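(* Let $K$ be a field with $\operatorname{char}(K)\neq 3$ and let $Y$ be a nonspecial Picard curve over $K$. Then there is a monic separable polynomial $f(x)=x^4+c_1x^3+c_2x^2+c_3x+c_4\in K[x]$ such that $Y$ is given over $K$ by the equation $$Y:\; y^3=f(x)=x^4+c_1x^3+c_2x^2+c_3x+c_4 .$$
   Context: Let $K$ be a field of characteristic different from $3$ with algebraic closure $\overline K$. Curves given by an affine equation are identified with the smooth projective curve with the same function field. A Picard curve $Y$ over $K$ is a smooth projective curve of genus $3$ over $K$ such that $Y_{\overline K}=Y\otimes_K\overline K$ admits a morphism $Y_{\overline K}\to\mathbb P^1_{\overline K}$ that is a Galois cover of degree $3$. Such a morphism corresponds to a subgroup $G\subset \mathrm{Aut}_{\overline K}(Y_{\overline K})$ of order $3$ such that $Y_{\overline K}/G$ has genus $0$; such a $G$ is called a distinguished subgroup of automorphisms. A Picard curve $Y$ over $K$ is special if $Y_{\overline K}$ has more than one distinguished subgroup of automorphisms, and nonspecial otherwise. *)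

(* Defs.v *)
From HB Require Import structures.
From mathcomp Require Import all_boot all_order all_algebra all_field.
From mathcomp Require Import boolp classical_sets functions cardinality fsbigop.
From mathcomp Require Import mpoly.

Set Implicit Arguments.
Unset Strict Implicit.
Unset Printing Implicit Defensive.

Import Order.TTheory GRing.Theory Num.Theory.

Local Open Scope classical_set_scope.
Local Open Scope ring_scope.

(* Field extensions E/k are given by a ring morphism j : k -> E. *)

Section Extensions.
Variables (k E : fieldType) (j : {rmorphism k -> E}).

Definition eval1 (x : E) (p : {poly k}) : E := (map_poly j p).[x].

(* In P : {poly {poly k}} the inner variable stands for x, the outer for y. *)
Definition eval2 (x y : E) (P : {poly {poly k}}) : E :=
  (map_poly (eval1 x) P).[y].

Definition simple_subfield (x : E) : set E :=
  [set z | exists p q : {poly k}, eval1 x q != 0 /\ z = eval1 x p / eval1 x q].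

Definition lin_indep n (f : 'I_n -> E) : Prop :=
  forall c : 'I_n -> k, \sum_(i < n) j (c i) * f i = 0 -> forall i, c i = 0.

Definition trdeg1 : Prop :=
  exists x : E, ~ algebraicOver j x /\
    forall y : E, exists2 P : {poly {poly k}}, P != 0 & eval2 x y P = 0.

(* E is the function field of the irreducible affine plane curve Q(x, y) = 0,
   i.e. E is k-isomorphic to Frac (k[x, y] / (Q)). *)
Definition function_field_of_equation (Q : {poly {poly k}}) : Prop :=
  exists x y : E,
    (forall P, eval2 x y P = 0 <-> exists R, P = R * Q) /\
    (forall z : E, exists P R,
        eval2 x y R != 0 /\ z = eval2 x y P / eval2 x y R).

Definition automorphism_group : set (E -> E) :=
  [set s : E -> E |
    [/\ {morph s : x y / x - y}, s 1 = 1, {morph s : x y / x * y},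
               bijective s & forall c, s (j c) = j c]].

Definition fixed_field (G : set (E -> E)) : set E :=
  [set z | forall s, G s -> s z = z].

Definition subgroup_of_automorphisms (G : set (E -> E)) : Prop :=
  [/\ G `<=` automorphism_group, G id,
      forall s t, G s -> G t -> G (s \o t)
    & forall s t, G s -> cancel s t -> cancel t s -> G t].

(* The element x, viewed as a morphism to the projective line, is a Galois
   cover of degree d: E / k(x) is Galois of degree d. *)
Definition galois_cover (x : E) (d : nat) : Prop :=
  let A := automorphism_group `&` [set s : E -> E | s x = x] in
  [/\ ~ algebraicOver j x, (A #= `I_d)%card
    & fixed_field A `<=` simple_subfield x].

(* Closed points of the smooth projective curve with function field E, as
   normalized discrete valuations of E / k. The value at 0, which should be
   +oo, is set to 0, so that a place is determined by its valuation. *)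
Record place := Place {
  ord :> E -> int;
  ord_zero : ord 0 = 0;
  ord_const : forall c, ord (j c) = 0;
  ord_mul : forall x y : E, x != 0 -> y != 0 -> ord (x * y) = ord x + ord y;
  ord_add : forall x y : E, x != 0 -> y != 0 -> x + y != 0 ->
           Num.min (ord x) (ord y) <= ord (x + y);
  ord_surj : exists x : E, x != 0 /\ ord x = 1
}.

HB.instance Definition _ := gen_eqMixin place.
HB.instance Definition _ := gen_choiceMixin place.

Definition is_divisor (D : place -> int) : Prop :=
  finite_set [set P | D P != 0].

Definition riemann_roch_space (D : place -> int) : set E :=
  [set f | f = 0 \/ forall P : place, - D P <= ord P f].

Definition has_dim (V : set E) (d : nat) : Prop :=
  exists b : 'I_d -> E,
    [/\ forall i, V (b i), lin_indep b
      & forall f, V f -> exists c : 'I_d -> k, f = \sum_(i < d) j (c i) * b i].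

End Extensions.

(* The constant field is algebraically closed, so all places have degree 1. *)
Definition deg (k : closedFieldType) (E : fieldType) (j : {rmorphism k -> E})
    (D : place j -> int) : int :=
  \sum_(P \in [set: place j]) D P.

(* g = max_D (deg D - l(D) + 1). *)
Definition has_genus (k : closedFieldType) (E : fieldType)
    (j : {rmorphism k -> E}) (g : nat) : Prop :=
  (forall (D : place j -> int) d, is_divisor D ->
     has_dim j (riemann_roch_space D) d ->
     deg D - d%:Z + 1 <= g%:Z) /\
  (exists (D : place j -> int) d,
     [/\ is_divisor D, has_dim j (riemann_roch_space D) d
      & deg D - d%:Z + 1 = g%:Z]).

(* The maps jF : F -> Fb and jK : Kb -> Fb exhibit the field Fb as the tensor
   product of F and Kb over K: surjectivity and injectivity of the map from
   the tensor product. *)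
Definition is_base_change (K Kb F Fb : fieldType) (iota : {rmorphism K -> Kb})
    (j : {rmorphism K -> F}) (jF : {rmorphism F -> Fb})
    (jK : {rmorphism Kb -> Fb}) : Prop :=
  [/\ forall c, jF (j c) = jK (iota c),
      forall z, exists n (f : 'I_n -> F) (c : 'I_n -> Kb),
        z = \sum_(i < n) jF (f i) * jK (c i)
    & forall n (f : 'I_n -> F), lin_indep j f -> lin_indep jK (jF \o f)].

(* The projective variety over K with generic point (u_0 : ... : u_n). *)
Section ProjectiveVariety.
Variables (K F : fieldType) (j : {rmorphism K -> F}).
Variables (n : nat) (u : 'I_n.+1 -> F).

Definition form_in_ideal (p : {mpoly K[n.+1]}) : Prop :=
  (exists d, p \is d.-homog) /\ mmap j u p = 0.

(* F consists of the quotients of forms of equal degree. *)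
Definition generates_function_field : Prop :=
  forall z : F, exists d (p q : {mpoly K[n.+1]}),
    [/\ p \is d.-homog, q \is d.-homog, mmap j u q != 0
      & z = mmap j u p / mmap j u q].

Variables (Kb : fieldType) (iota : {rmorphism K -> Kb}).

Definition geometric_point (a : 'I_n.+1 -> Kb) : Prop :=
  (exists i, a i != 0) /\ forall p, form_in_ideal p -> mmap iota a p = 0.

(* Jacobian criterion, for a variety of dimension 1. *)
Definition smooth_at (a : 'I_n.+1 -> Kb) : Prop :=
  exists p : 'I_n.-1 -> {mpoly K[n.+1]},
    (forall i, form_in_ideal (p i)) /\
    \rank (\matrix_(i < n.-1, l < n.+1) mmap iota a (mderiv l (p i))) = n.-1.

End ProjectiveVariety.

(* A smooth projective (geometrically integral) curve Y over K, given with a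
   projective embedding; geom_field is the function field of the base change
   of Y along iota : K -> Kb. *)
Record smooth_projective_curve (K Kb : fieldType) (iota : {rmorphism K -> Kb})
    := SmoothProjectiveCurve {
  fun_field : fieldType;
  fun_const : {rmorphism K -> fun_field};
  geom_field : fieldType;
  geom_const : {rmorphism Kb -> geom_field};
  geom_map : {rmorphism fun_field -> geom_field};
  ambient_dim : nat;
  generic_point : 'I_ambient_dim.+1 -> fun_field;
  curve_dim1 : trdeg1 fun_const;
  curve_base_change : is_base_change iota fun_const geom_map geom_const;
  generic_point_neq0 : exists i, generic_point i != 0;
  curve_fun_field : generates_function_field fun_const generic_point;
  curve_smooth : forall a : 'I_ambient_dim.+1 -> Kb,
    geometric_point fun_const generic_point iota a ->
    smooth_at fun_const generic_point iota a
}.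

(* Automorphisms of the base change Y_Kb of Y are identified with the
   Kb-automorphisms of its function field, and the quotient by G is the curve
   whose function field is the fixed field of G. *)
Section Picard.
Variables (K : fieldType) (Kb : closedFieldType) (iota : {rmorphism K -> Kb}).
Variable Y : smooth_projective_curve iota.

Definition quotient_has_genus
    (G : set (geom_field Y -> geom_field Y)) (g : nat) : Prop :=
  exists (E0 : fieldType) (j0 : {rmorphism Kb -> E0})
         (h : {rmorphism E0 -> geom_field Y}),
    [/\ forall c, h (j0 c) = geom_const Y c,
        range h = fixed_field G
      & has_genus j0 g].

Definition distinguished (G : set (geom_field Y -> geom_field Y)) : Prop :=
  [/\ subgroup_of_automorphisms (geom_const Y) G, (G #= `I_3)%card
    & quotient_has_genus G 0].

(* The genus of Y is the genus of its base change to Kb. *)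
Definition picard_curve : Prop :=
  has_genus (geom_const Y) 3 /\
  exists x : geom_field Y, galois_cover (geom_const Y) x 3.

Definition special_picard_curve : Prop :=
  picard_curve /\ exists G G', [/\ distinguished G, distinguished G' & G <> G'].

Definition nonspecial_picard_curve : Prop :=
  picard_curve /\ ~ special_picard_curve.

End Picard.

Definition given_by_equation (K Kb : fieldType) (iota : {rmorphism K -> Kb})
    (Y : smooth_projective_curve iota) (Q : {poly {poly K}}) : Prop :=
  function_field_of_equation (fun_const Y) Q.

(* Main.v *)
(* Over the algebraic closure, a Lagrange resolvent and a Moebius transformation turn
   the Galois cover into y^3 = g(x) with g separable; the genus being 3, one can take
   deg g = 4. The ramification point P at infinity is determined by the distinguished
   group, 1, x is a basis of L(3P) and 1, x, y one of L(4P) and of L(5P). As Y is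
   nonspecial, the group is unique, so the flag <1, x> < <1, x, y> depends only on Y.
   Take the reduced echelon form of these vectors with respect to K-independent functions
   on Y. If a coordinate were not in K, some field W between K and its closure would
   admit a K-embedding into the closure other than the inclusion, or a nonzero
   K-derivation, moving this coordinate. It extends to the function field over W, fixing
   the functions on Y. An embedding carries (x, y) to another quartic model; a
   derivation preserves regularity because, by smoothness, local rings are generated by
   functions on Y, so that it maps x into L(4P) and y into L(5P). In both cases the flag
   is preserved, and then so are the reduced coordinates: contradiction.
   Hence x and y can be chosen in the function field of Y; comparing coefficients in
   the cubic equation of y then makes the quartic and the completed cube rational, and
   scaling makes the quartic monic. *)
Require Import Defs.
From HB Require Import structures.
From mathcomp Require Import all_boot all_order all_algebra all_field.
From mathcomp Require Import boolp classical_sets functions cardinality fsbigop.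
From mathcomp Require Import mpoly.
From mathcomp Require Import ring zify.

Set Implicit Arguments.
Unset Strict Implicit.
Unset Printing Implicit Defensive.

Import Order.TTheory GRing.Theory Num.Theory.

Local Open Scope classical_set_scope.
Local Open Scope ring_scope.

(** * Subfields and linear algebra over a ring morphism *)

(** [K] need not be perfect, so the elements of [Kb] fixed by all [K]-automorphisms may exceed [K];
    a purely inseparable coordinate is detected only by a derivation. Hence the two kinds of moving
    maps. Both start from an intermediate field [W] containing all reduced coordinates and take
    values in [Kb], so no embedding has to be extended to an automorphism of [Kb]: the images are
    compared with the old flag inside [Fb]. For a derivation, pole orders only place the image of x
    in L(4P) = <1, x, y>, one dimension too many. Differentiating y^3 = g(x) and comparing
    coefficients of y shows that the unwanted coefficient times g' vanishes, and g' is nonzero as g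
    is separable. The group determines P because all five branch points are totally ramified, but y
    has order 1 at the four finite ones and -4, that is 2 modulo 3, at P: the local characters
    single P out. Genus and Riemann-Roch spaces are computed from explicit local parameters: at a
    totally ramified place the terms of p0 + p1 y + p2 y^2 have distinct orders modulo 3, so they
    cannot cancel. *)

Section Subfields.
Variable E : fieldType.

Record subfield := Subfield {
  subfield_set :> E -> Prop;
  subfield1 : subfield_set 1;
  subfieldB : forall x y,
    subfield_set x -> subfield_set y -> subfield_set (x - y);
  subfield_div : forall x y,
    subfield_set x -> subfield_set y -> subfield_set (x / y) }.

Definition subfield_pred (S : subfield) : {pred E} := fun x => `[< S x >].

Lemma subfield_predP (S : subfield) x : reflect (S x) (x \in subfield_pred S).
Proof. by rewrite unfold_in; exact: asboolP. Qed.

Lemma subfield_pred_closed (S : subfield) : divring_closed (subfield_pred S).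
Proof.
split; first exact/subfield_predP/subfield1.
- by move=> x y /subfield_predP Sx /subfield_predP Sy; apply/subfield_predP/subfieldB.
- by move=> x y /subfield_predP Sx /subfield_predP Sy; apply/subfield_predP/subfield_div.
Qed.

HB.instance Definition _ (S : subfield) :=
  GRing.isDivringClosed.Build E (subfield_pred S) (subfield_pred_closed S).

Record subfield_type (S : subfield) := SubfieldElt {
  subfield_val : E; _ : subfield_val \in subfield_pred S }.

HB.instance Definition _ (S : subfield) := [isSub for @subfield_val S].
HB.instance Definition _ (S : subfield) := [Choice of subfield_type S by <:].
HB.instance Definition _ (S : subfield) :=
  [SubChoice_isSubIntegralDomain of subfield_type S by <:].
HB.instance Definition _ (S : subfield) :=
  [SubIntegralDomain_isSubField of subfield_type S by <:].

(** Intermediate fields and fixed fields arise as subsets of a big field, but have to serve as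
    domains of ring morphisms; this turns the subset into a field type of its own. *)
Lemma subfieldP (S : subfield) :
  exists (W : fieldType) (h : {rmorphism W -> E}), range h = S :> set E.
Proof.
exists (subfield_type S : fieldType), (val : {rmorphism subfield_type S -> E}).
rewrite eqEsubset; split=> x /=.
  by case=> w _ <-; apply/subfield_predP; exact: valP.
by move=> /subfield_predP Sx; exists (SubfieldElt Sx).
Qed.

End Subfields.

Lemma rmorphismP (A B : pzRingType) (f : A -> B) :
  {morph f : x y / x - y} -> f 1 = 1 -> {morph f : x y / x * y} ->
  exists g : {rmorphism A -> B}, g =1 f.
Proof.
move=> fB f1 fM.
pose fA := GRing.isZmodMorphism.Build A B f fB.
pose fMM := GRing.isMonoidMorphism.Build A B f (f1, fM).
pose g : {rmorphism A -> B} := HB.pack f fA fMM.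
by exists g.
Qed.

Lemma rmorphism_factor (A W E : fieldType) (h : {rmorphism W -> E})
    (f : {rmorphism A -> E}) :
  (forall a, range h (f a)) -> exists g : {rmorphism A -> W}, forall a, h (g a) = f a.
Proof.
move=> fh.
have [g0 g0E] : exists g0 : A -> W, forall a, h (g0 a) = f a.
  have /choice [g0 g0E] : forall a, exists w, h w = f a.
    by move=> a; have [w _ <-] := fh a; exists w.
  by exists g0.
have [||| g gE] := @rmorphismP A W g0.
- by move=> x y; apply: (fmorph_inj h); rewrite g0E !rmorphB /= !g0E.
- by apply: (fmorph_inj h); rewrite g0E !rmorph1.
- by move=> x y; apply: (fmorph_inj h); rewrite g0E !rmorphM /= !g0E.
by exists g => a; rewrite gE.
Qed.

Section Independence.
Variables (k E : fieldType) (j : {rmorphism k -> E}).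

(** The same notion as [lin_indep], for arbitrary finite index types: monomial families below are
    indexed by sums of ordinals. *)
Definition indep (I : finType) (f : I -> E) : Prop :=
  forall c : I -> k, \sum_i j (c i) * f i = 0 -> forall i, c i = 0.

Lemma indep_enum (I : finType) (f : I -> E) :
  lin_indep j (f \o (@enum_val I I)) <-> indep f.
Proof.
split=> fI c c0 i.
  have -> : c i = (c \o (@enum_val I I)) (enum_rank i) by rewrite /= enum_rankK.
  apply: fI; rewrite -[RHS]c0 [RHS](reindex (@enum_val I I)) //=.
  by apply: onW_bij; apply: enum_val_bij.
have -> : c i = (c \o enum_rank) (enum_val i) by rewrite /= enum_valK.
apply: fI; rewrite -[RHS]c0 (reindex (@enum_val I I)) /=.
  by apply: eq_bigr => l _; rewrite enum_valK.
by apply: onW_bij; apply: enum_val_bij.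
Qed.

(* Families are started with 1, so that constants are visible on the first coordinate. *)
Lemma basis_extraction n (g : 'I_n -> E) :
  exists m (b : 'I_m.+1 -> E), [/\ b ord0 = 1, lin_indep j b
    & forall i, exists c : 'I_m.+1 -> k, g i = \sum_l j (c l) * b l].
Proof.
elim: n g => [|n IH] g.
  exists 0%N, (fun=> 1); split=> //; last by case.
  by move=> c; rewrite big_ord1 mulr1 => /eqP; rewrite fmorph_eq0 => /eqP c0 i; rewrite ord1.
have [m [b [b0 bI bg]]] := IH (g \o lift ord0).
have [[c gc]|Ng] := pselect (exists c : 'I_m.+1 -> k, g ord0 = \sum_l j (c l) * b l).
  exists m, b; split=> // i; case: (unliftP ord0 i) => [l ->|->]; first exact: bg.
  by exists c.
pose b' (i : 'I_m.+2) := if unlift ord_max i is Some l then b l else g ord0.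
have b'l l : b' (widen_ord (leqnSn _) l) = b l.
  rewrite /b'; have -> : widen_ord (leqnSn m.+1) l = lift ord_max l.
    by apply: val_inj; rewrite /= /bump leqNgt ltn_ord.
  by rewrite liftK.
have b'm : b' ord_max = g ord0 by rewrite /b' unlift_none.
exists m.+1, b'; split.
- by rewrite -b0 -b'l; congr b'; apply: val_inj.
- move=> c; rewrite big_ord_recr /= b'm.
  under eq_bigr do rewrite b'l.
  move=> c0; have cm0 : c ord_max = 0.
    apply: contrapT => /eqP cm; apply: Ng.
    exists (fun l => - c (widen_ord (leqnSn _) l) / c ord_max).
    have jc : j (c ord_max) != 0 by rewrite fmorph_eq0.
    apply: (mulfI jc); rewrite mulr_sumr.
    move/eqP: c0; rewrite addrC addr_eq0 => /eqP ->; rewrite -sumrN.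
    apply: eq_bigr => l _; rewrite !(rmorphM, rmorphN, fmorphV) /=.
    by field.
  move: c0; rewrite cm0 rmorph0 mul0r addr0 => /bI {}c0 i.
  case: (unliftP ord_max i) => [l ->|->] //.
  rewrite -[RHS](c0 l); congr c; apply: val_inj.
  by rewrite /= /bump leqNgt ltn_ord.
- move=> i; case: (unliftP ord0 i) => [l ->|->].
    have [c gc] := bg l; exists (fun i => if unlift ord_max i is Some l then c l else 0).
    rewrite [LHS]gc [RHS]big_ord_recr /= unlift_none rmorph0 mul0r addr0.
    apply: eq_bigr => q _; rewrite b'l.
    have -> : widen_ord (leqnSn m.+1) q = lift ord_max q.
      by apply: val_inj; rewrite /= /bump leqNgt ltn_ord.
    by rewrite liftK.
  exists (fun i => (i == ord_max)%:R); rewrite (bigD1 ord_max) //= eqxx rmorph1 mul1r b'm.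
  by rewrite big1 ?addr0 // => q /negPf ->; rewrite rmorph0 mul0r.
Qed.

Lemma basis_extraction_seq (s : seq E) :
  exists m (b : 'I_m.+1 -> E), [/\ b ord0 = 1, lin_indep j b
    & forall z, z \in s -> exists c : 'I_m.+1 -> k, z = \sum_l j (c l) * b l].
Proof.
have [m [b [b0 bI bg]]] := basis_extraction (fun i => nth 0 s i : E) (n := size s).
exists m, b; split=> // z zs; move: zs (zs); rewrite -{1}index_mem => zs1 zs.
have [c cE] := bg (Ordinal zs1); exists c; rewrite -cE /=.
by rewrite nth_index.
Qed.

End Independence.

(** * Base change *)

Section BaseChange.
Variables (K Kb F Fb : fieldType) (iota : {rmorphism K -> Kb}).
Variables (j : {rmorphism K -> F}) (jF : {rmorphism F -> Fb}).
Variable jK : {rmorphism Kb -> Fb}.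
Hypothesis H : is_base_change iota j jF jK.

Let jFj c : jF (j c) = jK (iota c). Proof. by case: H. Qed.

Lemma base_change_indep (I : finType) (f : I -> F) :
  indep j f -> indep jK (jF \o f).
Proof.
by case: H => _ _ H3 /indep_enum/H3 fI; apply/indep_enum.
Qed.

Lemma indep_descent (I : finType) (f : I -> F) :
  indep jK (jF \o f) -> indep j f.
Proof.
move=> fI c c0 i; apply: (fmorph_inj iota); rewrite rmorph0.
apply: (fI (iota \o c)); rewrite -[RHS](rmorph0 jF) -c0 rmorph_sum.
by apply: eq_bigr => l _ /=; rewrite rmorphM /= jFj.
Qed.

(** If [z0] were independent of the [z i] over [K], it would remain so over [Kb], against the given
    relation. So [z0] is a [K]-combination of them, and uniqueness of coefficients over [Kb]
    identifies [c] with its image. *)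
Lemma coefs_descent (I : finType) (z0 : F) (z : I -> F) (c : I -> Kb) :
  indep jK (jF \o z) -> jF z0 = \sum_i jK (c i) * jF (z i) ->
  exists2 c', c =1 iota \o c' & z0 = \sum_i j (c' i) * z i.
Proof.
move=> zI z0E.
pose zz (i : option I) := if i is Some l then z l else z0.
have [zzI|/existsNP[a /not_implyP[a0 /existsNP[i ai]]]] := pselect (indep j zz).
  have /(_ (fun i => if i is Some l then c l else -1)) := base_change_indep zzI.
  rewrite (bigD1 None) //= (reindex_omap (some : I -> option I) id) /=; last by case.
  rewrite z0E rmorphN1 mulN1r.
  under [X in - _ + X]eq_bigl do rewrite eqxx.
  rewrite addNr => /(_ erefl None) /eqP.
  by rewrite oppr_eq0 oner_eq0.
have sumE (b : option I -> K) : \sum_i j (b i) * zz i =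
    j (b None) * z0 + \sum_i j (b (Some i)) * z i.
  rewrite (bigD1 None) //= (reindex_omap (some : I -> option I) id) /=; last by case.
  by under [X in _ + X]eq_bigl do rewrite eqxx.
move: a0; rewrite sumE => a0.
have aN0 : a None != 0.
  apply/eqP => aN; apply: ai; move: a0; rewrite aN rmorph0 mul0r add0r.
  by move/(indep_descent zI) => aS; case: (i) => [l|//]; exact: aS.
have jaN0 : j (a None) != 0 by rewrite fmorph_eq0.
pose c' i := - a (Some i) / a None.
have z0E' : z0 = \sum_i j (c' i) * z i.
  apply: (mulfI jaN0); rewrite mulr_sumr; move/eqP: a0; rewrite addr_eq0 => /eqP ->.
  rewrite -sumrN; apply: eq_bigr => l _; rewrite /c' !(rmorphM, rmorphN, fmorphV) /=.
  by field.
exists c' => // m; apply/eqP; rewrite -subr_eq0; apply/eqP.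
apply: (zI (fun l => c l - iota (c' l))).
under eq_bigr do rewrite rmorphB mulrBl.
rewrite sumrB -z0E z0E' rmorph_sum; apply/eqP; rewrite subr_eq0; apply/eqP.
by apply: eq_bigr => l _; rewrite rmorphM /= jFj.
Qed.

(** The [Kb]-relations between the [z i] are spanned by the [K]-relations, so a linear form [ell]
    that is nonzero on one of the former is nonzero on one of the latter. In applications [ell]
    expresses that a denominator survives the descent. The proof is an induction on the support of
    [lam]; if no [K]-relation is supported there, the [z i] in the support are independent and [lam]
    is 0. *)
Lemma relation_descent (I : finType) (z : I -> F) (lam ell : I -> Kb) :
  \sum_i jK (lam i) * jF (z i) = 0 -> \sum_i ell i * lam i != 0 ->
  exists rho : I -> K, \sum_i j (rho i) * z i = 0 /\
    \sum_i ell i * iota (rho i) != 0.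
Proof.
move: {2}#|[pred i | lam i != 0]|.+1 (ltnSn #|[pred i | lam i != 0]|) => n.
elim: n lam => [//|n IH] lam lamn rel lamell.
have [[rho [[k rk] rsub relr]]|Nex] := pselect (exists rho : I -> K,
  [/\ exists k, rho k != 0, forall i, rho i != 0 -> lam i != 0
    & \sum_i j (rho i) * z i = 0]).
  have [er0|] := eqVneq (\sum_i ell i * iota (rho i)) 0; last by exists rho.
  have irk : iota (rho k) != 0 by rewrite fmorph_eq0.
  (* Subtracting this multiple of [rho] removes [k] from the support, and does not change the value
     of [ell] because [ell] vanishes on [rho]. *)
  apply: (IH (fun i => lam i - lam k / iota (rho k) * iota (rho i))).
  - rewrite ltnS in lamn; apply: leq_trans lamn; apply: proper_card.
    apply/fintype.properP; split.
      apply/fintype.subsetP => i; rewrite !inE; apply: contra => /eqP l0.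
      have [->|/rsub] := eqVneq (rho i) 0; last by rewrite l0 eqxx.
      by rewrite rmorph0 mulr0 subr0 l0.
    by exists k; rewrite !inE ?rsub // divfK // subrr eqxx.
  - under eq_bigr do rewrite rmorphB rmorphM mulrBl.
    rewrite sumrB rel sub0r; apply/eqP; rewrite oppr_eq0; apply/eqP.
    under eq_bigr do rewrite -mulrA.
    rewrite -mulr_sumr.
    have -> : \sum_i jK (iota (rho i)) * jF (z i) = jF (\sum_i j (rho i) * z i).
      by rewrite rmorph_sum; apply: eq_bigr => i _; rewrite rmorphM /= jFj.
    by rewrite relr rmorph0 mulr0.
  - have -> : \sum_i ell i * (lam i - lam k / iota (rho k) * iota (rho i)) =
      \sum_i ell i * lam i - lam k / iota (rho k) * \sum_i ell i * iota (rho i).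
      rewrite mulr_sumr -sumrB; apply: eq_bigr => i _; ring.
    by rewrite er0 mulr0 subr0.
suff lam0 : forall i, lam i = 0.
  by move: lamell; rewrite big1 ?eqxx // => i _; rewrite lam0 mulr0.
pose A := {i | lam i != 0}.
have AI : indep j (fun a : A => z (val a)).
  move=> c c0 a; apply: contrapT => /eqP ca; apply: Nex.
  have sumA (R : zmodType) (G : A -> R) : \sum_(i | lam i != 0)
      (if insub i is Some a then G a else 0) = \sum_a G a.
    rewrite (reindex_omap (val : A -> I) insub) /=; last first.
      by move=> i li; rewrite insubT.
    by apply: eq_big => [b|b _]; rewrite valK ?eqxx ?(valP b).
  exists (fun i => if (insub i : option A) is Some a then c a else 0); split.
  - by exists (val a); rewrite valK.
  - by move=> i; case: insubP => [u li _|]; rewrite ?eqxx.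
  - rewrite (bigID [pred i | lam i != 0]) /= [X in _ + X]big1 ?addr0; last first.
      by move=> i; case: insubP => [u li _|_ _]; rewrite ?li ?rmorph0 ?mul0r.
    rewrite -[RHS]c0 -sumA; apply: eq_bigr => i li.
    by rewrite (insubT (fun i => lam i != 0) li).
move=> i; apply: contrapT => /eqP li.
have /(_ (fun a => lam (val a))) := base_change_indep AI.
suff -> : \sum_(a : A) jK (lam (val a)) * (jF \o (fun a0 : A => z (val a0))) a = 0.
  by move=> /(_ erefl (Sub i li)) /=; exact/eqP.
rewrite -[RHS]rel [RHS](bigID [pred i | lam i != 0]) /= [X in _ + X]big1 ?addr0; last first.
  by move=> l /negPn/eqP ->; rewrite rmorph0 mul0r.
rewrite [RHS](reindex_omap (val : A -> I) insub) /=; last first.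
  by move=> l ll; rewrite insubT.
by apply: eq_bigl => b; rewrite valK eqxx (valP b).
Qed.

Definition pure_sum (s : seq (F * Kb)) : Fb := \sum_(p <- s) jF p.1 * jK p.2.

Lemma pure_sumP z : exists s, z = pure_sum s.
Proof.
case: H => _ H2 _; have [n [f [c ->]]] := H2 z.
by exists [seq (f i, c i) | i <- enum 'I_n]; rewrite /pure_sum big_map big_enum.
Qed.

Lemma base_change_ind (P : Fb -> Prop) :
  P 0 -> (forall x y, P x -> P y -> P (x + y)) -> (forall f c, P (jF f * jK c)) ->
  forall z, P z.
Proof.
move=> P0 PD Pp z; have [s ->] := pure_sumP z.
by rewrite /pure_sum; elim/big_rec: _ => // p w _ Pw; exact: PD.
Qed.

(** The universal property of the tensor product. A vanishing sum of pure tensors is rewritten in a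
    [K]-independent family, where all its coefficients in [Kb] are 0, so the value does not depend
    on the representation. [psi] is only assumed additive and [K]-semilinear, so as to cover
    derivations as well as ring morphisms. *)
Lemma base_change_extend (R : fieldType) (g : {rmorphism F -> R}) (psi : Kb -> R) :
  {morph psi : x y / x + y} -> (forall c w, psi (iota c * w) = g (j c) * psi w) ->
  exists Psi : Fb -> R, {morph Psi : x y / x + y} /\
    forall f c, Psi (jF f * jK c) = g f * psi c.
Proof.
move=> psiD psiZ.
have psi0 : psi 0 = 0 by apply: (addrI (psi 0)); rewrite -psiD !addr0.
pose ext (s : seq (F * Kb)) := \sum_(p <- s) g p.1 * psi p.2.
have psi_sum (I : finType) (G : I -> Kb) : psi (\sum_i G i) = \sum_i psi (G i).
  exact: (big_morph psi psiD psi0).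
have ext0 s : pure_sum s = 0 -> ext s = 0.
  move=> s0.
  have [m [b [_ bI bs]]] := basis_extraction_seq j [seq p.1 | p <- s].
  have /choice [c cE] : forall p : F * Kb, exists c : 'I_m.+1 -> K,
      p \in s -> p.1 = \sum_l j (c l) * b l.
    move=> p; have [ps|] := boolP (p \in s); last by exists (fun=> 0).
    by have [c cE] := bs _ (map_f fst ps); exists c.
  have coef0 l : \sum_(p <- s) iota (c p l) * p.2 = 0.
    apply: (base_change_indep bI (c := fun l => \sum_(p <- s) iota (c p l) * p.2)).
    rewrite -[RHS]s0 /pure_sum.
    under eq_bigr do rewrite rmorph_sum mulr_suml.
    rewrite exchange_big /= !big_seq; apply: eq_bigr => p ps.
    rewrite cE // rmorph_sum mulr_suml; apply: eq_bigr => q _.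
    by rewrite !rmorphM /= jFj; ring.
  rewrite /ext big_seq.
  under eq_bigr => p ps do rewrite cE // rmorph_sum mulr_suml.
  rewrite -big_seq exchange_big big1 //= => l _.
  under eq_bigr do rewrite rmorphM mulrAC -psiZ mulrC.
  rewrite -mulr_sumr -(big_morph psi psiD psi0).
  by rewrite coef0 psi0 mulr0.
have extE s t : pure_sum s = pure_sum t -> ext s = ext t.
  move=> st; have /ext0 : pure_sum (s ++ [seq (- p.1, p.2) | p <- t]) = 0.
    rewrite /pure_sum big_cat big_map /= -/(pure_sum s) st.
    under [X in _ + X]eq_bigr do rewrite rmorphN mulNr.
    by rewrite sumrN addrN.
  rewrite /ext big_cat big_map /=.
  under [X in _ + X]eq_bigr do rewrite rmorphN mulNr.
  by rewrite sumrN => /eqP; rewrite subr_eq0 => /eqP.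
have /choice [rep repE] := pure_sumP.
have PsiE s : ext (rep (pure_sum s)) = ext s by apply: extE; rewrite -repE.
exists (ext \o rep); split=> [x y|f c] /=.
  rewrite {1}(repE x) {1}(repE y).
  have -> : pure_sum (rep x) + pure_sum (rep y) = pure_sum (rep x ++ rep y).
    by rewrite /pure_sum big_cat.
  by rewrite PsiE /ext big_cat.
have -> : jF f * jK c = pure_sum [:: (f, c)] by rewrite /pure_sum big_seq1.
by rewrite PsiE /ext big_seq1.
Qed.

Lemma common_basis (n : nat) (z : 'I_n -> Fb) :
  exists m (b : 'I_m.+1 -> F) (w : 'I_n -> 'I_m.+1 -> Kb),
   [/\ b ord0 = 1, lin_indep j b & forall i, z i = \sum_l jF (b l) * jK (w i l)].
Proof.
have /choice [s sE] : forall i, exists s, z i = pure_sum s by move=> i; exact: pure_sumP.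
have [m [b [b0 bI bs]]] :=
  basis_extraction_seq j (flatten [seq [seq p.1 | p <- s i] | i <- enum 'I_n]).
have /choice [c cE] : forall p : F, exists c : 'I_m.+1 -> K,
    p \in (flatten [seq [seq p.1 | p <- s i] | i <- enum 'I_n]) -> p = \sum_l j (c l) * b l.
  move=> p; have [ps|] := boolP (p \in flatten [seq [seq p.1 | p <- s i] | i <- enum 'I_n]).
    by have [c cE] := bs _ ps; exists c.
  by exists (fun=> 0).
exists m, b, (fun i l => \sum_(p <- s i) iota (c p.1 l) * p.2); split=> // i.
rewrite sE /pure_sum.
under [RHS]eq_bigr do rewrite rmorph_sum mulr_sumr.
rewrite [RHS]exchange_big /= !big_seq; apply: eq_bigr => p ps.
rewrite {1}(cE p.1); last first.
  apply/flattenP; exists [seq p.1 | p <- s i]; last exact: map_f.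
  by apply/mapP; exists i; rewrite // mem_enum.
rewrite rmorph_sum mulr_suml; apply: eq_bigr => l _.
by rewrite !rmorphM /= jFj; ring.
Qed.

End BaseChange.

(** Dividing an annihilating polynomial by X as long as its constant term is 0 leaves z p(z) + c = 0
    with c nonzero, so the inverse is -p(z) / c. Thus a ring of algebraic elements containing the
    base field is a field. *)
Lemma algebraic_inverse (F E : fieldType) (jF : {rmorphism F -> E}) z :
  algebraicOver jF z -> z != 0 -> exists q : {poly F}, z * (map_poly jF q).[z] = 1.
Proof.
move=> [p p0 rp] z0.
elim/poly_ind: p p0 rp => [|p c IH]; first by rewrite eqxx.
move=> pc0; rewrite rmorphD rmorphM /= map_polyX map_polyC /= rootE.
rewrite !hornerE => /eqP pz.
have [c0|c0] := eqVneq c 0.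
  apply: IH; first by apply: contra_neq pc0 => ->; rewrite c0 mul0r addr0.
  move/eqP: pz; rewrite c0 rmorph0 addr0 mulf_eq0 (negPf z0) orbF.
  by rewrite rootE.
exists (- c^-1 *: p); rewrite linearZ /= hornerZ rmorphN fmorphV.
have jc : jF c != 0 by rewrite fmorph_eq0.
apply: (mulfI jc); rewrite mulr1 -[RHS]add0r -[in RHS]oppr0 -[in RHS]pz.
by field.
Qed.

Section Tower.
Variables (K Kb F Fb : fieldType) (iota : {rmorphism K -> Kb}).
Variables (j : {rmorphism K -> F}) (jF : {rmorphism F -> Fb}).
Variable jK : {rmorphism Kb -> Fb}.
Hypothesis H : is_base_change iota j jF jK.
Variables (W : fieldType) (a : {rmorphism K -> W}).

(** Transitivity of base change. A [W]-independent family, written in a [K]-independent family of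
    [F], has a coefficient matrix over [W] with independent rows; its rank does not change when the
    matrix is mapped into [Kb]. *)
Lemma base_change_cancel (b : {rmorphism W -> Kb}) (FW : fieldType)
    (jFW : {rmorphism F -> FW}) (jW : {rmorphism W -> FW})
    (bF : {rmorphism FW -> Fb}) :
  is_base_change a j jFW jW -> (forall c, bF (jFW c) = jF c) ->
  (forall w, bF (jW w) = jK (b w)) -> is_base_change b jW bF jK.
Proof.
move=> HW bFF bFW; split; first by [].
  case: H => _ H2 _ z; have [n [f [c ->]]] := H2 z.
  by exists n, (jFW \o f), c; apply: eq_bigr => i _ /=; rewrite bFF.
move=> n z zI.
have [m [f [w [_ fI zE]]]] := common_basis HW z.
pose A : 'M[W]_(n, m.+1) := \matrix_(i, l) w i l.
have Afree : row_free A.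
  rewrite -kermx_eq0; apply/rowV0P => u /sub_kermxP uA.
  have u0 : forall i, u 0 i = 0.
    apply: zI; under eq_bigr do rewrite zE mulr_sumr.
    rewrite exchange_big big1 //= => l _.
    have := congr1 (fun B : 'rV_m.+1 => jW (B 0 l) * jFW (f l)) uA.
    rewrite !mxE rmorph0 mul0r rmorph_sum mulr_suml => {2}<-.
    by apply: eq_bigr => i _; rewrite !mxE rmorphM /=; ring.
  by apply/rowP => i; rewrite u0 mxE.
move: Afree; rewrite -(row_free_map b) => Afree.
move=> c c0 i.
pose u : 'rV[Kb]_n := \row_i c i.
suff uA : u *m map_mx b A = 0.
  have u0 : u = 0 by apply: (row_free_inj Afree); rewrite uA mul0mx.
  by have := congr1 (fun B : 'rV_n => B 0 i) u0; rewrite !mxE.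
apply/rowP => l; rewrite !mxE; under eq_bigr do rewrite !mxE.
apply: (base_change_indep H fI (c := fun l => \sum_i c i * b (w i l))).
rewrite -[RHS]c0.
under eq_bigr do rewrite rmorph_sum mulr_suml.
rewrite exchange_big; apply: eq_bigr => q _ /=.
rewrite zE rmorph_sum mulr_sumr; apply: eq_bigr => r _.
by rewrite !rmorphM /= bFF bFW; ring.
Qed.

(** The field over [W] is realized inside [Fb] as the ring of sums of products of [F] and [W]. It is
    closed under inversion since all its elements are algebraic over [F]. *)
Lemma base_change_tower (b : {rmorphism W -> Kb}) :
  (forall c : Kb, algebraicOver iota c) -> (forall c, b (a c) = iota c) ->
  exists (FW : fieldType) (jFW : {rmorphism F -> FW}) (jW : {rmorphism W -> FW})
    (bF : {rmorphism FW -> Fb}),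
    [/\ is_base_change a j jFW jW, forall c, bF (jFW c) = jF c
      & forall w, bF (jW w) = jK (b w)].
Proof.
move=> Kalg ba.
pose S (z : Fb) := exists s : seq (F * W), z = \sum_(p <- s) jF p.1 * jK (b p.2).
have jFj c : jF (j c) = jK (iota c) by case: H.
have SF f : S (jF f) by exists [:: (f, 1)]; rewrite big_seq1 !rmorph1 mulr1.
have SW w : S (jK (b w)) by exists [:: (1, w)]; rewrite big_seq1 rmorph1 mul1r.
have SB x y : S x -> S y -> S (x - y).
  move=> [s ->] [t ->]; exists (s ++ [seq (- p.1, p.2) | p <- t]).
  rewrite big_cat big_map /= -sumrN; congr (_ + _).
  by apply: eq_bigr => p _; rewrite rmorphN mulNr.
have S0 : S 0 by exists [::]; rewrite big_nil.
have SD x y : S x -> S y -> S (x + y).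
  by move=> Sx Sy; rewrite -[y]opprK -[- y]sub0r; apply: (SB) => //; exact: SB.
have SM x y : S x -> S y -> S (x * y).
  move=> [s ->] [t ->]; exists [seq (p.1 * q.1, p.2 * q.2) | p <- s, q <- t].
  rewrite big_allpairs_dep /= mulr_suml; apply: eq_bigr => p _.
  by rewrite mulr_sumr; apply: eq_bigr => q _; rewrite !rmorphM /=; ring.
have Salg z : S z -> algebraicOver jF z.
  move=> [s ->]; elim/big_rec: _ => [|p w _]; first exact: algebraic0.
  apply: algebraic_add; apply: algebraic_mul; first exact: algebraic_id.
  have [q q0 rq] := Kalg (b p.2).
  exists (map_poly j q); first by rewrite map_poly_eq0.
  rewrite -map_poly_comp (eq_map_poly (g := jK \o iota)) // map_poly_comp.
  by rewrite fmorph_root.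
have SV z : S z -> S z^-1.
  have [->|z0] := eqVneq z 0; first by rewrite invr0.
  move=> Sz.
  have [q zq] := algebraic_inverse (Salg z Sz) z0.
  suff -> : z^-1 = (map_poly jF q).[z].
    rewrite horner_coef; elim/big_rec: _ => // i w _ Sw.
    apply: SD => //; apply: (SM); first by rewrite coef_map; exact: SF.
    elim: (i : nat) => [|n IH]; first by rewrite expr0 -(rmorph1 jF); exact: SF.
    by rewrite exprS; apply: SM.
  by apply: (mulfI z0); rewrite zq divff.
have Sdiv x y : S x -> S y -> S (x / y) by move=> Sx Sy; apply: SM => //; exact: SV.
have S1 : S 1 by rewrite -(rmorph1 jF); exact: SF.
have [FW [bF bFS]] := subfieldP (Subfield S1 SB Sdiv).
have bFP z : S z -> range bF z by rewrite bFS.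
have [jFW jFWE] := rmorphism_factor (fun f => bFP _ (SF f)).
have [jW jWE] := rmorphism_factor (h := bF) (f := jK \o b) (fun w => bFP _ (SW w)).
exists FW, jFW, jW, bF; split=> //; split.
- by move=> c; apply: (fmorph_inj bF); rewrite jFWE jWE /= ba jFj.
- move=> z; have : S (bF z) by rewrite -/(subfield_set (Subfield S1 SB Sdiv) _) -bFS.
  move=> [s zs]; pose p0 : F * W := (0, 0).
  exists (size s), (fun i => (nth p0 s i).1), (fun i => (nth p0 s i).2).
  apply: (fmorph_inj bF); rewrite zs rmorph_sum (big_nth p0) big_mkord.
  by apply: eq_bigr => i _; rewrite rmorphM /= jFWE jWE.
- move=> n f fI c c0 i; apply: (fmorph_inj b); rewrite rmorph0.
  apply: (base_change_indep H fI (c := b \o c)).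
  rewrite -[RHS](rmorph0 bF) -c0 rmorph_sum; apply: eq_bigr => l _.
  by rewrite rmorphM /= jFWE jWE.
Qed.

End Tower.

(** * Places *)

Section PlaceTheory.
Variables (k E : fieldType) (j : {rmorphism k -> E}).
Implicit Types (P Q : place j) (x y z : E).

Lemma place_ext P Q : (forall z, P z = Q z) -> P = Q.
Proof.
case: P Q => [f f0 fc fM fA fS] [g g0 gc gM gA gS] /= fg.
have {}fg : f = g by apply/funext.
by subst g; congr Place; apply: Prop_irrelevance.
Qed.

Lemma ord_one P : P 1 = 0.
Proof. by rewrite -(rmorph1 j) ord_const. Qed.

Lemma ordN P z : P (- z) = P z.
Proof.
have [->|z0] := eqVneq z 0; first by rewrite oppr0.
by rewrite -mulN1r ord_mul ?oppr_eq0 ?oner_eq0 // -(rmorphN1 j) ord_const add0r.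
Qed.

Lemma ordV P z : P z^-1 = - P z.
Proof.
have [->|z0] := eqVneq z 0; first by rewrite invr0 ord_zero oppr0.
have := ord_one P; rewrite -(divff z0) ord_mul ?invr_eq0 // => /eqP.
by rewrite addrC addr_eq0 => /eqP.
Qed.

Lemma ord_div P y z : y != 0 -> z != 0 -> P (y / z) = P y - P z.
Proof. by move=> y0 z0; rewrite ord_mul ?invr_eq0 // ordV. Qed.

Lemma ordX P z n : P (z ^+ n) = n%:Z * P z.
Proof.
have [->|z0] := eqVneq z 0.
  by rewrite expr0n; case: n => [|n]; rewrite /= ?ord_one ord_zero mulr0.
elim: n => [|n IH]; first by rewrite ord_one mul0r.
by rewrite exprS ord_mul ?expf_eq0 ?(negPf z0) ?andbF // IH; lia.
Qed.

Lemma ordXz P z (n : int) : P (z ^ n) = n * P z.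
Proof.
case: n => n; first by rewrite -exprnP ordX.
by rewrite NegzE -exprnN ordV ordX mulNr.
Qed.

Lemma ord_prod P (I : eqType) (r : seq I) (f : I -> E) :
  (forall i, i \in r -> f i != 0) -> P (\prod_(i <- r) f i) = \sum_(i <- r) P (f i).
Proof.
elim: r => [|i r IH] fr; first by rewrite !big_nil ord_one.
have f0 : \prod_(i <- r) f i != 0.
  by rewrite prodf_seq_neq0; apply/allP => l lr; rewrite implyTb fr // inE lr orbT.
rewrite !big_cons ord_mul ?IH // ?fr ?mem_head //.
by move=> l lr; rewrite fr // inE lr orbT.
Qed.

(** A place takes the conventional value 0 at 0; this predicate restores the usual convention that 0
    has infinite order, so that it is stable under sums and products. *)
Definition vge P (n : int) z := (z == 0) || (n <= P z).

Lemma vge0 P n : vge P n 0. Proof. by rewrite /vge eqxx. Qed.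

Lemma vge_ord P z : vge P (P z) z. Proof. by rewrite /vge lexx orbT. Qed.

Lemma vgeP P n z : z != 0 -> vge P n z = (n <= P z).
Proof. by rewrite /vge => /negPf ->. Qed.

Lemma vge_le P m n z : m <= n -> vge P n z -> vge P m z.
Proof. by move=> mn /orP[/eqP->|nz]; rewrite ?vge0 // /vge (le_trans mn nz) orbT. Qed.

Lemma vgeD P n y z : vge P n y -> vge P n z -> vge P n (y + z).
Proof.
have [->|y0] := eqVneq y 0; first by rewrite add0r.
have [->|z0] := eqVneq z 0; first by rewrite addr0.
have [->|yz0] := eqVneq (y + z) 0; first by rewrite vge0.
rewrite !vgeP // => ny nz; apply: le_trans (ord_add P y0 z0 yz0).
by rewrite le_min ny.
Qed.

Lemma vgeN P n z : vge P n (- z) = vge P n z.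
Proof. by rewrite /vge oppr_eq0 ordN. Qed.

Lemma vgeB P n y z : vge P n y -> vge P n z -> vge P n (y - z).
Proof. by move=> ny nz; rewrite vgeD ?vgeN. Qed.

Lemma vgeM P m n y z : vge P m y -> vge P n z -> vge P (m + n) (y * z).
Proof.
have [->|y0] := eqVneq y 0; first by rewrite mul0r => *; exact: vge0.
have [->|z0] := eqVneq z 0; first by rewrite mulr0 => *; exact: vge0.
by rewrite !vgeP ?mulf_neq0 // ord_mul // => my nz; exact: lerD.
Qed.

Lemma vgeM0 P n y z : vge P 0 y -> vge P n z -> vge P n (y * z).
Proof. by move=> y0 nz; rewrite -[n]add0r vgeM. Qed.

Lemma vge_sum P n (I : Type) (r : seq I) (p : pred I) (f : I -> E) :
  (forall i, p i -> vge P n (f i)) -> vge P n (\sum_(i <- r | p i) f i).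
Proof. by move=> fr; elim/big_ind: _ => //; [exact: vge0|exact: vgeD]. Qed.

Lemma vge_const P c : vge P 0 (j c).
Proof. by rewrite /vge ord_const lexx orbT. Qed.

Lemma vgeX P n z : vge P 0 z -> vge P 0 (z ^+ n).
Proof.
move=> z0; elim: n => [|n IH]; first by rewrite expr0 -(rmorph1 j) vge_const.
by rewrite exprS vgeM0.
Qed.

Lemma vge_eval1 P z p : vge P 0 z -> vge P 0 (eval1 j z p).
Proof.
move=> z0; rewrite /eval1 horner_coef; apply: vge_sum => i _.
by rewrite coef_map vgeM0 ?vge_const ?vgeX.
Qed.

Lemma ordD_lt P y z : y != 0 -> vge P (P y + 1) z -> y + z != 0 /\ P (y + z) = P y.
Proof.
move=> y0 yz.
have Ny : ~~ vge P (P y + 1) y by rewrite vgeP // -ltNge ltrDl.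
have s0 : y + z != 0.
  apply: contra Ny; rewrite addr_eq0 => /eqP yE.
  by rewrite {2}yE vgeN.
split=> //; apply/eqP; rewrite eq_le; apply/andP; split.
  rewrite leNgt; apply: contra Ny => lt; rewrite -{2}[y](addrK z).
  by apply: vgeB => //; rewrite vgeP // lezD1.
by rewrite -vgeP // vgeD ?vge_ord //; apply: vge_le yz; lia.
Qed.

Lemma ord_sub_const P z c c' : c != c' -> vge P 1 (z - j c) ->
  z - j c' != 0 /\ P (z - j c') = 0.
Proof.
move=> cc' zc.
have cc0 : j (c - c') != 0 by rewrite fmorph_eq0 subr_eq0.
have -> : z - j c' = j (c - c') + (z - j c) by rewrite rmorphB; ring.
have [] := @ordD_lt P (j (c - c')) (z - j c) cc0; last by rewrite ord_const.
by rewrite ord_const.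
Qed.

End PlaceTheory.

Section RegularPoint.
Variables (k E : fieldType) (j : {rmorphism k -> E}) (T : comNzRingType).
Variables (phi : {rmorphism T -> E}) (ev : {rmorphism T -> k}) (cst : k -> T) (t : T).

(* [ev] is a point of the affine curve with coordinate ring [phi T], at which
   [t] is a local parameter. *)
Record regular_point : Prop := RegularPoint {
  rp_phi_cst : forall c, phi (cst c) = j c;
  rp_ev_cst : forall c, ev (cst c) = c;
  rp_ker : forall u, phi u = 0 -> ev u = 0;
  rp_t : ev t = 0;
  rp_t0 : phi t != 0;
  rp_factor : forall u, phi u != 0 -> exists m s0 s1,
    [/\ ev s0 != 0, ev s1 != 0 & phi s0 * phi u = phi t ^+ m * phi s1];
  rp_frac : forall z, exists u v, phi v != 0 /\ z = phi u / phi v }.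

(** The valuation ring of the place dominates the local ring of the point. *)
Definition centered (P : place j) := forall u, ev u = 0 -> vge P 1 (phi u).

(** By the third premise a function vanishing at the point can be divided by [t] up to a local unit.
    The fourth says that a multiple of [u] is a power of [t] times a unit; its exponent bounds the
    number of such divisions and drives the induction. *)
Lemma rp_factorI :
  (forall u, phi u = 0 -> ev u = 0) -> phi t != 0 ->
  (forall u, ev u = 0 ->
    exists s u1, ev s != 0 /\ phi s * phi u = phi t * phi u1) ->
  (forall u, phi u != 0 -> exists u' m s0 s1,
    [/\ ev s0 != 0, ev s1 != 0 & phi s0 * phi u * phi u' = phi t ^+ m * phi s1]) ->
  forall u, phi u != 0 -> exists m s0 s1,
    [/\ ev s0 != 0, ev s1 != 0 & phi s0 * phi u = phi t ^+ m * phi s1].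
Proof.
move=> ker t0 H1 H2 u u0; have [u' [m [s0 [s1 [es0 es1 eq]]]]] := H2 u u0.
elim: m u u0 s0 s1 es0 es1 eq => [|m IH] u u0 s0 s1 es0 es1 eq.
  have [eu|eu] := eqVneq (ev u) 0; last first.
    by exists 0%N, 1, u; rewrite !rmorph1 oner_eq0 expr0 !mul1r.
  have /ker : phi (s0 * u * u' - s1) = 0.
    by rewrite rmorphB !rmorphM /= eq expr0 mul1r subrr.
  rewrite rmorphB !rmorphM /= eu mulr0 mul0r sub0r => /eqP.
  by rewrite oppr_eq0 (negPf es1).
have [eu|eu] := eqVneq (ev u) 0; last first.
  by exists 0%N, 1, u; rewrite !rmorph1 oner_eq0 expr0 !mul1r.
have [s [u1 [es su]]] := H1 u eu.
have s0' : phi s != 0 by apply: contra_neq es => /ker.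
have u10 : phi u1 != 0.
  by apply: contra_neq (mulf_neq0 s0' u0); rewrite su => ->; rewrite mulr0.
have [|||n [r0 [r1 [er0 er1 eqr]]]] := IH u1 u10 s0 (s * s1); first by [].

- by rewrite rmorphM mulf_neq0.
- apply: (mulfI t0); rewrite rmorphM.
  have -> : phi t * (phi s0 * phi u1 * phi u') = phi s0 * phi u' * (phi t * phi u1) by ring.
  rewrite -su.
  have -> : phi s0 * phi u' * (phi s * phi u) = phi s * (phi s0 * phi u * phi u') by ring.
  by rewrite eq exprS; ring.
exists n.+1, (r0 * s), r1; split=> //; first by rewrite rmorphM mulf_neq0.
by rewrite rmorphM -mulrA su mulrCA eqr exprS mulrA.
Qed.

Hypothesis R : regular_point.

Let ker := rp_ker R.
Let t0 := rp_t0 R.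

Let unit_neq0 s : ev s != 0 -> phi s != 0.
Proof. by apply: contra_neq => /ker. Qed.

Lemma rp_expansion z : z != 0 -> exists m s0 s1,
  [/\ ev s0 != 0, ev s1 != 0 & z = phi t ^ m * (phi s1 / phi s0)].
Proof.
have [u [v [v0 ->]]] := rp_frac R z; rewrite mulf_eq0 invr_eq0 negb_or v0 andbT => u0.
have [m [s0 [s1 [es0 es1 eqs]]]] := rp_factor R u0.
have [n [r0 [r1 [er0 er1 eqr]]]] := rp_factor R v0.
exists (m%:Z - n%:Z), (s0 * r1), (s1 * r0); rewrite !rmorphM !mulf_neq0 //; split=> //.
rewrite expfzDr // -invr_expz -!exprnP.
have -> : phi u = phi t ^+ m * phi s1 / phi s0 by rewrite -eqs mulrC mulKf ?unit_neq0.
have -> : phi v = phi t ^+ n * phi r1 / phi r0 by rewrite -eqr mulrC mulKf ?unit_neq0.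
have tn : phi t ^+ n != 0 by rewrite expf_neq0.
have r0' := unit_neq0 er0. have r1' := unit_neq0 er1. have s0' := unit_neq0 es0.
by field; rewrite r1' r0' s0' tn.
Qed.

Lemma rp_uniq m n s0 s1 r0 r1 :
  ev s0 != 0 -> ev s1 != 0 -> ev r0 != 0 -> ev r1 != 0 ->
  phi t ^ m * (phi s1 / phi s0) = phi t ^ n * (phi r1 / phi r0) -> m = n.
Proof.
wlog mn : m n s0 s1 r0 r1 / m <= n.
  move=> wl es0 es1 er0 er1 eq; have [mn|nm] := leP m n; first exact: wl eq.
  by apply/esym; apply: wl (esym eq) => //; exact: ltW.
move=> es0 es1 er0 er1 eq.
have [d dE] : exists d : nat, n = m + d%:Z by exists `|n - m|%N; lia.
move: eq; rewrite dE; case: d dE => [|d] dE; first by rewrite addr0.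
rewrite expfzDr // -mulrA => /(mulfI (expfz_neq0 m t0)); rewrite -exprnP => eq.
have /ker : phi (s1 * r0 - t ^+ d.+1 * r1 * s0) = 0.
  apply/eqP; rewrite rmorphB !rmorphM subr_eq0 /= rmorphXn; apply/eqP.
  rewrite -(divfK (unit_neq0 es0) (phi s1)) eq.
  by field; rewrite unit_neq0.
rewrite rmorphB !rmorphM rmorphXn /= (rp_t R) exprS !mul0r subr0 => /eqP.
by rewrite mulf_eq0 (negPf es1) (negPf er0).
Qed.

(** The order of an element is the exponent of [t] in its expansion as a power of [t] times a unit,
    which is well defined by [rp_uniq]. *)
Lemma rp_place : exists P : place j, centered P.
Proof.
have /choice [o oE] : forall z : E, exists m : int,
    (z = 0 -> m = 0) /\ (z != 0 -> exists s0 s1,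
      [/\ ev s0 != 0, ev s1 != 0 & z = phi t ^ m * (phi s1 / phi s0)]).
  move=> z; have [->|z0] := eqVneq z 0; first by exists 0; split=> // /negP.
  have [m [s0 [s1 zE]]] := rp_expansion z0.
  exists m; split=> [ez|_]; last by exists s0, s1.
  by rewrite ez eqxx in z0.
have oZ : o 0 = 0 by exact: (oE 0).1.
have oU m s0 s1 : ev s0 != 0 -> ev s1 != 0 -> o (phi t ^ m * (phi s1 / phi s0)) = m.
  move=> es0 es1; set z := phi t ^ m * _.
  have z0 : z != 0.
    apply: mulf_neq0; first exact: expfz_neq0.
    by apply: mulf_neq0; rewrite ?invr_eq0; apply: unit_neq0.
  have [r0 [r1 [er0 er1 zE]]] := (oE z).2 z0.
  by apply/esym; apply: rp_uniq zE.
have e1 : ev 1 != 0 by rewrite rmorph1 oner_eq0.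
have oc c : o (j c) = 0.
  have [->|c0] := eqVneq c 0; first by rewrite rmorph0.
  have := oU 0 1 (cst c) e1; rewrite (rp_ev_cst R) expr0z rmorph1 divr1 mul1r.
  by rewrite (rp_phi_cst R); apply.
have oM x y : x != 0 -> y != 0 -> o (x * y) = o x + o y.
  move=> x0 y0; have [s0 [s1 [es0 es1 xE]]] := (oE x).2 x0.
  have [r0 [r1 [er0 er1 yE]]] := (oE y).2 y0.
  rewrite {1}xE {1}yE -(oU (o x + o y) (s0 * r0) (s1 * r1)) ?rmorphM ?mulf_neq0 //.
  by congr o; rewrite /= invfM expfzDr //; ring.
have oA x y : x != 0 -> y != 0 -> x + y != 0 -> Num.min (o x) (o y) <= o (x + y).
  wlog xy : x y / o x <= o y.
    move=> wl x0 y0 xy0; have [xy|yx] := leP (o x) (o y).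
      by have := wl x y xy x0 y0 xy0; rewrite min_l.
    have := wl y x (ltW yx) y0 x0; rewrite addrC => /(_ xy0).
    by rewrite min_l // ltW.
  move=> x0 y0 xy0; rewrite min_l //.
  have [s0 [s1 [es0 es1 xE]]] := (oE x).2 x0.
  have [r0 [r1 [er0 er1 yE]]] := (oE y).2 y0.
  have [d dE] : exists d : nat, o y = o x + d%:Z by exists `|o y - o x|%N; lia.
  (* After the common power of [t] is taken out, [q] is the numerator of [x + y]; factoring it can
     only raise the exponent. *)
  pose q := s1 * r0 + t ^+ d * r1 * s0.
  have s0' := unit_neq0 es0. have r0' := unit_neq0 er0.
  have xyE : x + y = phi t ^ (o x) * (phi q / phi (s0 * r0)).
    rewrite {1}xE {1}yE dE expfzDr // /q !rmorphD !rmorphM /= rmorphXn -exprnP.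
    by field; rewrite s0' r0'.
  have q0 : phi q != 0.
    by apply: contra_neq xy0; rewrite xyE => ->; rewrite mul0r mulr0.
  have [m [u0 [u1 [eu0 eu1 qE]]]] := rp_factor R q0.
  have u0' := unit_neq0 eu0.
  rewrite xyE.
  have -> : phi t ^ o x * (phi q / phi (s0 * r0)) =
      phi t ^ (o x + m%:Z) * (phi u1 / phi (u0 * (s0 * r0))).
    rewrite expfzDr // -exprnP !rmorphM.
    have -> : phi q = phi t ^+ m * phi u1 / phi u0 by rewrite -qE mulrC mulKf.
    by field; rewrite s0' r0' u0'.
  by rewrite oU ?rmorphM ?mulf_neq0 // lerDl.
have ot : o (phi t) = 1.
  by have := oU 1 1 1 e1 e1; rewrite expr1z rmorph1 divr1 mulr1.
have oS : exists x : E, x != 0 /\ o x = 1 by exists (phi t).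
exists (Place oZ oc oM oA oS) => u eu; apply/orP.
have [->|u0] := eqVneq (phi u) 0; [by left|right].
have [[|m] [s0 [s1 [es0 es1 uE]]]] := rp_factor R u0.
  have /ker : phi (s0 * u - s1) = 0 by rewrite rmorphB rmorphM uE expr0 mul1r subrr.
  by rewrite rmorphB rmorphM /= eu mulr0 sub0r => /eqP; rewrite oppr_eq0 (negPf es1).
have -> : phi u = phi t ^ (m.+1%:Z) * (phi s1 / phi s0).
  by rewrite -exprnP mulrA -uE mulrC mulKf ?unit_neq0.
by rewrite /= oU.
Qed.

Section Centered.
Variable P : place j.
Hypothesis cP : centered P.

Lemma centered_unit u : ev u != 0 -> P (phi u) = 0.
Proof.
move=> eu; have /cP : ev (u - cst (ev u)) = 0 by rewrite rmorphB (rp_ev_cst R) subrr.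
rewrite rmorphB (rp_phi_cst R) => uc.
have je : j (ev u) != 0 by rewrite fmorph_eq0.
have [] := @ordD_lt _ _ _ P (j (ev u)) (phi u - j (ev u)) je.
  by rewrite ord_const add0r.
by rewrite addrC subrK ord_const.
Qed.

Lemma centered_integral u : vge P 0 (phi u).
Proof.
have [/cP|/centered_unit eu] := eqVneq (ev u) 0; first exact: vge_le.
by rewrite /vge eu lexx orbT.
Qed.

Lemma centered_expansion m s0 s1 : ev s0 != 0 -> ev s1 != 0 ->
  P (phi t ^ m * (phi s1 / phi s0)) = m * P (phi t).
Proof.
move=> es0 es1; have s00 := unit_neq0 es0; have s10 := unit_neq0 es1.
rewrite ord_mul ?expfz_neq0 ?mulf_neq0 ?invr_eq0 // ordXz ord_div //.
by rewrite (centered_unit es0) (centered_unit es1) subrr addr0.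
Qed.

(** Every order is a multiple of the order of [t], since units have order 0; as places are
    normalized, some order is 1. *)
Lemma centered_param : P (phi t) = 1.
Proof.
have := cP (rp_t R); rewrite vgeP // => t1.
have [z [z0 z1]] := ord_surj P.
have [m [s0 [s1 [es0 es1 zE]]]] := rp_expansion z0.
move: z1 t1; rewrite zE centered_expansion //; move: (P (phi t)) => e me e1.
have [m1|m1] : m <= 0 \/ 1 <= m by lia.
  by nia.
by have : m * e >= m; nia.
Qed.

Lemma centered_local z : vge P 0 z -> exists u s, ev s != 0 /\ z = phi u / phi s.
Proof.
have [->|z0] := eqVneq z 0.
  by exists 0, 1; rewrite rmorph1 oner_eq0 rmorph0 mul0r.
rewrite vgeP //; have [m [s0 [s1 [es0 es1 zE]]]] := rp_expansion z0.
rewrite zE centered_expansion // centered_param mulr1.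
case: m zE => // m zE _; exists (t ^+ m * s1), s0; split=> //.
by rewrite rmorphM rmorphXn /= mulrA exprnP.
Qed.

Lemma centered_residue z : vge P 0 z -> exists c, vge P 1 (z - j c).
Proof.
move=> /centered_local [u [s [es ->]]]; exists (ev u / ev s).
have s0 := unit_neq0 es.
have es' : j (ev s) != 0 by rewrite fmorph_eq0.
have -> : phi u / phi s - j (ev u / ev s) =
   phi (cst (ev s) * u - cst (ev u) * s) * (phi s * j (ev s))^-1.
  by rewrite rmorphB !rmorphM fmorphV !(rp_phi_cst R) /=; field; rewrite s0 es'.
rewrite -[1]addr0; apply: vgeM.
  by apply: cP; rewrite rmorphB !rmorphM !(rp_ev_cst R) mulrC subrr.
by rewrite /vge ordV ord_mul // centered_unit // ord_const addr0 oppr0 lexx orbT.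
Qed.

End Centered.

Lemma centered_uniq P Q : centered P -> centered Q -> P = Q.
Proof.
move=> cP cQ; apply: place_ext => z.
have [->|z0] := eqVneq z 0; first by rewrite !ord_zero.
have [m [s0 [s1 [es0 es1 ->]]]] := rp_expansion z0.
by rewrite !centered_expansion ?centered_param.
Qed.

End RegularPoint.

(** * Dimension and genus *)

Section Dimension.
Variables (k E : fieldType) (j : {rmorphism k -> E}).

Lemma indep_leq_dim n d (v : 'I_n -> E) (b : 'I_d -> E) : lin_indep j v ->
  (forall i, exists c : 'I_d -> k, v i = \sum_(l < d) j (c l) * b l) -> (n <= d)%N.
Proof.
move=> vI /choice [c cE]; pose A : 'M[k]_(n, d) := \matrix_(i, l) c i l.
suff Afree : row_free A by rewrite -(eqP Afree); exact: rank_leq_col.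
rewrite -kermx_eq0; apply/rowV0P => u /sub_kermxP uA.
have u0 : forall i, u 0 i = 0.
  apply: vI; under eq_bigr do rewrite cE mulr_sumr.
  rewrite exchange_big big1 //= => l _.
  have := congr1 (fun B : 'rV_d => j (B 0 l) * b l) uA.
  rewrite !mxE rmorph0 mul0r rmorph_sum mulr_suml => {2}<-.
  by apply: eq_bigr => i _; rewrite !mxE rmorphM mulrA.
by apply/rowP => i; rewrite u0 mxE.
Qed.

Lemma riemann_rochP (D : place j -> int) f :
  riemann_roch_space D f <-> forall P, vge P (- D P) f.
Proof.
split=> [[-> P|fD P]|fD]; [exact: vge0|by rewrite /vge fD orbT|].
by have [->|f0] := eqVneq f 0; [left|right=> P; rewrite -vgeP].
Qed.

(** All places have degree one. This is not built into [place]; it is verified later for the curves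
    at hand, by centering each place at a regular point. *)
Hypothesis residue : forall (P : place j) z,
  vge P 0 z -> exists c, vge P 1 (z - j c).

(** Removing one point from a divisor costs at most one dimension: a member [v i0] of exact pole
    order at [P] is the pivot, and the residue of [v i / v i0] is the multiple of it to be
    subtracted from [v i]. *)
Lemma indep_drop n (v : 'I_n.+1 -> E) (P : place j) (D D' : place j -> int) :
  (forall Q, D' Q = D Q + (P == Q)%:Z) -> lin_indep j v ->
  (forall i, riemann_roch_space D' (v i)) ->
  exists w : 'I_n -> E, lin_indep j w /\ forall i, riemann_roch_space D (w i).
Proof.
move=> D'E vI vD'.
have inD w : riemann_roch_space D' w -> vge P (- D P) w -> riemann_roch_space D w.
  move=> /riemann_rochP wD' wP; apply/riemann_rochP => Q.
  have [<-//|PQ] := eqVneq P Q.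
  by have := wD' Q; rewrite D'E (negPf PQ) addr0.
have [[i0 i0P]|all] := pselect (exists i, ~~ vge P (- D P) (v i)); last first.
  exists (v \o lift ord0); split=> [c c0 i|i]; last first.
    by apply: inD; [exact: vD'|]; apply/negPn/negP => ni; apply: all; exists (lift ord0 i).
  have := vI (fun i => if unlift ord0 i is Some l then c l else 0).
  rewrite big_ord_recl unlift_none rmorph0 mul0r add0r.
  under eq_bigr do rewrite liftK.
  by move=> /(_ c0 (lift ord0 i)); rewrite liftK.
have v00 : v i0 != 0 by apply: contraNneq i0P => ->; exact: vge0.
have ordv0 : P (v i0) = - D' P.
  have := vD' i0 => /riemann_rochP/(_ P); rewrite vgeP // D'E eqxx.
  by move: i0P; rewrite vgeP //; lia.
have /choice [c cP] : forall i, exists c, vge P (- D P) (v i - j c * v i0).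
  move=> i; have /residue [c cP] : vge P 0 (v i / v i0).
    rewrite -(addrN (- D' P)); apply: vgeM; first by have /riemann_rochP := vD' i.
    by rewrite /vge ordV ordv0 lexx orbT.
  exists c; have -> : v i - j c * v i0 = (v i / v i0 - j c) * v i0 by field.
  have -> : - D P = 1 + P (v i0) by rewrite ordv0 D'E eqxx; lia.
  by apply: vgeM => //; exact: vge_ord.
exists (fun i => v (lift i0 i) - j (c (lift i0 i)) * v i0); split=> [a a0 i|i]; last first.
  apply: inD; last exact: cP.
  apply/riemann_rochP => Q; apply: vgeB; first by have /riemann_rochP := vD' (lift i0 i).
  apply: vgeM0; first exact: vge_const.
  by have /riemann_rochP := vD' i0.
have := vI (fun i => if unlift i0 i is Some l then a l
                     else - \sum_l a l * c (lift i0 l)).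
rewrite (bigD1 i0) //= unlift_none.
rewrite (reindex_omap (lift i0) (unlift i0)) /=; last first.
  by move=> l; case: unliftP => [m ->|->]; rewrite ?eqxx.
under [X in _ + X]eq_bigl do rewrite liftK eqxx eq_sym neq_lift.
under [X in _ + X]eq_bigr do rewrite liftK.
move=> /(_ _ (lift i0 i)); rewrite liftK; apply; rewrite -[RHS]a0.
under [RHS]eq_bigr do rewrite mulrBr.
rewrite sumrB addrC; congr (_ + _); rewrite rmorphN mulNr rmorph_sum mulr_suml.
by congr (- _); apply: eq_bigr => l _; rewrite rmorphM mulrA.
Qed.

Lemma indep_drop_seq n (s : seq (place j)) (v : 'I_(size s + n) -> E)
    (D D' : place j -> int) :
  (forall Q, D' Q = D Q + (count_mem Q s)%:Z) -> lin_indep j v ->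
  (forall i, riemann_roch_space D' (v i)) ->
  exists w : 'I_n -> E, lin_indep j w /\ forall i, riemann_roch_space D (w i).
Proof.
elim: s v D' => [|P s IH] v D' D'E vI vD'.
  exists v; split=> // i; have -> : D = D'; last exact: vD'.
  by apply/funext => Q; rewrite D'E addr0.
have [|w [wI wD]] := @indep_drop (size s + n) v P
    (fun Q => D Q + (count_mem Q s)%:Z) D' _ vI vD'.
  by move=> Q; rewrite D'E /= PoszD; lia.
exact: IH wI wD.
Qed.

End Dimension.

Section Genus.
Variables (k : closedFieldType) (E : fieldType) (j : {rmorphism k -> E}).

Lemma degE (D : place j -> int) (s : seq (place j)) : uniq s ->
  (forall P, D P != 0 -> P \in s) -> deg D = \sum_(P <- s) D P.
Proof.
move=> us Ds; rewrite /deg [RHS]fsbig_seq //; apply/esym; apply: fsbig_widen => // P [_ /= Ps].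
by apply/eqP; apply: contrapT => /negP/Ds.
Qed.

Lemma divisor_support (D : place j -> int) : is_divisor D ->
  exists s, uniq s /\ forall P, D P != 0 -> P \in s.
Proof.
move=> /finite_seqP [s sE]; exists (undup s); rewrite undup_uniq; split=> // P DP.
have : [set P | D P != 0] P by [].
by rewrite sE /= mem_undup.
Qed.

Hypothesis residue : forall (P : place j) z,
  vge P 0 z -> exists c, vge P 1 (z - j c).

(** For D <= D' this is l(D') <= l(D) + deg D' - deg D, obtained by removing the points of D' - D,
    listed with multiplicity in [t], one at a time. *)
Lemma dim_growth (D D' : place j -> int) (s : seq (place j)) d n (v : 'I_n -> E) :
  uniq s -> (forall P, D P != 0 -> P \in s) -> (forall P, D' P != 0 -> P \in s) ->
  (forall P, D P <= D' P) -> has_dim j (riemann_roch_space D) d ->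
  lin_indep j v -> (forall i, riemann_roch_space D' (v i)) ->
  n%:Z <= d%:Z + deg D' - deg D.
Proof.
move=> us Ds D's DD' [b [bD bI bspan]] vI vD'.
pose t := flatten [seq nseq `|D' P - D P|%N P | P <- s].
have tE : (size t)%:Z = deg D' - deg D.
  rewrite (degE us Ds) (degE us D's) -sumrB size_flatten /shape -map_comp sumnE big_map.
  rewrite -[LHS]natz natr_sum /=; apply: eq_bigr => P _.
  by rewrite size_nseq natz; have := DD' P; lia.
have tc Q : D' Q = D Q + (count_mem Q t)%:Z.
  have cE r : uniq r -> count_mem Q (flatten [seq nseq `|D' P - D P|%N P | P <- r]) =
      if Q \in r then `|D' Q - D Q|%N else 0%N.
    elim: r => [//|P r IH] /= /andP[Pr ur].
    rewrite count_cat count_nseq IH // in_cons /= [P == Q]eq_sym.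
    have [->|_] := eqVneq Q P; first by rewrite (negPf Pr) mul1n addn0.
    by rewrite mul0n.
  rewrite cE //; case: ifPn => [_|Qs]; first by have := DD' Q; lia.
  have /eqP -> : D' Q == 0 by apply: contraR Qs => /D's.
  by have /eqP -> : D Q == 0 by apply: contraR Qs => /Ds.
suff : (n <= d + size t)%N by rewrite -addrA -tE -PoszD lez_nat.
have [nt|tn] := leqP n (size t); first exact: leq_trans nt (leq_addl _ _).
have [m nE] : exists m, n = (size t + m)%N by exists (n - size t)%N; rewrite subnKC // ltnW.
subst n; rewrite addnC leq_add2r.
have [w [wI wD]] := indep_drop_seq residue tc vI vD'.
by apply: (indep_leq_dim wI) => i; apply: bspan.
Qed.

(** The hypotheses describe [x] as a map of degree [N] to the projective line with a single pole,
    totally ramified there, whose finite fibres have at most [N] points counted with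
    multiplicity. *)
Variables (Pinf : place j) (x : E) (N g : nat).
Hypothesis N0 : (0 < N)%N.
Hypothesis xinf : Pinf x = - N%:Z.
Hypothesis xfin : forall P : place j, P <> Pinf -> exists c, vge P 1 (x - j c).
Hypothesis xsum : forall c, exists s : seq (place j), [/\ uniq s, Pinf \notin s,
  forall P, P <> Pinf -> vge P 1 (x - j c) -> P \in s
  & \sum_(P <- s) P (x - j c) <= N%:Z].

Lemma ord_inf_sub c : x - j c != 0 /\ Pinf (x - j c) = - N%:Z.
Proof.
have x0 : x != 0 by apply: contraPneq xinf => ->; rewrite ord_zero; lia.
rewrite -xinf; apply: ordD_lt => //; rewrite vgeN; apply: vge_le (vge_const Pinf c).
by rewrite xinf; lia.
Qed.

Lemma vge_fin (P : place j) c : P <> Pinf -> vge P 0 (x - j c).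
Proof.
move=> /xfin [a xa]; have -> : x - j c = (x - j a) + j (a - c) by rewrite rmorphB; ring.
by apply: vgeD (vge_const P _); apply: vge_le xa.
Qed.

Definition pole_divisor (m : nat) (P : place j) : int := if P == Pinf then m%:Z else 0.

Lemma deg_pole_divisor m : deg (pole_divisor m) = m%:Z.
Proof.
rewrite (@degE _ [:: Pinf]) // ?big_seq1 /pole_divisor ?eqxx // => P.
by rewrite mem_seq1; case: (P == Pinf).
Qed.

Lemma pole_divisor_finite m : is_divisor (pole_divisor m).
Proof.
apply/finite_seqP.
have [->|m0] := eqVneq m 0%N.
  exists [::]; rewrite eqEsubset; split=> P //=.
  by rewrite /pole_divisor; case: ifP; rewrite eqxx.
exists [:: Pinf]; rewrite eqEsubset; split=> P /=; rewrite mem_seq1 /pole_divisor.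
  by case: (P == Pinf).
by move=> ->; lia.
Qed.

(** Up to the principal divisor of a product [q] of factors x - c, every [D] lies below a multiple
    of [Pinf]. Dividing the given functions by [q] puts them in the space of a divisor D' >= D of
    degree at most N m, and [dim_growth] yields deg D - l(D) + 1 <= N m + 1 - n = g. *)
Lemma genus_upper_bound :
  (exists m0, forall m, (m0 <= m)%N -> exists n (v : 'I_n -> E),
     [/\ n%:Z = N%:Z * m%:Z + 1 - g%:Z, lin_indep j v
       & forall i, riemann_roch_space (pole_divisor (N * m)) (v i)]) ->
  forall (D : place j -> int) d, is_divisor D ->
    has_dim j (riemann_roch_space D) d -> deg D - d%:Z + 1 <= g%:Z.
Proof.
move=> [m0 dims] D d /divisor_support [t0 [ut0 Dt0]] Ddim.
have /choice [cc ccP] : forall P : place j, exists c, P <> Pinf -> vge P 1 (x - j c).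
  move=> P; have [->|/eqP PP] := eqVneq P Pinf; first by exists 0.
  by have [c xc] := xfin PP; exists c.
(* Repeating the factor that vanishes at [P] as often as [D P] asks makes the order of [q] at [P] at
   least [D P]. A factor coming from [Pinf] is arbitrary and only adds finite zeros. *)
pose cs := flatten [seq nseq `|D P|%N (cc P) | P <- t0].
pose q := \prod_(c <- cs) (x - j c).
have xc0 c : x - j c != 0 by case: (ord_inf_sub c).
have q0 : q != 0 by rewrite prodf_seq_neq0; apply/allP => c _; exact: xc0.
have ordq (P : place j) : P q = \sum_(c <- cs) P (x - j c).
  by rewrite ord_prod // => c _; exact: xc0.
have ge0 (P : place j) c : P <> Pinf -> 0 <= P (x - j c).
  by move=> PP; have := vge_fin c PP; rewrite vgeP.
have DP (P : place j) : P <> Pinf -> D P <= P q.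
  move=> PP; have qge0 : 0 <= P q by rewrite ordq; apply: sumr_ge0 => c _; exact: ge0.
  have [Pt|/negP Pt] := boolP (P \in t0); last first.
    by have /eqP -> : D P == 0 by apply/negPn/negP => /Dt0.
  rewrite ordq /cs big_flatten /= big_map (perm_big _ (perm_to_rem Pt)) big_cons /=.
  have -> : \sum_(c <- nseq `|D P|%N (cc P)) P (x - j c) = `|D P|%N%:Z * P (x - j (cc P)).
    by rewrite big_nseq; elim: `|D P|%N => [|n IH] /=; rewrite ?mul0r // IH; lia.
  have : 0 <= \sum_(i <- rem P t0) \sum_(i0 <- nseq `|D i|%N (cc i)) P (x - j i0).
    by apply: sumr_ge0 => i _; apply: sumr_ge0 => c _; exact: ge0.
  have := ccP _ PP; rewrite vgeP //; move: (\sum_(i <- _) _) (P (x - _)) => a e.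
  nia.
(* The summand [m0] makes the dimension count available, the other one gives D <= D' at [Pinf]. *)
pose m' := (m0 + `|D Pinf|)%N.
pose m := (size cs + m')%N.
pose D' (P : place j) : int := if P == Pinf then N%:Z * m'%:Z else P q.
have [] := dims m; first by rewrite /m /m'; lia.
move=> n [v [nE vI vL]].
pose w i := v i / q.
have wI : lin_indep j w.
  move=> c c0; apply: vI; apply: (mulIf (invr_neq0 q0)); rewrite mul0r mulr_suml -[RHS]c0.
  by apply: eq_bigr => i _; rewrite mulrA.
have infq : Pinf q = - (N%:Z * (size cs)%:Z).
  rewrite ordq; under eq_bigr do rewrite (ord_inf_sub _).2.
  by rewrite big_const_seq count_predT; elim: (size cs) => [|l IH] /=; rewrite ?mulr0 // IH; lia.
have wD' i : riemann_roch_space D' (w i).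
  apply/riemann_rochP => P; rewrite /w /D'.
  have := vL i => /riemann_rochP/(_ P); rewrite /pole_divisor.
  have [->|PP] := eqVneq P Pinf => vP.
    have -> : - (N%:Z * m'%:Z) = - (N * m)%N%:Z + Pinf q^-1.
      by rewrite ordV infq /m; lia.
    by apply: vgeM vP _; exact: vge_ord.
  rewrite -[- P q]add0r; apply: vgeM; first by move: vP; rewrite oppr0.
  by rewrite -ordV; exact: vge_ord.
have /choice [ss ssP] := xsum.
pose t := undup (t0 ++ Pinf :: flatten [seq ss c | c <- cs]).
have ut : uniq t by exact: undup_uniq.
have D't P : D' P != 0 -> P \in t.
  rewrite mem_undup mem_cat inE /D'; have [_|/eqP PP] := eqVneq P Pinf.
    by rewrite orbT.
  move=> Pq; apply/orP; right; rewrite orFb.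
  have [c ccs cP] : exists2 c, c \in cs & P (x - j c) != 0.
    apply: contrapT => Nex; move: Pq; rewrite ordq big_seq big1 ?eqxx // => c ccs.
    by apply/eqP; apply: contrapT => /negP cP; apply: Nex; exists c.
  apply/flattenP; exists (ss c); first by apply/mapP; exists c.
  have [_ _ + _] := ssP c; apply => //.
  by rewrite vgeP //; have := ge0 P c PP; lia.
have Dt P : D P != 0 -> P \in t by move=> /Dt0 Pt; rewrite mem_undup mem_cat Pt.
have DD' P : D P <= D' P.
  rewrite /D'; have [->|/eqP PP] := eqVneq P Pinf; last exact: DP.
  by rewrite /m'; nia.
have := dim_growth ut Dt D't DD' Ddim wI wD'.
suff : deg D' <= N%:Z * m%:Z by rewrite nE; lia.
rewrite (degE ut D't) (bigD1_seq Pinf) //=; last first.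
  by rewrite mem_undup mem_cat inE eqxx orbT.
rewrite {1}/D' eqxx.
have -> : \sum_(P <- t | P != Pinf) D' P =
    \sum_(c <- cs) \sum_(P <- t | P != Pinf) P (x - j c).
  rewrite exchange_big /=; apply: eq_bigr => P PP.
  by rewrite /D' (negPf PP) ordq.
suff : \sum_(c <- cs) \sum_(P <- t | P != Pinf) P (x - j c) <= N%:Z * (size cs)%:Z.
  by rewrite /m; lia.
have -> : N%:Z * (size cs)%:Z = \sum_(c <- cs) N%:Z.
  by rewrite big_const_seq count_predT; elim: (size cs) => [|l IH] /=; rewrite ?mulr0 // -IH; lia.
apply: ler_sum => c _.
have [us sPinf sP sN] := ssP c.
apply: le_trans sN.
rewrite (bigID [pred P | P \in ss c]) /= [X in _ + X]big1 ?addr0; last first.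
  move=> P /andP[/eqP PP Ps]; apply/eqP; apply: contraR Ps => cP.
  by apply: sP => //; rewrite vgeP //; have := ge0 P c PP; lia.
have -> : \sum_(P <- t | (P != Pinf) && (P \in ss c)) P (x - j c) =
   \sum_(P <- [seq P <- t | (P != Pinf) && (P \in ss c)]) P (x - j c) by rewrite big_filter.
have sub : {subset [seq P <- t | (P != Pinf) && (P \in ss c)] <= ss c}.
  by move=> P; rewrite mem_filter => /andP[/andP[]].
have -> : \sum_(P <- ss c) P (x - j c) = \sum_(P <- ss c |
   P \in [seq P <- t | (P != Pinf) && (P \in ss c)]) P (x - j c) +
   \sum_(P <- ss c | P \notin [seq P <- t | (P != Pinf) && (P \in ss c)]) P (x - j c).
  exact: bigID.
rewrite -[X in _ <= X + _]big_filter.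
have -> : \sum_(P <- [seq P <- t | (P != Pinf) && (P \in ss c)]) P (x - j c) =
  \sum_(P <- [seq P <- ss c | P \in [seq P <- t | (P != Pinf) && (P \in ss c)]]) P (x - j c).
  apply: perm_big; apply: uniq_perm; rewrite ?filter_uniq // => P.
  rewrite [RHS]mem_filter; apply/idP/andP => [Pm|[]//]; split=> //; exact: sub.
rewrite lerDl big_seq_cond; apply: sumr_ge0 => P /andP[Ps _]; apply: ge0 => PP.
by rewrite PP (negPf sPinf) in Ps.
Qed.

Lemma genusI :
  (exists m0, forall m, (m0 <= m)%N -> exists n (v : 'I_n -> E),
     [/\ n%:Z = N%:Z * m%:Z + 1 - g%:Z, lin_indep j v
       & forall i, riemann_roch_space (pole_divisor (N * m)) (v i)]) ->
  (exists m n, n%:Z = N%:Z * m%:Z + 1 - g%:Z /\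
     has_dim j (riemann_roch_space (pole_divisor (N * m))) n) ->
  has_genus j g.
Proof.
move=> upper [m [n [nE mdim]]]; split; first exact: genus_upper_bound.
exists (pole_divisor (N * m)), n; split; [exact: pole_divisor_finite|by []|].
by rewrite deg_pole_divisor nE; lia.
Qed.

End Genus.

Lemma has_genus_uniq (k : closedFieldType) (E : fieldType) (j : {rmorphism k -> E}) g g' :
  has_genus j g -> has_genus j g' -> g = g'.
Proof.
move=> [g1 [D [d [Dd Ddim gE]]]] [g1' [D' [d' [Dd' Ddim' gE']]]].
by have := g1' D d Dd Ddim; have := g1 D' d' Dd' Ddim'; rewrite gE gE'; lia.
Qed.

(** * Rational function fields *)

Section Evaluation.
Variables (k E : fieldType) (j : {rmorphism k -> E}).

Lemma eval1_zmod x : {morph eval1 j x : p q / p - q}.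
Proof. by move=> p q; rewrite /eval1 rmorphB hornerD hornerN. Qed.

Lemma eval1_monoid x : eval1 j x 1 = 1 /\ {morph eval1 j x : p q / p * q}.
Proof.
by split=> [|p q]; rewrite /eval1 ?rmorph1 ?hornerC // rmorphM hornerM.
Qed.

HB.instance Definition _ x :=
  GRing.isZmodMorphism.Build {poly k} E (eval1 j x) (eval1_zmod x).
HB.instance Definition _ x :=
  GRing.isMonoidMorphism.Build {poly k} E (eval1 j x) (eval1_monoid x).

Lemma eval1C x c : eval1 j x c%:P = j c.
Proof. by rewrite /eval1 map_polyC hornerC. Qed.

Lemma eval1X x : eval1 j x 'X = x.
Proof. by rewrite /eval1 map_polyX hornerX. Qed.

Lemma eval1Xn x n : eval1 j x 'X^n = x ^+ n.
Proof. by rewrite rmorphXn /= eval1X. Qed.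

Lemma eval1_XsubC x c : eval1 j x ('X - c%:P) = x - j c.
Proof. by rewrite rmorphB /= eval1X eval1C. Qed.

Lemma eval1Z x c p : eval1 j x (c *: p) = j c * eval1 j x p.
Proof. by rewrite -mul_polyC rmorphM /= eval1C. Qed.

Lemma eval1_sum x p : eval1 j x p = \sum_(i < size p) j p`_i * x ^+ i.
Proof.
rewrite /eval1 horner_coef size_map_poly; apply: eq_bigr => i _.
by rewrite coef_map.
Qed.

Lemma eval1_comp x p q : eval1 j x (p \Po q) = eval1 j (eval1 j x q) p.
Proof. by rewrite /eval1 map_comp_poly horner_comp. Qed.

Lemma eval2_zmod x y : {morph eval2 j x y : p q / p - q}.
Proof.
move=> p q; rewrite /eval2.
have mE r : map_poly (eval1 j x) r = map_poly (eval1 j x : {rmorphism _ -> _}) r by [].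
by rewrite rmorphB hornerD hornerN.
Qed.

Lemma eval2_monoid x y : eval2 j x y 1 = 1 /\ {morph eval2 j x y : p q / p * q}.
Proof.
by split=> [|p q]; rewrite /eval2 ?rmorph1 ?hornerC // rmorphM hornerM.
Qed.

HB.instance Definition _ x y :=
  GRing.isZmodMorphism.Build {poly {poly k}} E (eval2 j x y) (eval2_zmod x y).
HB.instance Definition _ x y :=
  GRing.isMonoidMorphism.Build {poly {poly k}} E (eval2 j x y) (eval2_monoid x y).

Definition eval2_hom x y : {rmorphism {poly {poly k}} -> E} := eval2 j x y.

Lemma eval2_homE x y u : eval2_hom x y u = eval2 j x y u. Proof. by []. Qed.

Lemma eval2D x y : {morph eval2 j x y : p q / p + q}.
Proof. exact: (rmorphD (eval2_hom x y)). Qed.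

Lemma eval2M x y : {morph eval2 j x y : p q / p * q}.
Proof. exact: (eval2_monoid x y).2. Qed.

Lemma eval2C x y p : eval2 j x y p%:P = eval1 j x p.
Proof. by rewrite /eval2 map_polyC hornerC. Qed.

Lemma eval2X x y : eval2 j x y 'X = y.
Proof. by rewrite /eval2 map_polyX hornerX. Qed.

Lemma eval2_sum x y p : eval2 j x y p = \sum_(i < size p) eval1 j x p`_i * y ^+ i.
Proof.
elim/poly_ind: p => [|p c _]; first by rewrite rmorph0 size_poly0 big_ord0.
rewrite /eval2 (@horner_coef_wide _ (size (p * 'X + c%:P))); last exact: size_poly.
by apply: eq_bigr => i _; rewrite coef_map.
Qed.

Definition transcendental x := forall p, eval1 j x p = 0 -> p = 0.

Lemma transcendentalP x : ~ algebraicOver j x <-> transcendental x.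
Proof.
split=> [Nx p p0|tx [p p0 /rootP /tx pE]]; last by rewrite pE eqxx in p0.
by apply/eqP; apply: contrapT => /negP pn0; apply: Nx; exists p => //; apply/rootP.
Qed.

Lemma transcendental_neq0 x p : transcendental x -> p != 0 -> eval1 j x p != 0.
Proof. by move=> tx; apply: contra_neq => /tx. Qed.

Lemma transcendental_sub_neq0 x c : transcendental x -> x - j c != 0.
Proof.
by move=> tx; rewrite -eval1_XsubC transcendental_neq0 // polyXsubC_eq0.
Qed.

Lemma simple_subfield1 x : simple_subfield j x 1.
Proof. by exists 1, 1; rewrite rmorph1 oner_eq0 divr1. Qed.

Lemma simple_subfieldB x y z :
  simple_subfield j x y -> simple_subfield j x z -> simple_subfield j x (y - z).
Proof.
move=> [p [q [q0 ->]]] [p' [q' [q0' ->]]].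
exists (p * q' - p' * q), (q * q'); rewrite rmorphB !rmorphM mulf_neq0 //; split=> //.
by field; rewrite q0 q0'.
Qed.

Lemma simple_subfield_div x y z :
  simple_subfield j x y -> simple_subfield j x z -> simple_subfield j x (y / z).
Proof.
move=> [p [q [q0 ->]]] [p' [q' [q0' ->]]].
have [->|p0'] := eqVneq (eval1 j x p') 0.
  by exists 0, 1; rewrite rmorph1 rmorph0 oner_eq0 mul0r invr0 mulr0 mul0r.
exists (p * q'), (q * p'); rewrite !rmorphM mulf_neq0 //; split=> //.
by field; rewrite q0 q0' p0'.
Qed.

Definition simple_field x : subfield E :=
  Subfield (simple_subfield1 x) (@simple_subfieldB x) (@simple_subfield_div x).

Lemma simple_subfield_eval x p : simple_subfield j x (eval1 j x p).
Proof. by exists p, 1; rewrite rmorph1 oner_eq0 divr1. Qed.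

Lemma simple_subfield_id x : simple_subfield j x x.
Proof. by rewrite -{2}[x]eval1X; exact: simple_subfield_eval. Qed.

Lemma simple_subfieldM x y z :
  simple_subfield j x y -> simple_subfield j x z -> simple_subfield j x (y * z).
Proof.
move=> Sy Sz; rewrite -[z]invrK; apply: simple_subfield_div => //.
by rewrite -[z^-1]mul1r; apply: simple_subfield_div => //; exact: simple_subfield1.
Qed.

Lemma simple_subfield_const x c : simple_subfield j x (j c).
Proof. by rewrite -(eval1C x); exact: simple_subfield_eval. Qed.

Lemma simple_subfield_sub x y z :
  simple_subfield j x y -> simple_subfield j y z -> simple_subfield j x z.
Proof.
move=> Sy [p [q [_ ->]]].
have Se r : simple_subfield j x (eval1 j y r).
  elim/poly_ind: r => [|r c IH].
    by rewrite rmorph0 -(rmorph0 (eval1 j x)); exact: simple_subfield_eval.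
  rewrite rmorphD rmorphM /= eval1X eval1C -[j c]opprK.
  apply: simple_subfieldB; first exact: simple_subfieldM.
  by rewrite -rmorphN; exact: simple_subfield_const.
exact: simple_subfield_div.
Qed.

Lemma transcendentalV x : transcendental x -> transcendental x^-1.
Proof.
move=> /transcendentalP Nx; apply/transcendentalP => ax; apply: Nx.
by rewrite -[x]invrK; exact: algebraic_inv.
Qed.

(** At a pole of [x] the term of highest degree strictly dominates all others. *)
Lemma ord_pole (P : place j) x p : P x < 0 -> p != 0 ->
  eval1 j x p != 0 /\ P (eval1 j x p) = (size p).-1%:Z * P x.
Proof.
move=> x_lt0 p0; have x0 : x != 0 by apply: contraTneq x_lt0 => ->; rewrite ord_zero.
have [n pn] : exists n, size p = n.+1.
  by exists (size p).-1; rewrite prednK // lt0n size_poly_eq0.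
rewrite eval1_sum pn big_ord_recr /= addrC.
have lc0 : j p`_n != 0 by rewrite fmorph_eq0 (_ : p`_n = lead_coef p) ?lead_coef_eq0 // lead_coefE pn.
have ordl : P (j p`_n * x ^+ n) = n%:Z * P x.
  by rewrite ord_mul ?expf_neq0 // ord_const add0r ordX.
rewrite -ordl; apply: ordD_lt; first by rewrite mulf_neq0 ?expf_neq0.
rewrite ordl; apply: vge_sum => i _; apply: vgeM0; first exact: vge_const.
by rewrite vgeP ?expf_neq0 // ordX; have := ltn_ord i; nia.
Qed.

Lemma centered_eval1 (P : place j) x c : vge P 1 (x - j c) ->
  centered (eval1 j x) (horner_eval c) P.
Proof.
move=> xc u; rewrite /= horner_evalE => /rootP /factor_theorem [q ->].
have x0 : vge P 0 x.
  by rewrite -[x](subrK (j c)); apply: vgeD (vge_const P c); apply: vge_le xc.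
by rewrite rmorphM /= eval1_XsubC; apply: vgeM0 xc; exact: vge_eval1.
Qed.

End Evaluation.

Section ClosedConstants.
Variables (k : closedFieldType) (E : fieldType) (j : {rmorphism k -> E}).

(** Over closed constants [p] splits into linear factors, each of order 0. This is the tool for
    showing that integral elements do have residues: without one, too many functions would have
    order 0. *)
Lemma ord_eval1_uncentered (P : place j) x p : vge P 0 x ->
  (forall c, ~~ vge P 1 (x - j c)) -> P (eval1 j x p) = 0.
Proof.
move=> x0 Nc; have [->|p0] := eqVneq p 0; first by rewrite rmorph0 ord_zero.
have [r ->] := closed_field_poly_normal p.
have xc0 c : x - j c != 0 by apply: contraNneq (Nc c) => ->; exact: vge0.
rewrite eval1Z rmorph_prod /= ord_mul ?fmorph_eq0 ?lead_coef_eq0 //; last first.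
  by rewrite prodf_seq_neq0; apply/allP => c _; rewrite eval1_XsubC xc0.
rewrite ord_const add0r ord_prod => [|c _]; last by rewrite eval1_XsubC.
rewrite big1 // => c _; rewrite eval1_XsubC; have := Nc c.
have : vge P 0 (x - j c) by rewrite vgeB // vge_const.
by rewrite !vgeP //; move: (P (x - j c)) => e; lia.
Qed.

Lemma poly_factor (p : {poly k}) c : p != 0 ->
  exists m q, q.[c] != 0 /\ p = ('X - c%:P) ^+ m * q.
Proof.
move=> p0; have [m [q /implyP/(_ p0) qc pE]] := multiplicity_XsubC p c.
by exists m, q; rewrite mulrC.
Qed.

Section ProjectiveLine.
Variable x : E.
Hypothesis tx : transcendental j x.
Hypothesis gx : forall z, simple_subfield j x z.

Lemma line_regular_point c :
  regular_point j (eval1 j x) (horner_eval c) polyC ('X - c%:P).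
Proof.
split.
- exact: eval1C.
- by move=> a; rewrite /= horner_evalE hornerC.
- by move=> u /tx ->; rewrite rmorph0.
- by rewrite /= horner_evalE !hornerE subrr.
- by rewrite transcendental_neq0 // polyXsubC_eq0.
- apply: rp_factorI.
  + by move=> u /tx ->; rewrite rmorph0.
  + by rewrite transcendental_neq0 // polyXsubC_eq0.
  + move=> u /=; rewrite horner_evalE => /rootP /factor_theorem [q ->].
    by exists 1, q; rewrite /= horner_evalE hornerC oner_eq0 rmorph1 mul1r mulrC -rmorphM.
  + move=> u u0; have [|m [q [qc uE]]] := @poly_factor u c.
      by apply: contra_neq u0 => ->; rewrite rmorph0.
    exists 1, m, 1, q; rewrite /= !horner_evalE hornerC oner_eq0; split=> //.
    by rewrite !rmorph1 mul1r mulr1 -rmorphXn -rmorphM -uE.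
- by move=> z; have [p [q []]] := gx z; exists p, q.
Qed.

End ProjectiveLine.

(** Needed for the quotient by the group of a cubic cover, whose function field is k(x). *)
Lemma projective_line_genus x : transcendental j x ->
  (forall z, simple_subfield j x z) -> has_genus j 0.
Proof.
move=> tx gx.
have tV := transcendentalV tx.
have gV z : simple_subfield j x^-1 z.
  apply: simple_subfield_sub (gx z); rewrite -{2}[x]invrK -[x^-1^-1]mul1r.
  by apply: simple_subfield_div; [exact: simple_subfield1|exact: simple_subfield_id].
have rp := line_regular_point tx gx; have rpV := line_regular_point tV gV 0.
have x0 : x != 0 by rewrite -(eval1X j x) transcendental_neq0 // polyX_eq0.
have [Pinf cPinf] := rp_place rpV.
have xinf : Pinf x = - 1%N%:Z.
  have := centered_param rpV cPinf; rewrite polyC0 subr0 /= eval1X ordV.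
  by lia.
have xfin0 (P : place j) : P <> Pinf -> vge P 0 x.
  move=> PP; rewrite vgeP // leNgt; apply/negP => Px; apply: PP.
  apply: (centered_uniq rpV) cPinf; apply: centered_eval1.
  by rewrite rmorph0 subr0 vgeP ?invr_eq0 // ordV; lia.
have xfin (P : place j) : P <> Pinf -> exists c, vge P 1 (x - j c).
  move=> PP; apply: contrapT => Nex.
  have Pe := ord_eval1_uncentered _ (xfin0 P PP) (fun c => introN idP (fun h => Nex (ex_intro _ c h))).
  have [z [z0 z1]] := ord_surj P; have [p [q [q0 zE]]] := gx z.
  have p0 : eval1 j x p != 0 by apply: contra_neq z0 => p0; rewrite zE p0 mul0r.
  by move: z1; rewrite zE ord_div // !Pe.
have xcen (P : place j) c : centered (eval1 j x) (horner_eval c) P -> P <> Pinf.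
  move=> cP PP; have := centered_integral (rp c) cP 'X.
  by rewrite /= eval1X vgeP // PP xinf.
have xsum c : exists s : seq (place j), [/\ uniq s, Pinf \notin s,
    forall P, P <> Pinf -> vge P 1 (x - j c) -> P \in s
    & \sum_(P <- s) P (x - j c) <= 1%N%:Z].
  have [Pc cPc] := rp_place (rp c); exists [:: Pc]; split=> //.
  - by rewrite mem_seq1; apply/eqP => PP; exact: xcen cPc _.
  - move=> P _ /centered_eval1 cP; rewrite mem_seq1; apply/eqP.
    exact: (centered_uniq (rp c)).
  - by rewrite big_seq1 -eval1_XsubC (centered_param (rp c)).
have res (P : place j) z : vge P 0 z -> exists c, vge P 1 (z - j c).
  have [->|/eqP PP] := eqVneq P Pinf; first exact: (centered_residue rpV cPinf).
  have [c /centered_eval1 cP] := xfin P PP.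
  exact: (centered_residue (rp c) cP).
(* At a root of the denominator integrality forces the numerator to vanish as well; the common
   factor is cancelled, by induction on the degree of the denominator. *)
have integral f : (forall P, P <> Pinf -> vge P 0 f) -> exists p, f = eval1 j x p.
  have [p [q [q0 ->]]] := gx f; move: {2}(size q) (leqnn (size q)) => n.
  elim: n p q q0 => [|n IH] p q q0.
    by rewrite leqn0 size_poly_eq0 => /eqP qE; rewrite qE rmorph0 eqxx in q0.
  move=> qn fP; have [q1|q1] := eqVneq (size q) 1%N.
    have /size_poly1P [c c0 qE] := introT eqP q1; exists (c^-1 *: p).
    by rewrite qE eval1C eval1Z fmorphV mulrC.
  have [c qc] := closed_rootP _ q1.
  have [Pc cPc] := rp_place (rp c); have Pc' := xcen Pc c cPc.
  have /rootP/factor_theorem [p' pE] : p.[c] = 0.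
    apply: contrapT => /eqP pc.
    have p0 : eval1 j x p != 0.
      by apply: contra_neq pc => /tx ->; rewrite horner0.
    have := fP _ Pc'; have := cPc q (elimT rootP qc).
    rewrite !vgeP ?mulf_neq0 ?invr_eq0 // ord_div // (centered_unit (rp c) cPc pc).
    by move=> /=; lia.
  have /factor_theorem [q' qE] := qc.
  have q'0 : eval1 j x q' != 0.
    by apply: contra_neq q0 => q'0; rewrite qE rmorphM /= q'0 mul0r.
  have xc0 := transcendental_sub_neq0 c tx.
  have fE : eval1 j x p / eval1 j x q = eval1 j x p' / eval1 j x q'.
    by rewrite pE qE !rmorphM /= eval1_XsubC; field; rewrite q'0 xc0.
  rewrite fE; apply: IH => //; last by rewrite -fE.
  have q'n0 : q' != 0 by apply: contra_neq q'0 => ->; rewrite rmorph0.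
  move: qn; rewrite qE size_mul ?polyXsubC_eq0 // size_XsubC addn2 /=.
  by rewrite ltnS.
have xinf_lt0 : Pinf x < 0 by rewrite xinf.
apply: (@genusI _ _ _ res Pinf x 1 0 _ xinf xfin xsum) => //.
- exists 0%N => m _; exists m.+1, (fun i : 'I_m.+1 => x ^+ i); split.
  + by rewrite mul1r subr0 -addn1 PoszD.
  + move=> c c0 i; have := tx (\poly_(l < m.+1) c (inord l)).
    rewrite /eval1 (horner_coef_wide _ (n := m.+1)); last first.
      by rewrite size_map_poly size_poly.
    have -> : \sum_(i < m.+1) (map_poly j (\poly_(l < m.+1) c (inord l)))`_i * x ^+ i = 0.
      rewrite -[RHS]c0; apply: eq_bigr => l _.
      by rewrite coef_map coef_poly ltn_ord inord_val.
    move=> /(_ erefl)/(congr1 (fun p : {poly k} => p`_i)).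
    by rewrite coef_poly ltn_ord inord_val coef0.
  + move=> i; apply/riemann_rochP => P; rewrite /pole_divisor mul1n.
    have [->|/eqP PP] := eqVneq P Pinf; last by rewrite oppr0 vgeX // xfin0.
    by rewrite vgeP ?expf_neq0 // ordX xinf; have := ltn_ord i; lia.
(* The maximum is attained at the zero divisor: L(0) consists of the constants, and 0 - 1 + 1 =
   0. *)
- exists 0%N, 1%N; split=> //; exists (fun=> 1); split.
  + move=> _; apply/riemann_rochP => P; rewrite /vge ord_one /pole_divisor.
    by case: ifP; rewrite orbC.
  + by move=> c; rewrite big_ord1 mulr1 => /eqP; rewrite fmorph_eq0 => /eqP c0 i; rewrite ord1.
  + move=> f /riemann_rochP fL.
    have [|p fE] := integral f.
      by move=> P /eqP PP; have := fL P; rewrite /pole_divisor (negPf PP) oppr0.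
    exists (fun=> p`_0); rewrite big_ord1 mulr1 fE.
    have [->|p0] := eqVneq p 0; first by rewrite coef0 !rmorph0.
    have [e0 eP] := ord_pole xinf_lt0 p0.
    have := fL Pinf; rewrite fE /pole_divisor eqxx muln0 oppr0 vgeP // eP xinf => sz.
    have /size1_polyC {1}-> : (size p <= 1)%N by lia.
    by rewrite eval1C.
Qed.

End ClosedConstants.

(** * Cyclic cubic extensions of the rational function field *)

Section CubicBasis.
Variables (k E : fieldType) (j : {rmorphism k -> E}).

(** The field has degree 3 over the rational function field k(x), with power basis 1, y, y^2. *)
Record cubic_basis (x y : E) : Prop := CubicBasis {
  cb_trans : transcendental j x;
  cb_indep : forall a0 a1 a2, simple_subfield j x a0 -> simple_subfield j x a1 ->
    simple_subfield j x a2 -> a0 + a1 * y + a2 * y ^+ 2 = 0 ->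
    [/\ a0 = 0, a1 = 0 & a2 = 0];
  cb_span : forall z, exists a0 a1 a2, [/\ simple_subfield j x a0,
    simple_subfield j x a1, simple_subfield j x a2 & z = a0 + a1 * y + a2 * y ^+ 2] }.

Definition comb3 (x y : E) (p0 p1 p2 : {poly k}) :=
  eval1 j x p0 + eval1 j x p1 * y + eval1 j x p2 * y ^+ 2.

Lemma cb_indep_poly x y p0 p1 p2 : cubic_basis x y -> comb3 x y p0 p1 p2 = 0 ->
  [/\ p0 = 0, p1 = 0 & p2 = 0].
Proof.
move=> [tx cbI _] c0.
by have [] := cbI _ _ _ (simple_subfield_eval _ _ p0) (simple_subfield_eval _ _ p1)
  (simple_subfield_eval _ _ p2) c0; split; apply: tx.
Qed.

Lemma cb_span_poly x y z : cubic_basis x y -> exists d p0 p1 p2, d != 0 /\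
  z * eval1 j x d = comb3 x y p0 p1 p2.
Proof.
move=> [tx _ /(_ z)] [a0 [a1 [a2 [[p0 [q0 [q00 ->]]] [p1 [q1 [q10 ->]]]
  [p2 [q2 [q20 ->]]] ->]]]].
exists (q0 * q1 * q2), (p0 * q1 * q2), (p1 * q0 * q2), (p2 * q0 * q1); split.
  by rewrite !mulf_neq0 //; [apply: contra_neq q00|apply: contra_neq q10|apply: contra_neq q20]
    => ->; rewrite rmorph0.
by rewrite /comb3 !rmorphM /=; field; rewrite q00 q10 q20.
Qed.

Lemma simple_indep x y : transcendental j x ->
  (forall p0 p1 p2, comb3 x y p0 p1 p2 = 0 -> [/\ p0 = 0, p1 = 0 & p2 = 0]) ->
  forall a0 a1 a2, simple_subfield j x a0 -> simple_subfield j x a1 ->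
    simple_subfield j x a2 -> a0 + a1 * y + a2 * y ^+ 2 = 0 ->
    [/\ a0 = 0, a1 = 0 & a2 = 0].
Proof.
move=> tx cbI.
move=> _ _ _ [p0 [q0 [q00 ->]]] [p1 [q1 [q10 ->]]] [p2 [q2 [q20 ->]]] c0.
have := cbI (p0 * q1 * q2) (p1 * q0 * q2) (p2 * q0 * q1).
have -> : comb3 x y (p0 * q1 * q2) (p1 * q0 * q2) (p2 * q0 * q1) = 0.
  apply: (mulfI (invr_neq0 (mulf_neq0 (mulf_neq0 q00 q10) q20))).
  rewrite mulr0 -[RHS]c0 /comb3 !rmorphM /=; field.
  by rewrite q00 q10 q20.
have qn0 q : eval1 j x q != 0 -> q == 0 = false.
  by move=> q0'; apply/negbTE; apply: contra_neq q0' => ->; rewrite rmorph0.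
case=> // /eqP + /eqP + /eqP; rewrite !mulf_eq0 (qn0 _ q00) (qn0 _ q10) (qn0 _ q20) !orbF.
by move=> /eqP -> /eqP -> /eqP ->; rewrite rmorph0 !mul0r.
Qed.

Lemma cubic_basisI x y : transcendental j x ->
  (forall p0 p1 p2, comb3 x y p0 p1 p2 = 0 -> [/\ p0 = 0, p1 = 0 & p2 = 0]) ->
  (forall z, exists d p0 p1 p2, d != 0 /\ z * eval1 j x d = comb3 x y p0 p1 p2) ->
  cubic_basis x y.
Proof.
move=> tx cbI cbS; split=> //; first exact: simple_indep.
move=> z; have [d [p0 [p1 [p2 [d0 zd]]]]] := cbS z.
have d0' := transcendental_neq0 tx d0.
have S p : simple_subfield j x (eval1 j x p / eval1 j x d) by exists p, d.
exists (eval1 j x p0 / eval1 j x d), (eval1 j x p1 / eval1 j x d),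
  (eval1 j x p2 / eval1 j x d); split=> //.
by apply: (mulIf d0'); rewrite zd /comb3; field.
Qed.

Lemma cubic_basis_scale x y x' mu : cubic_basis x y -> transcendental j x' ->
  simple_subfield j x x' -> simple_subfield j x' x ->
  simple_subfield j x mu -> mu != 0 -> cubic_basis x' (mu * y).
Proof.
move=> [tx cbI cbS] tx' Sxx' Sx'x Smu mu0.
have sub1 z : simple_subfield j x z -> simple_subfield j x' z.
  exact: simple_subfield_sub.
have sub2 z : simple_subfield j x' z -> simple_subfield j x z.
  exact: simple_subfield_sub.
have Smu2 : simple_subfield j x (mu ^+ 2) by exact: simple_subfieldM.
split=> //.
  move=> a0 a1 a2 /sub2 S0 /sub2 S1 /sub2 S2 c0.
  have [||||-> /eqP e1 /eqP e2] := cbI a0 (a1 * mu) (a2 * mu ^+ 2) => //.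
  - exact: simple_subfieldM.
  - exact: simple_subfieldM.
  - by rewrite -[RHS]c0; ring.
  by move: e1 e2; rewrite !mulf_eq0 (negPf mu0) /= !orbF => /eqP -> /eqP ->.
move=> z; have [a0 [a1 [a2 [S0 S1 S2 ->]]]] := cbS z.
exists a0, (a1 / mu), (a2 / mu ^+ 2); split.
- exact: sub1.
- by apply/sub1/simple_subfield_div.
- by apply/sub1/simple_subfield_div.
- by field.
Qed.

Lemma cb_neq0 x y : cubic_basis x y -> y != 0.
Proof.
move=> cb; apply/eqP => y0.
have [|_ /eqP] := @cb_indep_poly x y 0 1 0 cb; last by rewrite oner_eq0.
by rewrite /comb3 y0 rmorph0 expr0n mulr0 mulr0 !addr0.
Qed.

Definition poly3 (p0 p1 p2 : {poly k}) : {poly {poly k}} :=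
  p0%:P + p1%:P * 'X + p2%:P * 'X^2.

Lemma eval2_poly3 x y p0 p1 p2 : eval2 j x y (poly3 p0 p1 p2) = comb3 x y p0 p1 p2.
Proof.
by rewrite /poly3 !rmorphD !rmorphM /= !eval2C !eval2X.
Qed.

Lemma size_poly3 (r : {poly {poly k}}) : (size r <= 3)%N -> r = poly3 r`_0 r`_1 r`_2.
Proof.
move=> r3; apply/polyP => i; rewrite /poly3 !coefD !coefCM coefC coefX coefXn.
case: i => [|[|[|i]]] /=; rewrite ?mulr0 ?mulr1 ?addr0 ?add0r //.
by rewrite nth_default // (leq_trans r3).
Qed.

(** Division by the monic X^3 - h leaves a remainder of degree at most 2 in y, which vanishes by
    independence of 1, y, y^2. *)
Lemma cubic_kernel x y h : cubic_basis x y -> y ^+ 3 = eval1 j x h ->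
  forall u, eval2 j x y u = 0 <-> exists q, u = q * ('X^3 - h%:P).
Proof.
move=> cb yh u.
have e0 : eval2 j x y ('X^3 - h%:P) = 0.
  by rewrite eval2_zmod eval2C {1}/eval2 map_polyXn hornerXn yh subrr.
split=> [u0|[q ->]]; last by rewrite rmorphM /= e0 mulr0.
have mon : 'X^3 - h%:P \is monic by rewrite monicXnsubC.
have uE := Pdiv.RingMonic.rdivp_eq mon u.
exists (Pdiv.Ring.rdivp u ('X^3 - h%:P)); rewrite {1}uE.
set r := Pdiv.Ring.rmodp _ _ in uE *.
have r3 : (size r <= 3)%N.
  have := Pdiv.Ring.ltn_rmodpN0 u (monic_neq0 mon).
  by rewrite -/r size_XnsubC.
have : comb3 x y r`_0 r`_1 r`_2 = 0.
  rewrite -eval2_poly3 -size_poly3 // -[RHS]u0 uE rmorphD rmorphM /=.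
  by rewrite e0 mulr0 add0r.
move=> /(cb_indep_poly cb) [r0 r1 r2].
by rewrite (size_poly3 r3) r0 r1 r2 /poly3 polyC0 !mul0r !addr0.
Qed.

Definition rts (s : seq k) : {poly k} := \prod_(c <- s) ('X - c%:P).

Lemma rts_neq0 s : rts s != 0.
Proof. by rewrite monic_neq0 // monic_prod_XsubC. Qed.

Lemma root_rts s c : root (rts s) c = (c \in s).
Proof. exact: root_prod_XsubC. Qed.

Lemma size_rts s : size (rts s) = (size s).+1.
Proof. exact: size_prod_XsubC. Qed.

(** Cube factors having been removed, a cubic radical over k(x) is y^3 = A B^2 with A and B
    squarefree and coprime. At the branch points in [sA] the element y has order 1, at those in [sB]
    order 2. *)
Record kummer (x y : E) (sA sB : seq k) : Prop := Kummer {
  ku_basis : cubic_basis x y;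
  ku_uniq : uniq (sA ++ sB);
  ku_eq : y ^+ 3 = eval1 j x (rts sA * rts sB ^+ 2) }.

(** The other normalized radical w = y^2 / B, with w^3 = A^2 B. Together with 1 and y it is a basis
    of the integral closure of k[x], which y^2 is not in general. *)
Definition kconj x y sB := y ^+ 2 / eval1 j x (rts sB).

Lemma kummer_rts_neq0 x y sA sB s : kummer x y sA sB -> eval1 j x (rts s) != 0.
Proof. by move=> [[tx _ _] _ _]; rewrite transcendental_neq0 // rts_neq0. Qed.

Lemma kconj_kconj x y sA sB : kummer x y sA sB -> kconj x (kconj x y sB) sA = y.
Proof.
move=> ku; have A0 := kummer_rts_neq0 sA ku; have B0 := kummer_rts_neq0 sB ku.
have := ku_eq ku; rewrite rmorphM rmorphXn /= => yE.
have y0 := cb_neq0 (ku_basis ku).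
rewrite /kconj; apply: (mulfI (expf_neq0 2 y0)).
have -> : y ^+ 2 * y = y ^+ 3 by ring.
rewrite expr_div_n -[y ^+ 2 * (_ / _)]/(y ^+ 2 * _).
have -> : y ^+ 2 * ((y ^+ 2) ^+ 2 / eval1 j x (rts sB) ^+ 2 / eval1 j x (rts sA)) =
   (y ^+ 3) ^+ 2 / (eval1 j x (rts sB) ^+ 2 * eval1 j x (rts sA)) by field; rewrite A0 B0.
by rewrite yE; field; rewrite A0 B0.
Qed.

(** This symmetry reduces every statement about points of [sB] to points of [sA]. *)
Lemma kummer_swap x y sA sB : kummer x y sA sB -> kummer x (kconj x y sB) sB sA.
Proof.
move=> ku; have A0 := kummer_rts_neq0 sA ku; have B0 := kummer_rts_neq0 sB ku.
have [cb un] := ku; rewrite rmorphM rmorphXn /= => yE.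
have [tx cbI cbS] := cb.
have y2E : kconj x y sB ^+ 2 = eval1 j x (rts sA) * y.
  rewrite -{2}(kconj_kconj ku) {2}/kconj; field; exact: A0.
split; last 2 first.
- by rewrite uniq_catC.
- rewrite [LHS]exprS y2E mulrCA /kconj rmorphM rmorphXn /=.
  have -> : eval1 j x (rts sA) * (y ^+ 2 / eval1 j x (rts sB) * y) =
    y ^+ 3 * eval1 j x (rts sA) / eval1 j x (rts sB) by field.
  by rewrite yE; field.
have SA : simple_subfield j x (eval1 j x (rts sA)) by exact: simple_subfield_eval.
have SB : simple_subfield j x (eval1 j x (rts sB)) by exact: simple_subfield_eval.
split=> //.
  move=> a0 a1 a2 S0 S1 S2; rewrite y2E => c0.
  have [||||-> /eqP e1 /eqP e2] := cbI a0 (a2 * eval1 j x (rts sA)) (a1 / eval1 j x (rts sB)) => //.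
  - exact: simple_subfieldM.
  - exact: simple_subfield_div.
  - by rewrite -[RHS]c0 /kconj; ring.
  move: e1 e2; rewrite !mulf_eq0 invr_eq0 (negPf A0) (negPf B0) !orbF.
  by move=> /eqP -> /eqP ->.
move=> z; have [a0 [a1 [a2 [S0 S1 S2 ->]]]] := cbS z.
exists a0, (a2 * eval1 j x (rts sB)), (a1 / eval1 j x (rts sA)); split=> //.
- exact: simple_subfieldM.
- exact: simple_subfield_div.
- by rewrite y2E /kconj; field; rewrite A0 B0.
Qed.

End CubicBasis.

(** * Moving a branch point to infinity *)

Section Moebius.
Variables (k : closedFieldType) (E : fieldType) (j : {rmorphism k -> E}).

Lemma cube_root (c : k) : exists d, d ^+ 3 = c.
Proof.
have /closed_rootP [d] : size ('X^3 - c%:P) != 1%N by rewrite size_XnsubC.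
by rewrite rootE !hornerE subr_eq0 => /eqP; exists d.
Qed.

(** Images of the roots under c -> 1 / (c - c0); the root [c0] itself disappears to infinity. *)
Definition moebius_roots (c0 : k) (s : seq k) := [seq (c - c0)^-1 | c <- s & c != c0].

Lemma moebius_roots_neq0 c0 s : 0 \notin moebius_roots c0 s.
Proof.
apply/mapP => -[c]; rewrite mem_filter => /andP[cc0 _] /esym/eqP.
by rewrite invr_eq0 subr_eq0 (negPf cc0).
Qed.

Lemma moebius_roots_cat c0 s s' :
  moebius_roots c0 (s ++ s') = moebius_roots c0 s ++ moebius_roots c0 s'.
Proof. by rewrite /moebius_roots filter_cat map_cat. Qed.

Lemma moebius_roots_uniq c0 s : uniq s -> uniq (moebius_roots c0 s).
Proof.
move=> us; rewrite map_inj_uniq ?filter_uniq //.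
by move=> c d /invr_inj /addIr.
Qed.

(** Factor by factor: for c <> c0 one has x - c = -(c - c0) (X - 1 / (c - c0)) (x - c0) with X = 1 /
    (x - c0), and for c = c0 only x - c0 remains. *)
Lemma eval1_rts_moebius x c0 s : transcendental j x -> exists2 kap, kap != 0 &
  eval1 j x (rts s) = j kap * eval1 j (x - j c0)^-1 (rts (moebius_roots c0 s)) *
     (x - j c0) ^+ size s.
Proof.
move=> tx; have x0 := transcendental_sub_neq0 c0 tx.
elim: s => [|c s [kap kap0 IH]].
  by exists 1; rewrite ?oner_eq0 // /rts !big_nil !rmorph1 !mul1r.
have -> : rts (c :: s) = ('X - c%:P) * rts s by rewrite /rts big_cons.
rewrite rmorphM /= eval1_XsubC IH /moebius_roots /=.
have [->|cc0] := eqVneq c c0.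
  by exists kap => //; rewrite /= exprS; ring.
exists (- (c - c0) * kap); first by rewrite mulf_neq0 // oppr_eq0 subr_eq0.
have jcc0 : j c - j c0 != 0 by rewrite -rmorphB fmorph_eq0 subr_eq0.
rewrite /= /rts big_cons [eval1 _ _ (_ * _)]rmorphM /= eval1_XsubC exprS.
rewrite !(rmorphM, rmorphN, rmorphB, fmorphV) /=.
by field; rewrite x0 jcc0.
Qed.

(* The coordinate x is changed to 1/(x - c0): the point x = c0 goes to infinity and
   the old point at infinity becomes 0, with exponent - (size sA + 2 size sB) mod 3. *)
Lemma kummer_moebius x y sA sB c0 : kummer j x y sA sB ->
  exists w, kummer j (x - j c0)^-1 w
    (nseq ((size sA + 2 * size sB) %% 3 == 2)%N 0 ++ moebius_roots c0 sA)
    (nseq ((size sA + 2 * size sB) %% 3 == 1)%N 0 ++ moebius_roots c0 sB).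
Proof.
move=> ku; have [cb un yE] := ku; have tx := cb_trans cb.
have x0 := transcendental_sub_neq0 c0 tx.
set N := (size sA + 2 * size sB)%N; set X := (x - j c0)^-1.
have [ka ka0 AE] := eval1_rts_moebius c0 sA tx.
have [kb kb0 BE] := eval1_rts_moebius c0 sB tx.
have [d dE] := cube_root (ka * kb ^+ 2).
have d0 : d != 0.
  have : d ^+ 3 != 0 by rewrite dE mulf_neq0 ?expf_neq0.
  by rewrite expf_eq0.
have SX : simple_subfield j x X.
  rewrite /X -[_^-1]mul1r; apply: simple_subfield_div; first exact: simple_subfield1.
  by rewrite -eval1_XsubC; exact: simple_subfield_eval.
have tX : transcendental j X.
  apply: transcendentalV => p.
  have -> : x - j c0 = eval1 j x ('X - c0%:P) by rewrite eval1_XsubC.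
  rewrite -eval1_comp => /tx /eqP; rewrite comp_poly2_eq0 ?size_XsubC //.
  by move/eqP.
have SxX : simple_subfield j X x.
  have -> : x = X^-1 + j c0 by rewrite /X invrK subrK.
  rewrite -[j c0]opprK; apply: simple_subfieldB.
    rewrite -[X^-1]mul1r; apply: simple_subfield_div; first exact: simple_subfield1.
    exact: simple_subfield_id.
  by rewrite -rmorphN; exact: simple_subfield_const.
(* Here 3q is the least multiple of 3 not below N. Multiplying y by X^q cancels the pole factor (x -
   c0)^N of y^3 and leaves X^r with r in {0, 1, 2}; [d] absorbs the constants. *)
pose q := ((N + 2) %/ 3)%N; pose r := (3 * q - N)%N.
have Nr : (N + r = 3 * q)%N by rewrite /r /q; lia.
have jd0 : j d != 0 by rewrite fmorph_eq0.
have X0 : X != 0 by rewrite invr_eq0.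
exists (X ^+ q / j d * y); split.
- apply: (cubic_basis_scale cb tX SX SxX).
    apply: simple_subfield_div; last exact: simple_subfield_const.
    elim: (q) => [|n IH]; first exact: simple_subfield1.
    by rewrite exprS; apply: simple_subfieldM SX IH.
  by rewrite mulf_neq0 ?expf_neq0 // invr_eq0.
- have um : uniq (moebius_roots c0 sA ++ moebius_roots c0 sB).
    by rewrite -moebius_roots_cat moebius_roots_uniq.
  have n0 : 0 \notin moebius_roots c0 sA ++ moebius_roots c0 sB.
    by rewrite -moebius_roots_cat moebius_roots_neq0.
  have [->|N2] := eqVneq (N %% 3)%N 2%N; first by rewrite /= n0.
  have [_|N1] := eqVneq (N %% 3)%N 1%N; last by [].
  by rewrite /= uniq_catC /= mem_cat orbC -mem_cat n0 uniq_catC.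
- have h : (X ^+ q / j d * y) ^+ 3 = X ^+ r *
      (eval1 j X (rts (moebius_roots c0 sA)) * eval1 j X (rts (moebius_roots c0 sB)) ^+ 2).
    have alg (Q S ka' kb' A B ua ub : E) : ka' != 0 -> kb' != 0 ->
        S * (ua * ub ^+ 2) = 1 ->
        Q * S / (ka' * kb' ^+ 2) * (ka' * A * ua * (kb' * B * ub) ^+ 2) = Q * (A * B ^+ 2).
      move=> ka'0 kb'0 S1; rewrite -[RHS]mul1r -S1; field.
      by rewrite ka'0 kb'0.
    rewrite exprMn expr_div_n yE rmorphM rmorphXn /= AE BE -rmorphXn dE.
    rewrite rmorphM rmorphXn /= -exprM mulnC -Nr addnC exprD.
    apply: alg; rewrite ?fmorph_eq0 //.
    rewrite -exprM mulnC -exprD -/N /X exprVn mulVf // expf_neq0 //.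
  rewrite h; have rtsn n s : eval1 j X (rts (nseq n 0 ++ s)) = X ^+ n * eval1 j X (rts s).
    elim: n => [|n IH] /=; first by rewrite mul1r.
    by rewrite /rts big_cons rmorphM /= -/(rts _) IH eval1_XsubC rmorph0 subr0 exprS mulrA.
  rewrite rmorphM rmorphXn /= !rtsn.
  have -> : r = ((N %% 3 == 2) + (N %% 3 == 1) * 2)%N.
    rewrite /r /q; have := ltn_pmod N (isT : (0 < 3)%N).
    by case: eqP => ?; case: eqP => ? /=; lia.
  by rewrite exprD exprM; ring.
Qed.

End Moebius.

(** * Finite places of y^3 = A B^2 *)

Section KummerPlaces.
Variables (k : closedFieldType) (E : fieldType) (j : {rmorphism k -> E}).
Hypothesis three_neq0 : 3%:R != 0 :> k.
Implicit Type P : place j.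

Definition pt_eval (c eta : k) : {rmorphism {poly {poly k}} -> k} :=
  horner_eval c \o horner_eval eta%:P.

Lemma pt_evalE c eta u : pt_eval c eta u = u.[eta%:P].[c].
Proof. by []. Qed.

Lemma poly2_taylor (u : {poly {poly k}}) c eta : exists Q r,
  u = Q * ('X - eta%:P%:P) + (r * ('X - c%:P))%:P + (pt_eval c eta u)%:P%:P.
Proof.
have /factor_theorem [Q QE] : root (u - u.[eta%:P]%:P) eta%:P.
  by rewrite rootE !hornerE subrr.
have /factor_theorem [r rE] : root (u.[eta%:P] - (u.[eta%:P].[c])%:P) c.
  by rewrite rootE !hornerE subrr.
exists Q, r; rewrite -QE -rE pt_evalE polyCB; ring.
Qed.

Definition kpoly (sA sB : seq k) : {poly k} := rts sA * rts sB ^+ 2.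

Lemma kpolyE sA sB c : (kpoly sA sB).[c] = (rts sA).[c] * (rts sB).[c] ^+ 2.
Proof. by rewrite /kpoly hornerM horner_exp. Qed.

Lemma rts_neq (s : seq k) c : c \notin s -> (rts s).[c] != 0.
Proof. by rewrite -root_rts. Qed.

Lemma vge1_const P c : vge P 1 (j c) -> c = 0.
Proof.
move=> h; apply: contrapT => /eqP c0; move: h.
by rewrite vgeP ?fmorph_eq0 // ord_const.
Qed.

Lemma vge1_eval1 P x c p : vge P 1 (x - j c) -> p.[c] = 0 -> vge P 1 (eval1 j x p).
Proof. by move=> /centered_eval1 h pc; apply: h; rewrite /= horner_evalE. Qed.

Lemma vge0_sub P x c : vge P 1 (x - j c) -> vge P 0 x.
Proof.
move=> xc; rewrite -[x](subrK (j c)); apply: vgeD (vge_const P c).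
exact: vge_le xc.
Qed.

Lemma ord_eval1_unit P x c p : vge P 1 (x - j c) -> p.[c] != 0 ->
  eval1 j x p != 0 /\ P (eval1 j x p) = 0.
Proof.
move=> xc pc; have : vge P 1 (eval1 j x p - j p.[c]).
  rewrite -(eval1C j x) -eval1_zmod; apply: (vge1_eval1 xc).
  by rewrite !hornerE subrr.
have jp : j p.[c] != 0 by rewrite fmorph_eq0.
move=> h; have := @ordD_lt _ _ _ P (j p.[c]) (eval1 j x p - j p.[c]) jp.
by rewrite ord_const add0r (addrC (j _)) subrK => /(_ h).
Qed.

Section Curve.
Variables (x y : E) (sA sB : seq k).
Hypothesis ku : kummer j x y sA sB.
Let cb := ku_basis ku.
Let tx := cb_trans cb.

Lemma kummer_uniqA c : c \in sA -> c \notin sB.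
Proof.
move=> cA; have := ku_uniq ku; rewrite cat_uniq => /and3P[_ /hasPn h _].
by apply/negP => /h /=; rewrite cA.
Qed.

Lemma kummer_kernel u c eta : eta ^+ 3 = (kpoly sA sB).[c] ->
  eval2 j x y u = 0 -> pt_eval c eta u = 0.
Proof.
move=> etah /(cubic_kernel cb (ku_eq ku)) [q ->].
rewrite pt_evalE hornerM hornerD hornerN hornerXn hornerC hornerM hornerD hornerN.
by rewrite -polyC_exp hornerC etah subrr mulr0.
Qed.

Lemma kummer_integral P : vge P 0 x -> vge P 0 y.
Proof.
move=> x0; rewrite (vgeP _ _ (cb_neq0 cb)).
have : vge P 0 (y ^+ 3) by rewrite (ku_eq ku) vge_eval1.
by rewrite vgeP ?expf_neq0 ?(cb_neq0 cb) // ordX; clear three_neq0; lia.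
Qed.

Lemma centered_eval2 P c eta : vge P 1 (x - j c) -> vge P 1 (y - j eta) ->
  centered (eval2_hom j x y) (pt_eval c eta) P.
Proof.
move=> xc yc u u0; have [Q [r ->]] := poly2_taylor u c eta.
have x0 := vge0_sub xc; have y0 := kummer_integral x0.
rewrite u0 !polyC0 addr0 /= eval2D eval2M eval2_zmod eval2X !eval2C eval1C.
rewrite (eval1_monoid j x).2 eval1_XsubC; apply: vgeD; last first.
  by apply: vgeM0 xc; exact: vge_eval1.
apply: vgeM0 yc; rewrite eval2_sum; apply: vge_sum => i _; apply: vgeM0.
  exact: vge_eval1.
exact: vgeX.
Qed.

(** If y had no residue, all linear factors of Y^3 - h(c) would have order 0 at Y = y; but y^3 -
    h(c) = h(x) - h(c) has positive order. Here h = A B^2. *)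
Lemma kummer_center P c : vge P 1 (x - j c) ->
  exists2 eta, eta ^+ 3 = (kpoly sA sB).[c] & vge P 1 (y - j eta).
Proof.
move=> xc; have y0 := kummer_integral (vge0_sub xc).
have y3 : vge P 1 (y ^+ 3 - j (kpoly sA sB).[c]).
  rewrite (ku_eq ku) -(eval1C j x) -eval1_zmod; apply: (vge1_eval1 xc).
  by rewrite !hornerE subrr.
suff [eta yc] : exists eta, vge P 1 (y - j eta).
  exists eta => //; apply/eqP; rewrite -subr_eq0; apply/eqP; apply: (@vge1_const P).
  have -> : j (eta ^+ 3 - (kpoly sA sB).[c]) =
     (y ^+ 3 - j (kpoly sA sB).[c]) - (y ^+ 2 + y * j eta + j eta ^+ 2) * (y - j eta).
    by rewrite rmorphB rmorphXn /=; ring.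
  apply: vgeB => //; apply: vgeM0 => //.
  by rewrite !vgeD ?vgeX ?vgeM0 ?vge_const.
apply: contrapT => Nex.
have Nc c' : ~~ vge P 1 (y - j c') by apply/negP => h; apply: Nex; exists c'.
have yc0 c' : y - j c' != 0 by apply: contraNneq (Nc c') => ->; exact: vge0.
pose p := 'X^3 - ((kpoly sA sB).[c])%:P : {poly k}.
have [s pE] := closed_field_poly_normal p.
have ep : eval1 j y p = y ^+ 3 - j (kpoly sA sB).[c].
  by rewrite eval1_zmod eval1Xn eval1C.
have p0 : eval1 j y p != 0.
  rewrite pE eval1Z rmorph_prod mulf_neq0 ?fmorph_eq0 ?lead_coef_eq0 //.
    by rewrite -size_poly_eq0 size_XnsubC.
  by rewrite prodf_seq_neq0; apply/allP => c' _ /=; rewrite eval1_XsubC yc0.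
move: y3; rewrite -ep vgeP // (ord_eval1_uncentered _ y0 Nc).
by [].
Qed.

Lemma kummer_inverse z : z != 0 -> exists u d, d != 0 /\ z * eval2 j x y u = eval1 j x d.
Proof.
move=> z0; have [d [p0 [p1 [p2 [d0 zd]]]]] := cb_span_poly z^-1 cb.
exists (poly3 p0 p1 p2), d; split=> //.
by rewrite eval2_poly3 -zd mulrA divff // mul1r.
Qed.

(** Otherwise all nonzero polynomials in x have order 0. Each nonzero element of k[x, y] divides
    such a polynomial with an integral cofactor, so it has order 0 too, and no element of the field
    could have order 1. *)
Lemma kummer_finite P : vge P 0 x -> exists c, vge P 1 (x - j c).
Proof.
move=> x0; have y0 := kummer_integral x0; apply: contrapT => Nex.
have Nc c : ~~ vge P 1 (x - j c) by apply/negP => h; apply: Nex; exists c.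
have e0 u : vge P 0 (eval2 j x y u).
  rewrite eval2_sum; apply: vge_sum => i _; apply: vgeM0; first exact: vge_eval1.
  exact: vgeX.
have [z [z0 z1]] := ord_surj P.
have zero u : eval2 j x y u != 0 -> P (eval2 j x y u) = 0.
  move=> u0; have [u' [d [d0 ud]]] := kummer_inverse u0.
  have d0' := transcendental_neq0 tx d0.
  have u'0 : eval2 j x y u' != 0 by apply: contra_neq d0'; rewrite -ud => ->; rewrite mulr0.
  have := e0 u; have := e0 u'; rewrite !vgeP //.
  have := ord_mul P u0 u'0; rewrite ud (ord_eval1_uncentered _ x0 Nc).
  by move: (P _) (P _) => a b; clear three_neq0; lia.
have [d [p0 [p1 [p2 [d0 zd]]]]] := cb_span_poly z cb.
have d0' := transcendental_neq0 tx d0.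
have := ord_mul P z0 d0'; rewrite zd -eval2_poly3 z1 (ord_eval1_uncentered _ x0 Nc).
by rewrite zero // eval2_poly3 -zd mulf_neq0.
Qed.

Lemma kummer_frac z : exists u v, eval2 j x y v != 0 /\ z = eval2 j x y u / eval2 j x y v.
Proof.
have [d [p0 [p1 [p2 [d0 zd]]]]] := cb_span_poly z cb.
have d0' := transcendental_neq0 tx d0.
by exists (poly3 p0 p1 p2), d%:P; rewrite eval2C eval2_poly3 -zd mulfK.
Qed.

(** The parameter is x - c: the factor eta^2 + eta y + y^2 takes the value 3 eta^2 <> 0, and its
    product with y - eta is h(x) - h(c), a multiple of x - c. Characteristic 3 is excluded here. *)
Lemma kummer_regular_unramified c eta : eta ^+ 3 = (kpoly sA sB).[c] -> eta != 0 ->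
  regular_point j (eval2_hom j x y) (pt_eval c eta) (polyC \o polyC) ('X - c%:P)%:P.
Proof.
move=> etah eta0.
have tE : eval2_hom j x y ('X - c%:P)%:P = x - j c by rewrite eval2_homE eval2C eval1_XsubC.
have t0 : eval2_hom j x y ('X - c%:P)%:P != 0.
  by rewrite tE transcendental_sub_neq0.
split=> //.
- by move=> a; rewrite /= eval2C eval1C.
- by move=> a; rewrite pt_evalE /= !hornerC.
- by move=> u; exact: kummer_kernel.
- by rewrite pt_evalE hornerC !hornerE subrr.
- apply: rp_factorI => //.
  + by move=> u; exact: kummer_kernel.
  + move=> u u0; have [Q [r uE]] := poly2_taylor u c eta.
    have [g gE] : exists g, kpoly sA sB - (kpoly sA sB).[c]%:P = g * ('X - c%:P).
      by apply/factor_theorem; rewrite rootE !hornerE subrr.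
    have [s sdef] : exists s : {poly {poly k}}, s = poly3 (eta ^+ 2)%:P eta%:P 1 by eexists.
    exists s, (Q * g%:P + s * r%:P); split.
      rewrite pt_evalE sdef /poly3 !hornerE /=.
      have -> : eta ^+ 2 + eta * eta + eta ^+ 2 = 3%:R * eta ^+ 2 by ring.
      by rewrite mulf_neq0 ?expf_neq0.
    have sE : eval2 j x y s = j eta ^+ 2 + j eta * y + y ^+ 2.
      by rewrite sdef eval2_poly3 /comb3 !eval1C rmorphXn rmorph1 mul1r.
    have uE' : eval2 j x y u = eval2 j x y Q * (y - j eta) + eval1 j x r * (x - j c).
      rewrite uE u0 !polyC0 addr0 eval2D eval2C.
      by rewrite eval2M rmorphM /= eval1_XsubC eval2_zmod eval2X eval2C eval1C.
    rewrite tE !eval2_homE eval2D !eval2M !eval2C sE uE'.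
    have hc : y ^+ 3 = j eta ^+ 3 + eval1 j x g * (x - j c).
      rewrite (ku_eq ku) -rmorphXn etah -(eval1C j x) -eval1_XsubC -rmorphM -gE.
      by rewrite -rmorphD /=; congr eval1; rewrite addrC subrK.
    have -> : (j eta ^+ 2 + j eta * y + y ^+ 2) *
       (eval2 j x y Q * (y - j eta) + eval1 j x r * (x - j c)) =
       eval2 j x y Q * (y ^+ 3 - j eta ^+ 3) + (j eta ^+ 2 + j eta * y + y ^+ 2) *
       (eval1 j x r * (x - j c)) by ring.
    by rewrite hc; ring.
  + move=> u u0; have [u' [d [d0 ud]]] := kummer_inverse u0.
    have [m [q [qc dE]]] := poly_factor c d0.
    exists u', m, 1, q%:P; split.
    * by rewrite pt_evalE !hornerC oner_eq0.
    * by rewrite pt_evalE hornerC.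
    * rewrite tE !eval2_homE (eval2_monoid j x y).1 mul1r ud dE eval2C rmorphM rmorphXn /=.
      by rewrite eval1_XsubC.
- exact: kummer_frac.
Qed.

(** Here y itself is the parameter: y^3 = w (x - c) with w(c) <> 0, so x - c is y^3 up to a unit and
    a power (x - c)^m becomes y^(3 m). *)
Lemma kummer_regular_ramified c : c \in sA ->
  regular_point j (eval2_hom j x y) (pt_eval c 0) (polyC \o polyC) 'X.
Proof.
move=> cA; have y0 := cb_neq0 cb.
have etah : 0 ^+ 3 = (kpoly sA sB).[c].
  by rewrite kpolyE expr0n /=; move: cA; rewrite -root_rts => /rootP ->; rewrite mul0r.
have usA : uniq sA by have := ku_uniq ku; rewrite cat_uniq => /andP[].
have [w wdef] : exists w, w = rts (rem c sA) * rts sB ^+ 2 by eexists.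
have hE : kpoly sA sB = ('X - c%:P) * w.
  by rewrite wdef /kpoly {1}/rts (perm_big _ (perm_to_rem cA)) big_cons -mulrA.
have wc : w.[c] != 0.
  rewrite wdef hornerM horner_exp mulf_neq0 ?expf_neq0 ?rts_neq ?kummer_uniqA //.
  by rewrite mem_rem_uniq // inE eqxx.
have wy : eval1 j x w * (x - j c) = y ^+ 3.
  by rewrite (ku_eq ku) -/(kpoly _ _) hE rmorphM /= eval1_XsubC mulrC.
have tE : eval2_hom j x y 'X = y by exact: eval2X.
split=> //.
- by move=> a; rewrite /= eval2C eval1C.
- by move=> a; rewrite pt_evalE /= !hornerC.
- by move=> u; exact: kummer_kernel.
- by rewrite pt_evalE hornerX hornerC.
- by rewrite tE.
- apply: rp_factorI; rewrite ?tE //.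
  + by move=> u; exact: kummer_kernel.
  + move=> u u0; have [Q [r uE]] := poly2_taylor u c 0.
    exists w%:P, (w%:P * Q + r%:P * 'X^2); split.
      by rewrite pt_evalE hornerC.
    have uE' : eval2 j x y u = eval2 j x y Q * y + eval1 j x r * (x - j c).
      rewrite uE u0 !polyC0 addr0 subr0 eval2D eval2C.
      by rewrite eval2M rmorphM /= eval1_XsubC eval2X.
    rewrite !eval2_homE uE' eval2D !eval2M !eval2C !eval2X.
    have -> : eval1 j x w * (eval2 j x y Q * y + eval1 j x r * (x - j c)) =
      eval1 j x w * eval2 j x y Q * y + eval1 j x r * (eval1 j x w * (x - j c)) by ring.
    by rewrite wy; ring.
  + move=> u u0; have [u' [d [d0 ud]]] := kummer_inverse u0.
    have [m [q [qc dE]]] := poly_factor c d0.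
    exists u', (3 * m)%N, (w ^+ m)%:P, q%:P; split.
    * by rewrite pt_evalE hornerC horner_exp expf_neq0.
    * by rewrite pt_evalE hornerC.
    * rewrite !eval2_homE -mulrA ud !eval2C dE rmorphM !rmorphXn /= eval1_XsubC.
      by rewrite mulrA -exprMn wy -exprM.
- exact: kummer_frac.
Qed.

Lemma kummer_ord_ramified P c : c \in sA -> vge P 1 (x - j c) ->
  [/\ centered (eval2_hom j x y) (pt_eval c 0) P, P (x - j c) = 3 & P y = 1].
Proof.
move=> cA xc; have [eta etah yc] := kummer_center xc.
have eta0 : eta = 0.
  apply/eqP; move: etah; rewrite kpolyE; move: (cA); rewrite -root_rts => /rootP ->.
  by rewrite mul0r => /eqP; rewrite expf_eq0.
subst eta; have cP := centered_eval2 xc yc.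
have := centered_param (kummer_regular_ramified cA) cP; rewrite eval2_homE eval2X => Py.
split=> //.
have usA : uniq sA by have := ku_uniq ku; rewrite cat_uniq => /andP[].
have wc : (rts (rem c sA) * rts sB ^+ 2).[c] != 0.
  rewrite hornerM horner_exp mulf_neq0 ?expf_neq0 ?rts_neq ?kummer_uniqA //.
  by rewrite mem_rem_uniq // inE eqxx.
have [w0 Pw] := ord_eval1_unit xc wc.
have := ordX P y 3; rewrite Py (ku_eq ku) {1}/rts (perm_big _ (perm_to_rem cA)) big_cons.
rewrite -mulrA rmorphM /= eval1_XsubC ord_mul ?Pw ?addr0 ?mulr1 //.
exact: transcendental_sub_neq0.
Qed.

Lemma kummer_ord_unramified P c eta : eta ^+ 3 = (kpoly sA sB).[c] -> eta != 0 ->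
  vge P 1 (x - j c) -> vge P 1 (y - j eta) -> P (x - j c) = 1.
Proof.
move=> etah eta0 xc yc; have cP := centered_eval2 xc yc.
by have := centered_param (kummer_regular_unramified etah eta0) cP; rewrite eval2_homE eval2C eval1_XsubC.
Qed.

Lemma centered_xy P c eta : centered (eval2_hom j x y) (pt_eval c eta) P ->
  vge P 1 (x - j c) /\ vge P 1 (y - j eta).
Proof.
move=> cP; split.
  rewrite -eval1_XsubC -(eval2C _ _ y) -eval2_homE; apply: cP.
  by rewrite pt_evalE hornerC !hornerE subrr.
have -> : y - j eta = eval2_hom j x y ('X - eta%:P%:P).
  by rewrite eval2_homE eval2_zmod eval2X eval2C eval1C.
by apply: cP; rewrite pt_evalE !hornerE subrr.
Qed.

Lemma kummer_place_ramified c : c \in sA -> exists P, vge P 1 (x - j c).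
Proof.
move=> cA; have [P cP] := rp_place (kummer_regular_ramified cA).
by exists P; case: (centered_xy cP).
Qed.

Lemma kummer_place_unramified c eta : eta ^+ 3 = (kpoly sA sB).[c] -> eta != 0 ->
  exists P, vge P 1 (x - j c) /\ vge P 1 (y - j eta).
Proof.
move=> etah eta0; have [P cP] := rp_place (kummer_regular_unramified etah eta0).
by exists P; exact: centered_xy.
Qed.

Lemma kummer_uniq_ramified P Q c : c \in sA ->
  vge P 1 (x - j c) -> vge Q 1 (x - j c) -> P = Q.
Proof.
move=> cA /(kummer_ord_ramified cA) [cP _ _] /(kummer_ord_ramified cA) [cQ _ _].
exact: (centered_uniq (kummer_regular_ramified cA)).
Qed.

Lemma kummer_uniq_unramified P Q c eta : eta ^+ 3 = (kpoly sA sB).[c] -> eta != 0 ->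
  vge P 1 (x - j c) -> vge P 1 (y - j eta) ->
  vge Q 1 (x - j c) -> vge Q 1 (y - j eta) -> P = Q.
Proof.
move=> etah eta0 xP yP xQ yQ.
by apply: (centered_uniq (kummer_regular_unramified etah eta0)); exact: centered_eval2.
Qed.

Lemma kummer_residue_unramified P z c : c \notin sA ++ sB -> vge P 1 (x - j c) ->
  vge P 0 z -> exists a, vge P 1 (z - j a).
Proof.
move=> cAB xc; have [eta etah yc] := kummer_center xc.
have eta0 : eta != 0.
  have : eta ^+ 3 != 0.
    rewrite etah kpolyE mulf_neq0 ?expf_neq0 // rts_neq //;
    by apply: contra cAB => h; rewrite mem_cat h ?orbT.
  by rewrite expf_eq0.
exact: (centered_residue (kummer_regular_unramified etah eta0) (centered_eval2 xc yc)).
Qed.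

Lemma kummer_residue_ramified P z c : c \in sA -> vge P 1 (x - j c) ->
  vge P 0 z -> exists a, vge P 1 (z - j a).
Proof.
move=> cA /(kummer_ord_ramified cA) [cP _ _].
exact: (centered_residue (kummer_regular_ramified cA) cP).
Qed.

End Curve.

Lemma kummer_residue_fin x y sA sB P z : kummer j x y sA sB ->
  vge P 0 x -> vge P 0 z -> exists a, vge P 1 (z - j a).
Proof.
move=> ku x0; have [c xc] := kummer_finite ku x0.
have [|cAB] := boolP (c \in sA ++ sB); last exact: (kummer_residue_unramified ku cAB xc).
rewrite mem_cat => /orP[cA|cB]; first exact: (kummer_residue_ramified ku cA xc).
exact: (kummer_residue_ramified (kummer_swap ku) cB xc).
Qed.

End KummerPlaces.

(** * Sums of terms of distinct orders *)

Section Ultrametric.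
Variables (k E : fieldType) (j : {rmorphism k -> E}) (P : place j).

Lemma vge_sum2 n u v : (u != 0 -> v != 0 -> P u <> P v) ->
  vge P n (u + v) -> vge P n u /\ vge P n v.
Proof.
have [->|u0] := eqVneq u 0; first by rewrite add0r vge0.
have [->|v0] := eqVneq v 0; first by rewrite addr0 vge0.
move=> /(_ isT isT) neq.
wlog lt : u v u0 v0 neq / P u < P v.
  move=> wl uv; have [lt|lt|//] := ltgtP (P u) (P v); first exact: wl uv.
  by rewrite addrC in uv; have [] := wl v u v0 u0 (fun h => neq (esym h)) lt uv.
have [|uv0 Puv] := @ordD_lt _ _ _ P u v u0.
  by rewrite vgeP //; move: (P u) (P v) lt => a b; lia.
by rewrite !vgeP // Puv => nu; split=> //; apply: le_trans nu (ltW lt).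
Qed.

(** Terms of pairwise distinct orders cannot cancel, so a bound on the sum is a bound on each term.
    It is applied to orders distinct modulo 3. *)
Lemma vge_sum3 n u v w :
  (u != 0 -> v != 0 -> P u <> P v) -> (u != 0 -> w != 0 -> P u <> P w) ->
  (v != 0 -> w != 0 -> P v <> P w) ->
  vge P n (u + v + w) -> [/\ vge P n u, vge P n v & vge P n w].
Proof.
move=> uv uw vw; rewrite -addrA => h.
suff : u != 0 -> v + w != 0 -> P u <> P (v + w).
  by move=> /vge_sum2/(_ h) [hu /(vge_sum2 vw) [hv hw]].
have [v0|v0] := eqVneq v 0; first by rewrite v0 add0r.
have [w0|w0] := eqVneq w 0; first by rewrite w0 addr0 => u0 _; exact: uv.
move=> u0 _; have [lt|lt|//] := ltgtP (P v) (P w).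
- have [|_ ->] := @ordD_lt _ _ _ P v w v0; last exact: uv.
  by rewrite vgeP //; move: (P v) (P w) lt => a b; lia.
- rewrite addrC; have [|_ ->] := @ordD_lt _ _ _ P w v w0; last exact: uw.
  by rewrite vgeP //; move: (P v) (P w) lt => a b; lia.
- by move=> e; have := vw v0 w0; rewrite e.
Qed.

End Ultrametric.

(** * The integral closure of k[x] *)

Section KummerGenus.
Variables (k : closedFieldType) (E : fieldType) (j : {rmorphism k -> E}).
Hypothesis three_neq0 : 3%:R != 0 :> k.
Implicit Type P : place j.

Lemma cube_root_unity : exists zeta : k, zeta ^+ 2 + zeta + 1 = 0.
Proof.
have /closed_rootP [z] : size ('X^2 + ('X + 1%:P) : {poly k}) != 1%N.
  by rewrite size_polyDl size_polyXn // size_XaddC.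
by rewrite rootE !hornerD hornerXn hornerX hornerC addrA => /eqP; exists z.
Qed.

Definition kcomb x y sB p0 p1 p2 :=
  eval1 j x p0 + eval1 j x p1 * y + eval1 j x p2 * kconj j x y sB.

Lemma kcomb_swap x y sA sB p0 p1 p2 : kummer j x y sA sB ->
  kcomb x (kconj j x y sB) sA p0 p2 p1 = kcomb x y sB p0 p1 p2.
Proof. by move=> ku; rewrite /kcomb (kconj_kconj ku); ring. Qed.

Lemma ord_eval1_ramified P x c p : vge P 1 (x - j c) -> P (x - j c) = 3 -> p != 0 ->
  x - j c != 0 ->
  exists m : nat, [/\ eval1 j x p != 0, P (eval1 j x p) = 3 * m%:Z & (0 < m)%N -> root p c].
Proof.
move=> xc x3 p0 x0; have [m [q [qc pE]]] := poly_factor c p0; exists m.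
have [q0 Pq] := ord_eval1_unit xc qc.
rewrite pE rmorphM rmorphXn /= eval1_XsubC mulf_neq0 ?expf_neq0 // ord_mul ?expf_neq0 //.
rewrite ordX x3 Pq addr0 mulrC; split=> // m0.
by case: (m) m0 => // n _; rewrite rootE hornerM horner_exp hornerXsubC subrr expr0n mul0r.
Qed.

Section Curve.
Variables (x y : E) (sA sB : seq k).
Hypothesis ku : kummer j x y sA sB.
Let cb := ku_basis ku.
Let tx := cb_trans cb.

Lemma kconj_neq0 : kconj j x y sB != 0.
Proof. exact: cb_neq0 (ku_basis (kummer_swap ku)). Qed.

(** Orders of polynomials in x are divisible by 3 at this place, while 1, y and [kconj] have orders
    0, 1, 2. So each of the three terms has order at least 3, which only a factor x - c of the
    polynomial can provide. *)
Lemma kcomb_root_ramified c p0 p1 p2 : c \in sA ->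
  (forall P, vge P 1 (x - j c) -> vge P (P (x - j c)) (kcomb x y sB p0 p1 p2)) ->
  [/\ root p0 c, root p1 c & root p2 c].
Proof.
move=> cA h; have [P xc] := kummer_place_ramified ku cA.
have [_ x3 y1] := kummer_ord_ramified ku cA xc.
have x0 := transcendental_sub_neq0 c tx.
have y0 := cb_neq0 cb.
have y20 := kconj_neq0.
have y2 : P (kconj j x y sB) = 2.
  have cB := kummer_uniqA ku cA.
  have [B0 PB] := ord_eval1_unit xc (rts_neq cB).
  by rewrite /kconj ord_div ?expf_neq0 // PB ordX y1 subr0 mulr1.
have ordp p t (r : nat) : t != 0 -> P t = r%:Z -> eval1 j x p * t != 0 ->
    exists m : nat, P (eval1 j x p * t) = 3 * m%:Z + r%:Z /\ ((0 < m)%N -> root p c).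
  move=> t0 tr pt0; have p0' : p != 0.
    by apply: contra_neq pt0 => ->; rewrite rmorph0 mul0r.
  have [m [e0 Pp mr]] := ord_eval1_ramified xc x3 p0' x0; exists m.
  by rewrite ord_mul // Pp tr.
have rootp p t (r : nat) : t != 0 -> P t = r%:Z -> (r < 3)%N ->
    vge P 3 (eval1 j x p * t) -> root p c.
  move=> t0 tr r3; have [/eqP|pt0] := eqVneq (eval1 j x p * t) 0.
    rewrite mulf_eq0 (negPf t0) orbF => /eqP/tx -> _; exact: root0.
  have [m [Pm mr]] := ordp p t r t0 tr pt0; rewrite vgeP // Pm => m3; apply: mr.
  by lia.
have o0 := ordp _ 1 0%N (oner_neq0 _) (ord_one P).
have o1 := ordp _ y 1%N y0 y1; have o2 := ordp _ _ 2%N y20 y2.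
have := h P xc; rewrite x3 /kcomb -[eval1 j x p0]mulr1 => /vge_sum3 [].
- by move=> /o0 [m [-> _]] /o1 [n [-> _]]; lia.
- by move=> /o0 [m [-> _]] /o2 [n [-> _]]; lia.
- by move=> /o1 [m [-> _]] /o2 [n [-> _]]; lia.
move=> h0 h1 h2; split.
- exact: (rootp _ 1 0%N (oner_neq0 _) (ord_one P)).
- exact: (rootp _ y 1%N).
- exact: (rootp _ (kconj j x y sB) 2%N).
Qed.

(** The combination vanishes at the three points (c, eta), (c, z eta), (c, z^2 eta), with z a
    primitive cube root of unity; inverting this Vandermonde system requires 3 <> 0. *)
Lemma kcomb_root_unramified c p0 p1 p2 : c \notin sA ++ sB ->
  (forall P, vge P 1 (x - j c) -> vge P (P (x - j c)) (kcomb x y sB p0 p1 p2)) ->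
  [/\ root p0 c, root p1 c & root p2 c].
Proof.
rewrite mem_cat negb_or => /andP[cA cB] h.
have Ac := rts_neq cA; have Bc := rts_neq cB.
have [eta etah] := cube_root (kpoly sA sB).[c].
have hc0 : (kpoly sA sB).[c] != 0 by rewrite kpolyE mulf_neq0 ?expf_neq0.
have eta0 : eta != 0 by move: hc0; rewrite -etah expf_eq0.
have [z z2] := cube_root_unity.
have z3 : z ^+ 3 = 1.
  by apply/eqP; rewrite -subr_eq0; apply/eqP; rewrite -[RHS](mulr0 (z - 1)) -z2; ring.
have z0 : z != 0.
  by apply/eqP => zE; move: z3; rewrite zE expr0n => /eqP; rewrite eq_sym oner_eq0.
(* The combination multiplied by B, which is a unit at c, so that it becomes a polynomial in x and
   y. *)
pose U := poly3 (p0 * rts sB) (p1 * rts sB) p2.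
have key e : e ^+ 3 = (kpoly sA sB).[c] -> e != 0 -> pt_eval c e U = 0.
  move=> eh e0; have [P [xc yc]] := kummer_place_unramified three_neq0 ku eh e0.
  have cP := centered_eval2 ku xc yc.
  have rp := kummer_regular_unramified three_neq0 ku eh e0.
  apply: contrapT => /eqP Ue.
  have := h P xc; rewrite (kummer_ord_unramified three_neq0 ku eh e0 xc yc).
  have [B0 PB] := ord_eval1_unit xc Bc.
  have UE : eval2 j x y U = eval1 j x (rts sB) * kcomb x y sB p0 p1 p2.
    by rewrite eval2_poly3 /comb3 /kcomb /kconj !rmorphM /=; field.
  have U0 : eval2 j x y U != 0.
    by apply: contra_neq Ue => U0; apply: (rp_ker rp).
  move=> h1; have : vge P 1 (eval2 j x y U).
    by rewrite UE; apply: vgeM0 h1; rewrite /vge PB lexx orbT.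
  by rewrite vgeP // (centered_unit rp cP Ue).
have e1 := key eta etah eta0.
have e2 := key (z * eta); have e3 := key (z ^+ 2 * eta).
rewrite exprMn z3 mul1r etah mulf_neq0 // in e2; have {}e2 := e2 erefl isT.
rewrite exprMn -exprM mulnC exprM z3 expr1n mul1r etah mulf_neq0 ?expf_neq0 // in e3.
have {}e3 := e3 erefl isT.
move: e1 e2 e3; rewrite !pt_evalE /U /poly3 !hornerE /=.
set a0 := p0.[c]; set a1 := p1.[c]; set a2 := p2.[c]; set b := (rts sB).[c] => e1 e2 e3.
set E1 := _ + _ in e1; set E2 := _ + _ in e2; set E3 := _ + _ in e3.
(* Discrete Fourier inversion: the sum of [E1], [E2], [E3], weighted by powers of z, is three times
   one coefficient modulo z^2 + z + 1. The cofactor in each identity is the explicit quotient. *)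
have r0 : a0 * b = 0.
  apply: (mulfI three_neq0); rewrite mulr0.
  have -> : 3%:R * (a0 * b) = E1 + E2 + E3 - (z ^+ 2 + z + 1) *
      (a1 * b * eta + a2 * eta ^+ 2 * (1 - z + z ^+ 2)) by rewrite /E1 /E2 /E3; ring.
  by rewrite e1 e2 e3 z2 mul0r subr0 !addr0.
have r1 : a1 * b = 0.
  apply: (mulIf eta0); apply: (mulfI three_neq0); rewrite mul0r mulr0.
  have -> : 3%:R * (a1 * b * eta) = E1 + z ^+ 2 * E2 + z * E3 - (z ^+ 2 + z + 1) *
     (a0 * b + a2 * eta ^+ 2 * (z ^+ 3 - z + 1) + 2%:R * (z - 1) * (a1 * b * eta)).
    by rewrite /E1 /E2 /E3; ring.
  by rewrite e1 e2 e3 z2 mul0r !mulr0 subr0 !addr0.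
have r2 : a2 = 0.
  apply: (mulIf (expf_neq0 2 eta0)); apply: (mulfI three_neq0); rewrite mul0r mulr0.
  have -> : 3%:R * (a2 * eta ^+ 2) = E1 + z * E2 + z ^+ 2 * E3 - (z ^+ 2 + z + 1) *
     (a0 * b + a1 * b * eta * (1 - z + z ^+ 2) + (z - 1) * (z ^+ 3 + 2%:R) * (a2 * eta ^+ 2)).
    by rewrite /E1 /E2 /E3; ring.
  by rewrite e1 e2 e3 z2 mul0r !mulr0 subr0 !addr0.
move/eqP: r0; move/eqP: r1; rewrite !mulf_eq0 (negPf Bc) !orbF => /eqP r1 /eqP r0.
by split; apply/rootP.
Qed.

End Curve.

Lemma kcomb_root x y sA sB c p0 p1 p2 : kummer j x y sA sB ->
  (forall P, vge P 1 (x - j c) -> vge P (P (x - j c)) (kcomb x y sB p0 p1 p2)) ->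
  [/\ root p0 c, root p1 c & root p2 c].
Proof.
move=> ku h; have [|cAB] := boolP (c \in sA ++ sB); last first.
  exact: (kcomb_root_unramified ku cAB).
rewrite mem_cat => /orP[cA|cB]; first exact: (kcomb_root_ramified ku cA).
have [|r0 r2 r1] := kcomb_root_ramified (kummer_swap ku) cB (p0 := p0) (p1 := p2) (p2 := p1).
  by move=> P xc; rewrite (kcomb_swap _ _ _ ku); exact: h.
by split.
Qed.

(** A common denominator is removed root by root: at a root c the numerator vanishes to the order of
    x - c at all places above c, so by [kcomb_root] all three polynomials are divisible by X - c. *)
Lemma kummer_integral_closure x y sA sB f : kummer j x y sA sB ->
  (forall P, vge P 0 x -> vge P 0 f) -> exists p0 p1 p2, f = kcomb x y sB p0 p1 p2.
Proof.
move=> ku fint; have cb := ku_basis ku; have tx := cb_trans cb.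
have [d [p0 [p1 [p2 [d0 fd]]]]] : exists d p0 p1 p2, d != 0 /\
    f * eval1 j x d = kcomb x y sB p0 p1 p2.
  have [d [p0 [p1 [p2 [d0 fd]]]]] := cb_span_poly f cb.
  exists d, p0, p1, (p2 * rts sB); split=> //.
  rewrite fd /comb3 /kcomb /kconj rmorphM /=; congr (_ + _).
  by have B0 := kummer_rts_neq0 sB ku; field.
move: {2}(size d) (leqnn (size d)) => n.
elim: n d d0 p0 p1 p2 fd => [|n IH] d d0 p0 p1 p2 fd.
  by rewrite leqn0 size_poly_eq0 (negPf d0).
move=> dn; have [d1|d1] := eqVneq (size d) 1%N.
  have /size_poly1P [c c0 dE] := introT eqP d1.
  exists (c^-1 *: p0), (c^-1 *: p1), (c^-1 *: p2).
  have jc0 : j c != 0 by rewrite fmorph_eq0.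
  apply: (mulIf jc0); rewrite -(eval1C j x c) -dE fd /kcomb !eval1Z dE eval1C fmorphV.
  by field.
have [c dc] := closed_rootP _ d1.
have /factor_theorem [d' dE] := dc.
have xc0 := transcendental_sub_neq0 c tx.
have [|/factor_theorem [q0 q0E] /factor_theorem [q1 q1E] /factor_theorem [q2 q2E]] :=
    kcomb_root ku (c := c) (p0 := p0) (p1 := p1) (p2 := p2).
  move=> P xc; have x0 := vge0_sub xc.
  rewrite -fd dE rmorphM /= eval1_XsubC mulrA -[X in vge P X _]add0r.
  by apply: vgeM; [apply: vgeM0; [exact: fint|exact: vge_eval1]|exact: vge_ord].
have d'0 : d' != 0 by apply: contra_neq d0; rewrite dE => ->; rewrite mul0r.
apply: (IH d' d'0 q0 q1 q2).
  apply: (mulIf xc0); move: fd; rewrite dE q0E q1E q2E /kcomb !rmorphM /= eval1_XsubC mulrA => ->.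
  by ring.
by move: dn; rewrite dE size_mul ?polyXsubC_eq0 // size_XsubC addn2.
Qed.

End KummerGenus.

(** * The place at infinity and the genus *)

Section KummerInfinity.
Variables (k : closedFieldType) (E : fieldType) (j : {rmorphism k -> E}).
Hypothesis three_neq0 : 3%:R != 0 :> k.
Variables (x y : E) (sA sB : seq k).
Hypothesis ku : kummer j x y sA sB.
(** The degree of A B^2 is prime to 3, which means that infinity is totally ramified, tamely since 3
    is invertible. *)
Hypothesis wild : ((size sA + 2 * size sB) %% 3 != 0)%N.
Implicit Types P Q : place j.
Let cb := ku_basis ku.
Let tx := cb_trans cb.

(** In the coordinate 1/x infinity becomes the finite branch point 0, so the results on finite
    ramified places apply to it. *)
Lemma kummer_at_infinity : exists w sA' sB', kummer j x^-1 w sA' sB' /\ 0 \in sA'.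
Proof.
have [w] := kummer_moebius 0 ku; rewrite rmorph0 subr0 => ku'.
have [e|e] : ((size sA + 2 * size sB) %% 3 = 1 \/ (size sA + 2 * size sB) %% 3 = 2)%N.
- clear three_neq0; have := ltn_pmod (size sA + 2 * size sB) (isT : (0 < 3)%N).
  by move: wild; case: (_ %% 3)%N => [|[|[|]]] // _ _; [left|right].
- have := kummer_swap ku'; rewrite e /= => ku''.
  by eexists; eexists; eexists; split; first exact: ku''; rewrite mem_head.
- move: ku'; rewrite e /= => ku''.
  by eexists; eexists; eexists; split; first exact: ku''; rewrite mem_head.
Qed.

Let x_neq0 : x != 0.
Proof. by have := transcendental_sub_neq0 0 tx; rewrite rmorph0 subr0. Qed.

Let infV P : P x < 0 -> vge P 1 (x^-1 - j 0).
Proof. by rewrite rmorph0 subr0 vgeP ?invr_eq0 // ordV; clear three_neq0; lia. Qed.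

Lemma infinite_place : exists P, P x < 0.
Proof.
have [w [sA' [sB' [ku' s0]]]] := kummer_at_infinity.
have [P] := kummer_place_ramified ku' s0.
rewrite rmorph0 subr0 vgeP ?invr_eq0 // ordV => P1; exists P; clear three_neq0; lia.
Qed.

Lemma infinite_place_ord P : P x < 0 -> P x = - 3.
Proof.
have [w [sA' [sB' [ku' s0]]]] := kummer_at_infinity.
move=> /infV/(kummer_ord_ramified ku' s0) [_ + _].
by rewrite rmorph0 subr0 ordV => <-; rewrite opprK.
Qed.

Lemma infinite_place_uniq P Q : P x < 0 -> Q x < 0 -> P = Q.
Proof.
have [w [sA' [sB' [ku' s0]]]] := kummer_at_infinity.
by move=> /infV hP /infV; exact: (kummer_uniq_ramified ku' s0).
Qed.

Lemma kummer_residue P z : vge P 0 z -> exists a, vge P 1 (z - j a).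
Proof.
have [x0|] := boolP (vge P 0 x); first exact: (kummer_residue_fin three_neq0 ku).
rewrite vgeP // -ltNge => /infV.
have [w [sA' [sB' [ku' s0]]]] := kummer_at_infinity.
exact: (kummer_residue_ramified ku' s0).
Qed.

Variable Pinf : place j.
Hypothesis xinf : Pinf x < 0.

Lemma infinite_place_fin P : P <> Pinf -> vge P 0 x.
Proof.
move=> PP; rewrite vgeP // leNgt; apply/negP => Px; apply: PP.
exact: infinite_place_uniq.
Qed.

Lemma finite_place_neq P : vge P 0 x -> P <> Pinf.
Proof. by rewrite vgeP // => + PP; rewrite PP leNgt xinf. Qed.

Let xinf3 := infinite_place_ord xinf.

Lemma infinite_ord_rts s : Pinf (eval1 j x (rts s)) = - 3 * (size s)%:Z.
Proof. by have [_ ->] := ord_pole xinf (rts_neq0 s); rewrite size_rts xinf3 mulrC. Qed.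

Lemma infinite_ord_y : Pinf y = - (size sA + 2 * size sB)%N%:Z.
Proof.
have := ordX Pinf y 3; rewrite (ku_eq ku) rmorphM rmorphXn /= ord_mul ?expf_neq0 //.
- rewrite ordX !infinite_ord_rts; move: (Pinf y) (size sA) (size sB) => e a b; clear; lia.
- exact: kummer_rts_neq0 ku.
- exact: kummer_rts_neq0 ku.
Qed.

Lemma infinite_ord_kconj : Pinf (kconj j x y sB) = - (2 * size sA + size sB)%N%:Z.
Proof.
rewrite /kconj ord_div ?expf_neq0 ?(cb_neq0 cb) //; last exact: kummer_rts_neq0 ku.
rewrite ordX infinite_ord_y infinite_ord_rts; move: (size sA) (size sB) => a b; clear; lia.
Qed.

(** With a and b the sizes of [sA] and [sB], the three terms have orders 0, -(a + 2b) and -(2a + b)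
    modulo 3 at infinity. The last two are opposite and nonzero, so all three are distinct. *)
Lemma kummer_riemann_roch n f : (forall P, P <> Pinf -> vge P 0 f) -> vge Pinf n f ->
  exists p0 p1 p2, [/\ f = kcomb j x y sB p0 p1 p2, vge Pinf n (eval1 j x p0),
    vge Pinf n (eval1 j x p1 * y) & vge Pinf n (eval1 j x p2 * kconj j x y sB)].
Proof.
move=> ffin finf; have [|p0 [p1 [p2 fE]]] := kummer_integral_closure three_neq0 ku (f := f).
  by move=> P /finite_place_neq; exact: ffin.
exists p0, p1, p2; move: finf; rewrite {1}fE /kcomb => /vge_sum3 h.
have ordp p t : eval1 j x p * t != 0 ->
    exists m : nat, Pinf (eval1 j x p * t) = - 3 * m%:Z + Pinf t.
  rewrite mulf_eq0 negb_or => /andP[p0' t0]; rewrite ord_mul //.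
  have pn0 : p != 0 by apply: contra_neq p0' => ->; rewrite rmorph0.
  by have [_ ->] := ord_pole xinf pn0; exists (size p).-1; rewrite xinf3 mulrC.
have o0 := ordp p0 1; rewrite mulr1 ord_one in o0.
have o1 := ordp p1 y; rewrite infinite_ord_y in o1.
have o2 := ordp p2 (kconj j x y sB); rewrite infinite_ord_kconj in o2.
move: wild; set a := size sA in o1 o2 *; set b := size sB in o1 o2 * => wild'.
case: h => [/o0[m ->]/o1[m' ->]|/o0[m ->]/o2[m' ->]|/o1[m ->]/o2[m' ->]|].
- by clear -wild'; lia.
- by clear -wild'; lia.
- by clear -wild'; lia.
by split.
Qed.

(** A branch point carries one place, of order 3; any other point carries at most one place of order
    1 for each cube root of h(c). *)
Lemma kummer_sum c : exists s : seq (place j), [/\ uniq s, Pinf \notin s,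
  forall P, P <> Pinf -> vge P 1 (x - j c) -> P \in s & \sum_(P <- s) P (x - j c) <= 3%N%:Z].
Proof.
have notin P : vge P 1 (x - j c) -> P != Pinf.
  by move=> /vge0_sub/finite_place_neq/eqP.
have ram x' sA' sB' : kummer j x x' sA' sB' -> c \in sA' -> exists s : seq (place j),
  [/\ uniq s, Pinf \notin s,
  forall P, P <> Pinf -> vge P 1 (x - j c) -> P \in s & \sum_(P <- s) P (x - j c) <= 3%N%:Z].
  move=> ku' cA; have [P xc] := kummer_place_ramified ku' cA.
  exists [:: P]; split=> //.
  - by rewrite mem_seq1 eq_sym notin.
  - move=> Q _ xQ; rewrite mem_seq1; apply/eqP.
    exact: (kummer_uniq_ramified ku' cA).
  - by rewrite big_seq1; have [_ ->] := kummer_ord_ramified ku' cA xc.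
have [|cAB] := boolP (c \in sA ++ sB).
  rewrite mem_cat => /orP[|]; first exact: ram ku.
  exact: ram (kummer_swap ku).
have hc0 : (kpoly sA sB).[c] != 0.
  by move: cAB; rewrite mem_cat negb_or => /andP[cA cB];
    rewrite kpolyE mulf_neq0 ?expf_neq0 ?rts_neq.
have [eta etah] := cube_root (kpoly sA sB).[c].
have eta0 : eta != 0 by move: hc0; rewrite -etah expf_eq0.
have [z z2] := @cube_root_unity k.
have z3 : z ^+ 3 = 1.
  by apply/eqP; rewrite -subr_eq0; apply/eqP; rewrite -[RHS](mulr0 (z - 1)) -z2; ring.
have z0 : z != 0.
  by apply/eqP => zE; move: z3; rewrite zE expr0n => /eqP; rewrite eq_sym oner_eq0.
have z1 : z != 1.
  apply/eqP => zE; move: z2; rewrite zE => /eqP.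
  have -> : 1 ^+ 2 + 1 + 1 = 3%:R :> k by ring.
  by rewrite (negPf three_neq0).
have roots e : e ^+ 3 = (kpoly sA sB).[c] -> e \in [:: eta; z * eta; z ^+ 2 * eta].
  rewrite -etah => /eqP; rewrite -subr_eq0.
  have -> : e ^+ 3 - eta ^+ 3 = (e - eta) * ((e - z * eta) * (e - z ^+ 2 * eta)).
    rewrite -[LHS](addr0 (e ^+ 3 - eta ^+ 3)) -(mulr0 ((1 - z) * eta ^+ 3 +
      z * eta ^+ 2 * e - eta * e ^+ 2)) -z2.
    by ring.
  by rewrite !mulf_eq0 !subr_eq0 !inE.
have rz e : e \in [:: eta; z * eta; z ^+ 2 * eta] -> e ^+ 3 = (kpoly sA sB).[c].
  rewrite !inE -etah => /or3P[] /eqP -> //; rewrite exprMn ?z3 ?mul1r //.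
  by rewrite -exprM mulnC exprM z3 expr1n mul1r.
have n0 e : e \in [:: eta; z * eta; z ^+ 2 * eta] -> e != 0.
  by move=> /rz eh; move: hc0; rewrite -eh expf_eq0.
have /choice [pl plP] : forall e, exists P, e \in [:: eta; z * eta; z ^+ 2 * eta] ->
    vge P 1 (x - j c) /\ vge P 1 (y - j e).
  move=> e; have [es|_] := boolP (e \in _); last by exists Pinf.
  have [P Pe] := kummer_place_unramified three_neq0 ku (rz e es) (n0 e es).
  by exists P.
exists (undup [seq pl e | e <- [:: eta; z * eta; z ^+ 2 * eta]]); split.
- exact: undup_uniq.
- rewrite mem_undup; apply/mapP => -[e es PE].
  by have [/notin] := plP e es; rewrite PE eqxx.
- move=> P _ xc; rewrite mem_undup; have [e eh yc] := kummer_center ku xc.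
  have es := roots e eh; apply/mapP; exists e => //.
  have [xe ye] := plP e es.
  exact: (kummer_uniq_unramified three_neq0 ku eh (n0 e es)).
- apply: (@le_trans _ _ (\sum_(P <- undup [seq pl e | e <- [:: eta; z * eta; z ^+ 2 * eta]]) 1)).
    rewrite big_seq [X in _ <= X]big_seq; apply: ler_sum => P.
    rewrite mem_undup => /mapP[e es ->]; have [xe ye] := plP e es.
    by rewrite (kummer_ord_unramified three_neq0 ku (rz e es) (n0 e es) xe ye).
  rewrite big_const_seq count_predT; have := size_undup [seq pl e | e <- [:: eta; z * eta; z ^+ 2 * eta]].
  by case: (undup _) => [|P1 [|P2 [|P3 [|]]]].
Qed.

(** For suitable lengths these monomials in the integral basis form a basis of L(3m Pinf). *)
Definition kmon n0 n1 n2 (i : 'I_n0 + ('I_n1 + 'I_n2)) : E :=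
  match i with
  | inl i => x ^+ i
  | inr (inl i) => x ^+ i * y
  | inr (inr i) => x ^+ i * kconj j x y sB
  end.

Definition opoly n (c : 'I_n -> k) : {poly k} := \sum_(i < n) c i *: 'X^i.

Lemma coef_opoly n (c : 'I_n -> k) (i : 'I_n) : (opoly c)`_i = c i.
Proof.
rewrite /opoly coef_sum (bigD1 i) //= coefZ coefXn eqxx mulr1 big1 ?addr0 // => l li.
by rewrite coefZ coefXn eq_sym val_eqE (negPf li) mulr0.
Qed.

Lemma opoly_coef n (p : {poly k}) : (size p <= n)%N -> opoly (fun i : 'I_n => p`_i) = p.
Proof.
move=> pn; apply/polyP => i; have [lt|ge] := ltnP i n.
  by rewrite (coef_opoly _ (Ordinal lt)).
rewrite [RHS]nth_default ?(leq_trans pn) // /opoly coef_sum big1 // => l _.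
rewrite coefZ coefXn gtn_eqF ?mulr0 //; exact: leq_trans (ltn_ord l) ge.
Qed.

Lemma eval1_opoly n (c : 'I_n -> k) : eval1 j x (opoly c) = \sum_(i < n) j (c i) * x ^+ i.
Proof. by rewrite /opoly rmorph_sum; apply: eq_bigr => i _ /=; rewrite eval1Z eval1Xn. Qed.

Lemma kmon_sum n0 n1 n2 (c : 'I_n0 + ('I_n1 + 'I_n2) -> k) :
  \sum_i j (c i) * kmon i = kcomb j x y sB (opoly (c \o inl)) (opoly (c \o inr \o inl))
    (opoly (c \o inr \o inr)).
Proof.
rewrite big_sumType big_sumType /= /kcomb !eval1_opoly !mulr_suml -addrA.
by congr (_ + (_ + _)); apply: eq_bigr => i _; rewrite mulrA.
Qed.

Lemma kcomb0 p0 p1 p2 : kcomb j x y sB p0 p1 p2 = 0 -> [/\ p0 = 0, p1 = 0 & p2 = 0].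
Proof.
move=> c0; have B0 := kummer_rts_neq0 sB ku.
have [] := @cb_indep_poly _ _ _ x y (p0 * rts sB) (p1 * rts sB) p2 cb.
  rewrite -[RHS](mul0r (eval1 j x (rts sB))) -c0 /comb3 /kcomb /kconj !rmorphM /=.
  by field.
by move=> /eqP + /eqP; rewrite !mulf_eq0 (negPf (rts_neq0 sB)) !orbF => /eqP -> /eqP -> ->.
Qed.

Lemma kmon_indep n0 n1 n2 : indep j (@kmon n0 n1 n2).
Proof.
move=> c; rewrite kmon_sum => /kcomb0 [c0 c1 c2] [i|[i|i]].
- by rewrite -[LHS](coef_opoly (c \o inl)) c0 coef0.
- by rewrite -[LHS](coef_opoly (c \o inr \o inl)) c1 coef0.
- by rewrite -[LHS](coef_opoly (c \o inr \o inr)) c2 coef0.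
Qed.

(** The number of i >= 0 for which x^i y, with pole order 3i + a + 2b, lies in L(3m Pinf). When
    there is none, truncated subtraction and division give 0. [n2] is the analogue for [kconj]. *)
Let n1 m := ((3 * m + 3 - (size sA + 2 * size sB)) %/ 3)%N.
Let n2 m := ((3 * m + 3 - (2 * size sA + size sB)) %/ 3)%N.

Lemma kmon_riemann_roch m i : riemann_roch_space (pole_divisor Pinf (3 * m))
  (@kmon m.+1 (n1 m) (n2 m) i).
Proof.
apply/riemann_rochP => P; rewrite /pole_divisor; have [->|/eqP PP] := eqVneq P Pinf.
  case: i => [i|[i|i]] /=.
  - rewrite vgeP ?expf_neq0 // ordX xinf3; have := ltn_ord i.
    by clear; lia.
  - have y0 := cb_neq0 cb; rewrite vgeP ?mulf_neq0 ?expf_neq0 // ord_mul ?expf_neq0 //.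
    rewrite ordX xinf3 infinite_ord_y; have := ltn_ord i; rewrite /n1.
    by move: (size sA) (size sB) (nat_of_ord i) => a b i'; clear; lia.
  - have := infinite_ord_kconj; have := kconj_neq0 ku; move: (kconj _ _ _ _) => t t0 ot.
    rewrite vgeP ?mulf_neq0 ?expf_neq0 // ord_mul ?expf_neq0 //.
    rewrite ordX xinf3 ot; have := ltn_ord i; rewrite /n2.
    by move: (size sA) (size sB) (nat_of_ord i) => a b i'; clear; lia.
have x0 := infinite_place_fin PP; rewrite oppr0.
case: i => [i|[i|i]] /=; first exact: vgeX.
  by apply: vgeM0; [exact: vgeX|exact: (kummer_integral ku)].
by apply: vgeM0; [exact: vgeX|exact: (kummer_integral (kummer_swap ku))].
Qed.

(** This is the Riemann-Hurwitz value 2g - 2 = -6 + 2(a + b + 1). It comes from counting monomials: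
    m + 1 + n1 + n2 = 3m + 2 - (a + b) for large m, the two roundings together costing exactly 1. *)
Lemma kummer_genus : has_genus j (size sA + size sB).-1.
Proof.
pose I m : finType := ('I_m.+1 + ('I_(n1 m) + 'I_(n2 m)))%type.
have cardI m : (size sA + size sB <= m)%N ->
    #|I m|%:Z = 3%N%:Z * m%:Z + 1 - (size sA + size sB).-1%:Z.
  rewrite !card_sum !card_ord /n1 /n2; move: wild.
  by move: (size sA) (size sB) => a b; clear; lia.
have pole n p : vge Pinf n (eval1 j x p) -> p != 0 -> n <= - 3 * (size p).-1%:Z.
  move=> + p0; have [e0 eP] := ord_pole xinf p0.
  by rewrite vgeP // eP xinf3 mulrC.
apply: (@genusI _ _ _ kummer_residue Pinf x 3 (size sA + size sB).-1) => //.
- by move=> P /infinite_place_fin; exact: (kummer_finite ku).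
- exact: kummer_sum.
- exists (size sA + size sB)%N => m mm; exists #|I m|, (@kmon _ _ _ \o enum_val); split.
  + exact: cardI.
  + by apply/indep_enum; exact: kmon_indep.
  + by move=> i; exact: kmon_riemann_roch.
exists (size sA + size sB)%N, #|I (size sA + size sB)%N|; split; first exact: cardI.
set m := (size sA + size sB)%N.
exists (@kmon _ _ _ \o enum_val); split.
- by move=> i; exact: kmon_riemann_roch.
- by apply/indep_enum; exact: kmon_indep.
move=> f /riemann_rochP fL.
have [P /eqP PP|| p0 [p1 [p2 [fE h0 h1 h2]]]] := @kummer_riemann_roch (- (3 * m)%N%:Z) f.
- by have := fL P; rewrite /pole_divisor (negPf PP) oppr0.
- by have := fL Pinf; rewrite /pole_divisor eqxx.
have s0 : (size p0 <= m.+1)%N.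
  have [->|p00] := eqVneq p0 0; first by rewrite size_poly0.
  by have := pole _ _ h0 p00; clear; lia.
have st p t (n : nat) : t != 0 -> Pinf t = - n%:Z ->
    vge Pinf (- (3 * m)%N%:Z) (eval1 j x p * t) -> (size p <= (3 * m + 3 - n) %/ 3)%N.
  have [->|p00] := eqVneq p 0; first by rewrite size_poly0.
  move=> t0 tn h; have : vge Pinf (- (3 * m)%N%:Z + n%:Z) (eval1 j x p).
    by rewrite -[eval1 j x p](mulfK t0); apply: vgeM h _; rewrite /vge ordV tn opprK lexx orbT.
  move=> /pole/(_ p00); have : (0 < size p)%N by rewrite size_poly_gt0.
  by move: (size p) (m) => s m'; clear; lia.
have s1 : (size p1 <= n1 m)%N by apply: (st _ y) h1; [exact: (cb_neq0 cb)|exact: infinite_ord_y].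
have s2 : (size p2 <= n2 m)%N.
  by apply: (st _ _) h2; [exact: (kconj_neq0 ku)|exact: infinite_ord_kconj].
pose c (i : I m) : k := match i with
  | inl i => p0`_i | inr (inl i) => p1`_i | inr (inr i) => p2`_i end.
exists (c \o enum_val).
have -> : \sum_(i < #|I m|) j ((c \o enum_val) i) * (@kmon _ _ _ \o enum_val) i =
   \sum_i j (c i) * kmon i.
  by rewrite [RHS](reindex (@enum_val (I m) (I m))) //=; apply: onW_bij; apply: enum_val_bij.
rewrite kmon_sum fE; congr kcomb.
- by rewrite -[LHS](opoly_coef s0).
- by rewrite -[LHS](opoly_coef s1).
- by rewrite -[LHS](opoly_coef s2).
Qed.

End KummerInfinity.

Lemma card_three (T : eqType) (A : set T) : (A #= `I_3)%card <->
  exists a b c, [/\ a <> b, a <> c, b <> c & forall s, A s <-> [\/ s = a, s = b | s = c]].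
Proof.
split=> [/card_set_bijP [f [fA finj fsurj]]|[a [b [c [ab ac bc AE]]]]].
  have [|a Aa fa] := fsurj 0%N; first by [].
  have [|b Ab fb] := fsurj 1%N; first by [].
  have [|c Ac fc] := fsurj 2%N; first by [].
  exists a, b, c; split.
  - by move=> e; move: fa; rewrite e fb.
  - by move=> e; move: fa; rewrite e fc.
  - by move=> e; move: fb; rewrite e fc.
  - move=> s; split=> [As|[->|->|->]] //.
    have inj t : A t -> f s = f t -> s = t.
      by move=> At; apply: finj; rewrite inE.
    have := fA s As => /=; case fs : (f s) => [|[|[|]]] // _.
    + by apply: Or31; apply: inj; rewrite ?fa.
    + by apply: Or32; apply: inj; rewrite ?fb.
    + by apply: Or33; apply: inj; rewrite ?fc.
apply/card_set_bijP; exists (fun s => if s == a then 0%N else if s == b then 1%N else 2%N).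
have ba : (b == a) = false by apply/eqP => e; apply: ab.
have ca : (c == a) = false by apply/eqP => e; apply: ac.
have cb : (c == b) = false by apply/eqP => e; apply: bc.
split.
- by move=> s _ /=; case: ifP => // _; case: ifP.
- move=> s t; rewrite !inE => /AE + /AE.
  by move=> [->|->|->] [->|->|->] //; rewrite ?eqxx ?ba ?ca ?cb.
- move=> [|[|[|]]] // _.
  + by exists a; [apply/AE/Or31|rewrite eqxx].
  + by exists b; [apply/AE/Or32|rewrite ba eqxx].
  + by exists c; [apply/AE/Or33|rewrite ca cb].
Qed.

(** * Kummer models of Galois covers of degree three *)

Section Galois.
Variables (k : closedFieldType) (E : fieldType) (j : {rmorphism k -> E}).
Hypothesis three_neq0 : 3%:R != 0 :> k.

Definition fixing (x : E) : set (E -> E) :=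
  automorphism_group j `&` [set s : E -> E | s x = x].

Lemma automorphism_rmorphism s : automorphism_group j s ->
  exists g : {rmorphism E -> E}, g =1 s.
Proof. by case=> sB s1 sM _ _; exact: rmorphismP. Qed.

Lemma fixing_id x : fixing x id.
Proof. by split=> //; split=> //; exists id. Qed.

Lemma fixing_comp x s t : fixing x s -> fixing x t -> fixing x (s \o t).
Proof.
move=> [[sB s1 sM sb sj] /= sx] [[tB t1 tM tb tj] /= tx]; split=> /=; last by rewrite tx.
split=> [y z|/=|y z||c] /=; rewrite ?tB ?t1 ?tM ?tj //.
exact: bij_comp.
Qed.

Lemma fixing_simple x s z : fixing x s -> simple_subfield j x z -> s z = z.
Proof.
move=> [sA /= sx] [p [q [q0 ->]]]; have [g gE] := automorphism_rmorphism sA.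
have ge r : g (eval1 j x r) = eval1 j x r.
  rewrite /eval1 -horner_map -map_poly_comp /= gE sx; congr _.[_].
  by apply: eq_map_poly => c /=; rewrite gE; case: sA.
by rewrite -gE fmorph_div !ge.
Qed.

(** A group of order 3 consists of the identity, a, and a o a for any nontrivial a, so an element
    fixed by this generator is fixed by the whole group. *)
Lemma cyclic_three x : (fixing x #= `I_3)%card -> exists s,
  [/\ fixing x s, exists z, s z <> z, forall z, s (s (s z)) = z
    & forall z, s z = z -> forall t, fixing x t -> t z = z].
Proof.
move=> /card_three A3.
have [a [b [aid bid ab AE]]] : exists a b, [/\ a <> id, b <> id, a <> b
    & forall s, fixing x s <-> [\/ s = id, s = a | s = b]].
  case: A3 => [a [b [c [ab ac bc AE]]]].
  have /AE [e|e|e] := fixing_id x.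
  - by exists b, c; rewrite e; split=> //; apply: nesym.
  - exists a, c; rewrite e; split=> // [|s]; first exact: nesym.
    by rewrite AE; split=> [[->|->|->]|[->|->|->]]; [apply: Or32|apply: Or31|apply: Or33|
      apply: Or32|apply: Or31|apply: Or33].
  - exists a, b; rewrite e; split=> // s.
    by rewrite AE; split=> [[->|->|->]|[->|->|->]]; [apply: Or32|apply: Or33|apply: Or31|
      apply: Or33|apply: Or31|apply: Or32].
have Aa : fixing x a by apply/AE/Or32.
have Ab : fixing x b by apply/AE/Or33.
have bij t : fixing x t -> bijective t by move=> [[]].
have inj t : fixing x t -> injective t by move=> /bij/bij_inj.
have fid (f g : E -> E) : (forall z, f z = g z) -> f = g by move=> h; apply/funext.
have aa : a \o a = b.
  have /AE [e|e|//] := fixing_comp Aa Aa; exfalso.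
  - have /AE [e'|e'|e'] := fixing_comp Aa Ab.
    + apply: ab; apply: fid => z; apply: (inj _ Aa).
      by have := congr1 (@^~ z) e; have := congr1 (@^~ z) e' => /= -> ->.
    + by apply: bid; apply: fid => z; apply: (inj _ Aa); have := congr1 (@^~ z) e'.
    + apply: aid; apply: fid => z; have [b' bb' b'b] := bij _ Ab.
      by have := congr1 (@^~ (b' z)) e' => /=; rewrite !b'b.
  - by apply: aid; apply: fid => z; apply: (inj _ Aa); have := congr1 (@^~ z) e.
have aaa : a \o b = id.
  have /AE [//|e|e] := fixing_comp Aa Ab; exfalso.
  - by apply: bid; apply: fid => z; apply: (inj _ Aa); have := congr1 (@^~ z) e.
  - apply: aid; apply: fid => z; have [b' bb' b'b] := bij _ Ab.
    by have := congr1 (@^~ (b' z)) e => /=; rewrite !b'b.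
exists a; split=> //.
- apply: contrapT => Nex; apply: aid; apply: fid => z; apply: contrapT => h.
  by apply: Nex; exists z.
- by move=> z; have := congr1 (@^~ z) aaa; rewrite -aa.
- by move=> z az t /AE [->|->|->] //; rewrite -aa /= !az.
Qed.

(** The Lagrange resolvents [e1] and [e2] of a moved z are eigenvectors for the two primitive cube
    roots of unity. If both were 0, then 3z would be the trace of z and z would be fixed. *)
Lemma resolvent (g : {rmorphism E -> E}) :
  (forall c, g (j c) = j c) -> (forall z, g (g (g z)) = z) -> (exists z, g z <> z) ->
  exists theta w, [/\ theta ^+ 2 + theta + 1 = 0, w != 0 & g w = j theta * w].
Proof.
move=> gj g3 [z gz]; have [om om2] := @cube_root_unity k.
have omE : j om ^+ 2 + j om + 1 = 0.
  by rewrite -rmorphXn -rmorphD -(rmorph1 j) -rmorphD om2 rmorph0.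
have th2 : (om ^+ 2) ^+ 2 + om ^+ 2 + 1 = 0.
  by rewrite -(mulr0 (om ^+ 2 - om + 1)) -om2; ring.
pose e1 := z + j om ^+ 2 * g z + j om * g (g z).
pose e2 := z + j om * g z + j om ^+ 2 * g (g z).
have ge1 : g e1 = j om * e1.
  rewrite /e1 !rmorphD !rmorphM /= g3 !gj -[RHS]addr0.
  by rewrite -(mulr0 ((1 - j om) * g z)) -omE; ring.
have ge2 : g e2 = j (om ^+ 2) * e2.
  rewrite /e2 !rmorphD !rmorphM /= g3 !gj -[RHS]addr0.
  by rewrite -(mulr0 ((1 - j om) * (g z + j om * g (g z)))) -omE; ring.
have [e10|e10] := eqVneq e1 0; last by exists om, e1.
have [e20|e20] := eqVneq e2 0; last by exists (om ^+ 2), e2.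
case: gz; have j3 : (3%:R : E) != 0 by rewrite -(rmorph_nat j) fmorph_eq0.
have z3 : 3%:R * z = z + g z + g (g z).
  have : e1 + e2 = 0 by rewrite e10 e20 addr0.
  rewrite /e1 /e2 => e; rewrite -[RHS]addr0 -e -[LHS]addr0 -(mulr0 (g z + g (g z))) -omE.
  by ring.
apply: (mulfI j3); rewrite -{1}[3%:R](rmorph_nat g) -rmorphM z3 !rmorphD /= g3.
by ring.
Qed.

(** Roots are inserted one at a time: a root seen for the first time goes to A, a second occurrence
    moves it from A to B, and a third from B to C. *)
Lemma cube_free (r : seq k) : exists sA sB C, [/\ uniq (sA ++ sB), C != 0
  & rts r = rts sA * rts sB ^+ 2 * C ^+ 3].
Proof.
elim: r => [|c r [sA [sB [C [un C0 rE]]]]].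
  by exists [::], [::], 1; split; rewrite ?oner_eq0 // /rts big_nil !expr1n !mulr1.
have -> : rts (c :: r) = ('X - c%:P) * (rts sA * rts sB ^+ 2 * C ^+ 3).
  by rewrite -rE /rts big_cons.
have remE s : c \in s -> rts s = ('X - c%:P) * rts (rem c s).
  by move=> cs; rewrite /rts (perm_big _ (perm_to_rem cs)) big_cons.
have consE s : rts (c :: s) = ('X - c%:P) * rts s by rewrite /rts big_cons.
have [cA|cA] := boolP (c \in sA).
  exists (rem c sA), (c :: sB), C; split=> //; last by rewrite (remE sA cA) consE; ring.
  have pm : perm_eq (rem c sA ++ c :: sB) (sA ++ sB).
    rewrite perm_sym (perm_trans (perm_cat (perm_to_rem cA) (perm_refl sB))) //.
    by rewrite cat_cons perm_sym perm_catC cat_cons perm_cons perm_catC.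
  by rewrite (perm_uniq pm).
have [cB|cB] := boolP (c \in sB).
  exists sA, (rem c sB), (('X - c%:P) * C); split.
  - move: un; rewrite !cat_uniq => /and3P[-> /hasPn h uB]; rewrite rem_uniq // andbT /=.
    by apply/hasPn => d /mem_rem /h.
  - by rewrite mulf_neq0 // polyXsubC_eq0.
  - by rewrite (remE sB cB); ring.
exists (c :: sA), sB, C; split=> //; last by rewrite consE; ring.
by rewrite /= mem_cat negb_or cA cB un.
Qed.

(** Explicit Kummer theory: the powers of a resolvent w lie in distinct eigenspaces of the generator
    g, whose invariants are k(x), and w^3 is invariant. *)
Lemma galois_kummer x : galois_cover j x 3 -> exists y sA sB, kummer j x y sA sB.
Proof.
move=> [/transcendentalP tx A3 Afix].
have [s [sfix [z sz] s3 sgen]] := cyclic_three A3.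
have [g gE] := automorphism_rmorphism sfix.1.
have gj c : g (j c) = j c by rewrite gE; case: sfix.1.
have g3 t : g (g (g t)) = t by rewrite !gE.
have gS t : g t = t -> simple_subfield j x t.
  by move=> gt; apply: Afix => u uA; apply: sgen uA; rewrite -gE.
have Sg t : simple_subfield j x t -> g t = t.
  by move=> St; rewrite gE; apply: fixing_simple sfix St.
have [|th [w [th2 w0 gw]]] := resolvent gj g3; first by exists z; rewrite gE.
have thE : j th ^+ 2 + j th + 1 = 0.
  by rewrite -rmorphXn -rmorphD -(rmorph1 j) -rmorphD th2 rmorph0.
have th3 : j th ^+ 3 = 1.
  by apply/eqP; rewrite -subr_eq0; apply/eqP; rewrite -[RHS](mulr0 (j th - 1)) -thE; ring.
have th0 : j th != 0.
  by apply/eqP => h; move: th3; rewrite h expr0n => /eqP; rewrite eq_sym oner_eq0.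
have three : (3%:R : E) != 0 by rewrite -(rmorph_nat j) fmorph_eq0.
have cb : cubic_basis j x w.
  split=> //.
    move=> a0 a1 a2 S0 S1 S2 c0.
    have c1 : a0 + j th * (a1 * w) + j th ^+ 2 * (a2 * w ^+ 2) = 0.
      have := congr1 g c0; rewrite rmorph0 !rmorphD !rmorphM /= (Sg _ S0) (Sg _ S1) (Sg _ S2) gw => h.
      by rewrite -[RHS]h; ring.
    have c2 : a0 + j th ^+ 2 * (a1 * w) + j th ^+ 4 * (a2 * w ^+ 2) = 0.
      have := congr1 g c1; rewrite rmorph0 !rmorphD !rmorphM /= (Sg _ S0) (Sg _ S1) (Sg _ S2) gw gj => h.
      by rewrite -[RHS]h; ring.
    move: c0 c1 c2; set E1 := _ + _; set E2 := _ + _; set E3 := _ + _ => c0 c1 c2.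
    split; apply: (mulfI three); rewrite mulr0.
    - have -> : 3%:R * a0 = E1 + E2 + E3 - (j th ^+ 2 + j th + 1) *
        (a1 * w + a2 * w ^+ 2 * (1 - j th + j th ^+ 2)) by rewrite /E1 /E2 /E3; ring.
      by rewrite c0 c1 c2 thE mul0r subr0 !addr0.
    - apply: (mulIf w0); rewrite mul0r.
      have -> : 3%:R * a1 * w = E1 + j th ^+ 2 * E2 + j th * E3 - (j th ^+ 2 + j th + 1) *
        (a0 + a2 * w ^+ 2 * (j th ^+ 3 - j th + 1) + 2%:R * (j th - 1) * (a1 * w)).
        by rewrite /E1 /E2 /E3; ring.
      by rewrite c0 c1 c2 thE mul0r !mulr0 subr0 !addr0.
    - apply: (mulIf (expf_neq0 2 w0)); rewrite mul0r.
      have -> : 3%:R * a2 * w ^+ 2 = E1 + j th * E2 + j th ^+ 2 * E3 - (j th ^+ 2 + j th + 1) *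
        (a0 + a1 * w * (1 - j th + j th ^+ 2) + (j th - 1) * (j th ^+ 3 + 2%:R) * (a2 * w ^+ 2)).
        by rewrite /E1 /E2 /E3; ring.
      by rewrite c0 c1 c2 thE mul0r !mulr0 subr0 !addr0.
  move=> t.
  (* Three times the projections of t to the eigenspaces of g; dividing each by the matching power
     of w gives an invariant, hence a coordinate in k(x). *)
  pose e0 := t + g t + g (g t).
  pose e1 := t + j th ^+ 2 * g t + j th * g (g t).
  pose e2 := t + j th * g t + j th ^+ 2 * g (g t).
  exists (e0 / 3%:R), (e1 / (3%:R * w)), (e2 / (3%:R * w ^+ 2)); split.
  - apply: gS; rewrite fmorph_div rmorph_nat /e0 !rmorphD /= g3; congr (_ / _).
    by ring.
  - apply: gS; rewrite fmorph_div rmorphM rmorph_nat /= gw.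
    have -> : g e1 = j th * e1.
      rewrite /e1 !rmorphD !rmorphM /= g3 !gj -[RHS]addr0.
      by rewrite -(mulr0 ((1 - j th) * g t)) -thE; ring.
    by field; rewrite three w0 th0.
  - apply: gS; rewrite fmorph_div !rmorphM rmorph_nat /= gw.
    have -> : g e2 = j th ^+ 2 * e2.
      rewrite /e2 !rmorphD !rmorphM /= g3 !gj -[RHS]addr0.
      by rewrite -(mulr0 ((1 - j th) * (g t + j th * g (g t)))) -thE; ring.
    by field; rewrite three w0 th0.
  - rewrite -[LHS]addr0 -(mulr0 ((g t + g (g t)) / 3%:R)) -thE /e0 /e1 /e2.
    by field; rewrite three w0.
have [p [q [q0 w3]]] : simple_subfield j x (w ^+ 3).
  by apply: gS; rewrite rmorphXn /= gw exprMn th3 mul1r.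
have p0 : p != 0.
  by apply: contra_neq (expf_neq0 3 w0) => p0; rewrite w3 p0 rmorph0 mul0r.
have qn0 : q != 0 by apply: contra_neq q0 => ->; rewrite rmorph0.
(* Since p / q = p q^2 / q^3, multiplying w by q makes its cube the polynomial p q^2. Its cube part
   and a cube root of its leading coefficient are then divided out. *)
have [r rE] := closed_field_poly_normal (p * q ^+ 2).
have [sA [sB [C [un C0 rtsE]]]] := cube_free r.
have lc0 : lead_coef (p * q ^+ 2) != 0 by rewrite lead_coef_eq0 mulf_neq0 ?expf_neq0.
have [d dE] := cube_root (lead_coef (p * q ^+ 2)).
have d0 : d != 0 by move: lc0; rewrite -dE expf_eq0.
have jd0 : j d != 0 by rewrite fmorph_eq0.
have eC0 := transcendental_neq0 tx C0.
exists (eval1 j x q / (j d * eval1 j x C) * w), sA, sB; split=> //.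
  apply: (cubic_basis_scale cb tx); [exact: simple_subfield_id|exact: simple_subfield_id| |].
    apply: simple_subfield_div; first exact: simple_subfield_eval.
    by rewrite -eval1Z; exact: simple_subfield_eval.
  by rewrite mulf_neq0 // invr_eq0 mulf_neq0.
have hE : eval1 j x p * eval1 j x q ^+ 2 =
    j d ^+ 3 * (eval1 j x (rts sA * rts sB ^+ 2) * eval1 j x C ^+ 3).
  rewrite -!rmorphXn -!rmorphM /= {1}rE -/(rts r) rtsE -mul_polyC -dE rmorphM /= eval1C.
  by rewrite rmorphXn.
rewrite exprMn w3 expr_div_n exprMn.
have -> : eval1 j x q ^+ 3 / (j d ^+ 3 * eval1 j x C ^+ 3) * (eval1 j x p / eval1 j x q) =
   (eval1 j x p * eval1 j x q ^+ 2) / (j d ^+ 3 * eval1 j x C ^+ 3).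
  by field; rewrite q0 jd0 eC0.
by rewrite hE; field; rewrite jd0 eC0.
Qed.

Lemma size_moebius_roots c0 (s : seq k) : uniq s ->
  size (moebius_roots c0 s) = (size s - (c0 \in s))%N.
Proof.
move=> us; rewrite /moebius_roots size_map size_filter -(count_predC (pred1 c0) s).
by rewrite -(count_uniq_mem c0 us) addKn.
Qed.

(** If infinity is unramified, a finite branch point is sent there: removing it from A or B lowers a
    degree divisible by 3 by 1 or 2. A branch point exists, as otherwise y^3 = 1, which contradicts
    independence of 1, y, y^2. *)
Lemma kummer_wild x y sA sB : kummer j x y sA sB -> exists x' y' sA' sB',
  kummer j x' y' sA' sB' /\ ((size sA' + 2 * size sB') %% 3 != 0)%N.
Proof.
move=> ku; have [h|h] := eqVneq ((size sA + 2 * size sB) %% 3)%N 0%N; last first.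
  by exists x, y, sA, sB.
have [usA usB] : uniq sA /\ uniq sB.
  by have := ku_uniq ku; rewrite cat_uniq => /and3P[].
have [c cAB] : exists c, c \in sA ++ sB.
  case E0 : (sA ++ sB) => [|c s]; last by exists c; rewrite mem_head.
  have := size_cat sA sB; rewrite E0 => /esym/eqP; rewrite addn_eq0 !size_eq0 => /andP[/eqP sA0 /eqP sB0].
  have := ku_eq ku; rewrite sA0 sB0 /rts !big_nil expr1n mulr1 rmorph1 => y3.
  have cb := ku_basis ku; have : (y - 1) * (1 + 1 * y + 1 * y ^+ 2) = 0.
    have -> : (y - 1) * (1 + 1 * y + 1 * y ^+ 2) = y ^+ 3 - 1 by ring.
    by rewrite y3 subrr.
  move=> /eqP; rewrite mulf_eq0 => /orP[/eqP e|/eqP e].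
    have [|_ /eqP] := @cb_indep_poly _ _ _ x y (-1) 1 0 cb; last by rewrite oner_eq0.
    by rewrite /comb3 -[RHS]e rmorphN rmorph1 rmorph0; ring.
  have [|_ /eqP] := @cb_indep_poly _ _ _ x y 1 1 1 cb; last by rewrite oner_eq0.
  by rewrite /comb3 rmorph1.
have [w] := kummer_moebius c ku; rewrite h /= => ku'.
eexists; eexists; eexists; eexists; split; first exact: ku'.
rewrite !size_moebius_roots //.
have sc s : c \in s -> (0 < size s)%N by case: s.
have := ku_uniq ku; rewrite cat_uniq => /and3P[_ /hasPn nAB _].
move: cAB; rewrite mem_cat => /orP[cA|cB].
  have cB : (c \in sB) = false by apply/negbTE/negP => /nAB /=; rewrite cA.
  rewrite cA cB; have := sc _ cA; move: h; move: (size sA) (size sB) => a b; clear; lia.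
have cA : (c \in sA) = false by apply/negbTE; exact: nAB.
rewrite cA cB; have := sc _ cB; move: h; move: (size sA) (size sB) => a b; clear; lia.
Qed.

(** Genus 3 means four finite branch points. Up to exchanging A and B the sizes are (4, 0), (3, 1)
    or (2, 2), and the last has degree 6, divisible by 3. *)
Lemma picard_kummer x : has_genus j 3 -> galois_cover j x 3 ->
  exists x' y' s, kummer j x' y' s [::] /\ size s = 4.
Proof.
move=> g3 /galois_kummer [y [sA [sB ku]]].
have [x1 [y1 [sA1 [sB1 [ku1 wild1]]]]] := kummer_wild ku.
have [Pinf xinf] := infinite_place ku1 wild1.
have g3' := has_genus_uniq g3 (kummer_genus three_neq0 ku1 wild1 xinf).
have key x2 y2 sA2 sB2 : kummer j x2 y2 sA2 sB2 -> ((size sA2 + 2 * size sB2) %% 3 != 0)%N ->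
    (size sA2 + size sB2)%N = 4 -> (size sB2 <= size sA2)%N ->
    exists x' y' s, kummer j x' y' s [::] /\ size s = 4.
  move=> ku2 wild2 s4 le; case: sB2 => [|c [|c' sB2]] in ku2 wild2 s4 le *.
  - by exists x2, y2, sA2; rewrite addn0 in s4.
  (* Sizes (3, 1): the point of B is sent to infinity. The old infinity, of degree 5 = 2 modulo 3,
     becomes the new root 0 of A, which gives (4, 0). *)
  - have [w] := kummer_moebius c ku2.
    have s3 : size sA2 = 3 by move: s4; rewrite /=; clear; lia.
    rewrite s3 /= {2}/moebius_roots /= eqxx /= => ku3.
    eexists; eexists; eexists; split; first exact: ku3.
    have := ku_uniq ku2; rewrite cat_uniq => /and3P[usA /hasPn/(_ c) nAB _].
    rewrite /= size_moebius_roots // s3; have /negbTE -> // := nAB (mem_head _ _).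
  - exfalso; move: wild2 s4 le => /=; move: (size sA2) (size sB2) => a b; clear; lia.
have s4 : (size sA1 + size sB1)%N = 4 by move: g3'; move: (_ + _)%N; clear; lia.
have [le|/ltnW le] := leqP (size sB1) (size sA1); first exact: key ku1 _ _ _.
apply: (key _ _ _ _ (kummer_swap ku1)); last exact: le.
  by move: wild1 s4; move: (size sA1) (size sB1) => a b; clear; lia.
by rewrite addnC.
Qed.

End Galois.

(** * Quartic models *)

Section QuarticModel.
Variables (k : closedFieldType) (E : fieldType) (j : {rmorphism k -> E}).
Hypothesis three_neq0 : 3%:R != 0 :> k.

Lemma cube_eq (th : k) (u v : E) : th ^+ 2 + th + 1 = 0 -> u ^+ 3 = v ^+ 3 ->
  [\/ u = v, u = j th * v | u = j th ^+ 2 * v].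
Proof.
move=> th2 uv; have thE : j th ^+ 2 + j th + 1 = 0.
  by rewrite -rmorphXn -rmorphD -(rmorph1 j) -rmorphD th2 rmorph0.
have : (u - v) * ((u - j th * v) * (u - j th ^+ 2 * v)) = 0.
  have -> : (u - v) * ((u - j th * v) * (u - j th ^+ 2 * v)) = u ^+ 3 - v ^+ 3 +
     (j th ^+ 2 + j th + 1) * ((1 - j th) * v ^+ 3 + j th * v ^+ 2 * u - v * u ^+ 2) by ring.
  by rewrite uv subrr thE mul0r addr0.
move=> /eqP; rewrite !mulf_eq0 !subr_eq0 => /or3P[] /eqP; [exact: Or31|exact: Or32|exact: Or33].
Qed.

Lemma unity_neq (th : k) : th ^+ 2 + th + 1 = 0 -> [/\ th != 0, th != 1 & th ^+ 2 != th].
Proof.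
move=> th2; have t0 : th != 0.
  by apply/eqP => h; move: th2; rewrite h expr0n !add0r => /eqP; rewrite oner_eq0.
have t1 : th != 1.
  apply/eqP => h; move: th2; rewrite h => /eqP.
  have -> : 1 ^+ 2 + 1 + 1 = 3%:R :> k by ring.
  by rewrite (negPf three_neq0).
split=> //; rewrite expr2 -subr_eq0 -{3}[th]mulr1 -mulrBr mulf_neq0 //.
by rewrite subr_eq0.
Qed.

(** * Automorphisms over k(x) *)

Section Twist.
Variables x y : E.
Hypothesis cb : cubic_basis j x y.
Hypothesis y3 : simple_subfield j x (y ^+ 3).
Variable th : k.
Hypothesis th3 : j th ^+ 3 = 1.
Let S := simple_subfield j x.

Let SM a b : S a -> S b -> S (a * b). Proof. exact: simple_subfieldM. Qed.
Let SB a b : S a -> S b -> S (a - b). Proof. exact: simple_subfieldB. Qed.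
Let SD a b : S a -> S b -> S (a + b).
Proof.
move=> Sa Sb; rewrite -[b]opprK; apply: SB => //; rewrite -sub0r; apply: SB => //.
by rewrite -(rmorph0 j); exact: simple_subfield_const.
Qed.

(** The automorphism y -> th y, defined on coordinates; multiplicativity rests on th^3 = 1 and on
    y^3 lying in k(x). *)
Lemma twist_exists : exists g : E -> E, fixing j x g /\
  forall a0 a1 a2, S a0 -> S a1 -> S a2 ->
    g (a0 + a1 * y + a2 * y ^+ 2) = a0 + j th * a1 * y + j th ^+ 2 * a2 * y ^+ 2.
Proof.
have /choice [g gP] : forall z, exists w, exists a0 a1 a2, [/\ S a0, S a1, S a2 &
    z = a0 + a1 * y + a2 * y ^+ 2 /\ w = a0 + j th * a1 * y + j th ^+ 2 * a2 * y ^+ 2].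
  move=> z; have [a0 [a1 [a2 [S0 S1 S2 zE]]]] := cb_span cb z.
  by eexists; exists a0, a1, a2.
have gE a0 a1 a2 : S a0 -> S a1 -> S a2 ->
    g (a0 + a1 * y + a2 * y ^+ 2) = a0 + j th * a1 * y + j th ^+ 2 * a2 * y ^+ 2.
  move=> S0 S1 S2; have [b0 [b1 [b2 [T0 T1 T2 [e ->]]]]] := gP (a0 + a1 * y + a2 * y ^+ 2).
  have [|/eqP + /eqP + /eqP] := cb_indep cb (SB S0 T0) (SB S1 T1) (SB S2 T2).
    by rewrite -[RHS](subrr (a0 + a1 * y + a2 * y ^+ 2)) [X in _ = _ - X]e; ring.
  by rewrite !subr_eq0 => /eqP -> /eqP -> /eqP ->.
have S0 : S 0 by rewrite -(rmorph0 j); exact: simple_subfield_const.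
have gS a : S a -> g a = a.
  by move=> Sa; have := gE a 0 0 Sa S0 S0; rewrite !mulr0 !mul0r !addr0.
have th_S : S (j th) by exact: simple_subfield_const.
exists g; split=> //; split; last exact/gS/simple_subfield_id.
split.
- move=> z w; have [a0 [a1 [a2 [Sa0 Sa1 Sa2 ->]]]] := cb_span cb z.
  have [b0 [b1 [b2 [Sb0 Sb1 Sb2 ->]]]] := cb_span cb w.
  rewrite !gE //.
  have -> : a0 + a1 * y + a2 * y ^+ 2 - (b0 + b1 * y + b2 * y ^+ 2) =
    (a0 - b0) + (a1 - b1) * y + (a2 - b2) * y ^+ 2 by ring.
  by rewrite gE; [ring|exact: SB|exact: SB|exact: SB].
- by apply: gS; exact: simple_subfield1.
- move=> z w; have [a0 [a1 [a2 [Sa0 Sa1 Sa2 ->]]]] := cb_span cb z.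
  have [b0 [b1 [b2 [Sb0 Sb1 Sb2 ->]]]] := cb_span cb w.
  rewrite !gE //.
  have -> : (a0 + a1 * y + a2 * y ^+ 2) * (b0 + b1 * y + b2 * y ^+ 2) =
    (a0 * b0 + (a1 * b2 + a2 * b1) * y ^+ 3) + (a0 * b1 + a1 * b0 + a2 * b2 * y ^+ 3) * y +
    (a0 * b2 + a1 * b1 + a2 * b0) * y ^+ 2 by ring.
  rewrite gE; last 1 first.
  + by apply: SD; [apply: SD|]; apply: SM.
  + have th4 : j th ^+ 4 = j th by rewrite exprS th3 mulr1.
    have -> : (a0 + j th * a1 * y + j th ^+ 2 * a2 * y ^+ 2) *
      (b0 + j th * b1 * y + j th ^+ 2 * b2 * y ^+ 2) =
      a0 * b0 + (a1 * b2 + a2 * b1) * y ^+ 3 * j th ^+ 3 + (j th * (a0 * b1 + a1 * b0) +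
      j th ^+ 4 * a2 * b2 * y ^+ 3) * y + j th ^+ 2 * (a0 * b2 + a1 * b1 + a2 * b0) * y ^+ 2 by ring.
    by rewrite th3 th4; ring.
  + by apply: SD; [exact: SM|apply: SM => //; apply: SD; exact: SM].
  + by apply: SD; [apply: SD; exact: SM|apply: SM => //; exact: SM].
- have g3 z : g (g (g z)) = z.
    have [a0 [a1 [a2 [Sa0 Sa1 Sa2 ->]]]] := cb_span cb z.
    have th2S : S (j th ^+ 2) by exact: SM.
    rewrite gE // gE; [|by []|exact: SM|exact: SM].
    rewrite gE; [|by []|by apply: SM => //; exact: SM|by apply: SM => //; exact: SM].
    rewrite -[RHS]addr0.
    have -> : a0 + j th * (j th * (j th * a1)) * y + j th ^+ 2 * (j th ^+ 2 * (j th ^+ 2 * a2)) * y ^+ 2 =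
      a0 + j th ^+ 3 * a1 * y + (j th ^+ 3) ^+ 2 * a2 * y ^+ 2 by ring.
    by rewrite th3 expr1n !mul1r addr0.
  by exists (g \o g) => z /=; rewrite g3.
- by move=> c; apply: gS; exact: simple_subfield_const.
Qed.

End Twist.

Section Distinguished.
Variables x y : E.
Hypothesis cb : cubic_basis j x y.
Hypothesis y3 : simple_subfield j x (y ^+ 3).

Lemma twist_unity (th : k) : th ^+ 2 + th + 1 = 0 -> j th ^+ 3 = 1.
Proof.
move=> th2; have thE : j th ^+ 2 + j th + 1 = 0.
  by rewrite -rmorphXn -rmorphD -(rmorph1 j) -rmorphD th2 rmorph0.
by apply/eqP; rewrite -subr_eq0; apply/eqP; rewrite -[RHS](mulr0 (j th - 1)) -thE; ring.
Qed.

Lemma fixing_eq s t : fixing j x s -> fixing j x t -> s y = t y -> s = t.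
Proof.
move=> sF tF sty; apply/funext => z.
have [a0 [a1 [a2 [S0 S1 S2 ->]]]] := cb_span cb z.
have [g gE] := automorphism_rmorphism sF.1; have [h hE] := automorphism_rmorphism tF.1.
rewrite -gE -hE !rmorphD !rmorphM /= !gE !hE sty.
by rewrite !(fixing_simple sF S0, fixing_simple sF S1, fixing_simple sF S2,
  fixing_simple tF S0, fixing_simple tF S1, fixing_simple tF S2).
Qed.

(** An automorphism over k(x) sends y to a cube root of y^3 and is determined by that image. A twist
    by a primitive root of unity fixes only elements with no y or y^2 component. *)
Lemma fixing_three : (fixing j x #= `I_3)%card /\
  fixed_field (fixing j x) `<=` simple_subfield j x.
Proof.
have [th th2] := @cube_root_unity k; have th3 := twist_unity th2.
have [t0 t1 t2] := unity_neq th2.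
have [g [gF gE]] := twist_exists cb y3 th3.
have S0 : simple_subfield j x 0 by rewrite -(rmorph0 j); exact: simple_subfield_const.
have S1 := simple_subfield1 j x.
have gy : g y = j th * y.
  by have := gE 0 1 0 S0 S1 S0; rewrite !mul1r !mulr0 !mul0r !addr0 !add0r mulr1.
have y0 := cb_neq0 cb.
split.
  apply/card_three; exists id, g, (g \o g).
  have ggy : g (g y) = j th ^+ 2 * y.
    have [h hE] := automorphism_rmorphism gF.1.
    rewrite gy -hE rmorphM /= !hE gy (fixing_simple gF) ?mulrA //.
    exact: simple_subfield_const.
  have neq (a b : k) : a != b -> j a * y <> j b * y.
    by move=> ab /(mulIf y0)/(fmorph_inj j)/eqP; rewrite (negPf ab).
  split.
  - move=> e; apply: (neq 1 th); first by rewrite eq_sym.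
    by rewrite rmorph1 mul1r -gy -e.
  - move=> e; apply: (neq 1 (th ^+ 2)).
      apply/eqP => e2; have : th ^+ 3 = th by rewrite exprS -e2 mulr1.
      move=> e3; move: t1; rewrite -e3.
      have -> : th ^+ 3 = 1 by apply: (fmorph_inj j); rewrite rmorphXn rmorph1.
      by rewrite eqxx.
    by rewrite rmorph1 mul1r rmorphXn -ggy -[g (g y)]/((g \o g) y) -e.
  - move=> e; apply: (neq th (th ^+ 2)); first by rewrite eq_sym.
    by have := congr1 (@^~ y) e => /=; rewrite ggy gy rmorphXn.
  - move=> s; split=> [sF|[->|->|->]]; [|exact: fixing_id|by []|exact: fixing_comp].
    have [h hE] := automorphism_rmorphism sF.1.
    have : s y ^+ 3 = y ^+ 3 by rewrite -hE -rmorphXn /= hE (fixing_simple sF).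
    move=> /(cube_eq th2) [e|e|e].
    + by apply: Or31; apply: (fixing_eq sF (fixing_id j x)).
    + by apply: Or32; apply: (fixing_eq sF gF); rewrite gy.
    + by apply: Or33; apply: (fixing_eq sF (fixing_comp gF gF)); rewrite /= ggy.
move=> z /(_ g gF) gz; have [a0 [a1 [a2 [Sa0 Sa1 Sa2 zE]]]] := cb_span cb z.
move: gz; rewrite zE gE // => e.
have [||||_ /eqP + /eqP] := @cb_indep _ _ _ _ _ cb 0 ((j th - 1) * a1) ((j th ^+ 2 - 1) * a2).
- by [].
- by rewrite -(rmorph1 j) -rmorphB; apply: simple_subfieldM => //; exact: simple_subfield_const.
- rewrite -(rmorph1 j) -rmorphXn -rmorphB.
  by apply: simple_subfieldM => //; exact: simple_subfield_const.
- by rewrite -[RHS](subrr (a0 + a1 * y + a2 * y ^+ 2)) -[X in _ = X - _]e; ring.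
rewrite !mulf_eq0 !subr_eq0 -(rmorph1 j) -rmorphXn !(inj_eq (fmorph_inj j)) (negPf t1) /=.
have -> : (th ^+ 2 == 1) = false.
  apply/eqP => h; move: t1; have -> : th = 1; last by rewrite eqxx.
  have : th ^+ 3 = 1 by apply: (fmorph_inj j); rewrite rmorphXn rmorph1.
  by rewrite exprS h mulr1.
by move=> /eqP -> /eqP ->; rewrite !mul0r !addr0.
Qed.

Lemma fixing_distinguished : [/\ subgroup_of_automorphisms j (fixing j x),
   (fixing j x #= `I_3)%card
 & exists (E0 : fieldType) (j0 : {rmorphism k -> E0}) (h : {rmorphism E0 -> E}),
    [/\ forall c, h (j0 c) = j c, range h = fixed_field (fixing j x) & has_genus j0 0]].
Proof.
have [c3 sub] := fixing_three; split=> //.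
  split; [by move=> s []|exact: fixing_id|by move=> s t; exact: fixing_comp|].
  move=> s t [[sB s1 sM sb sj] /= sx] st ts; split; last by rewrite /= -sx st.
  split=> [u v||u v||c].
  - by apply: (can_inj st); rewrite sB !ts.
  - by rewrite -s1 st.
  - by apply: (can_inj st); rewrite sM !ts.
  - by exists s.
  - by rewrite -sj st.
have [E0 [h hE]] := subfieldP (simple_field j x).
have hP z : simple_subfield j x z -> range h z by rewrite hE.
have [j0 j0E] := rmorphism_factor (f := j) (fun c => hP _ (simple_subfield_const j x c)).
exists E0, j0, h; split=> //.
  rewrite hE eqEsubset; split=> [z Sz s sF|]; last exact: sub.
  exact: fixing_simple Sz.
have [x0 _ x0E] := hP x (simple_subfield_id j x).
have he p : h (eval1 j0 x0 p) = eval1 j x p.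
  rewrite /eval1 -horner_map -map_poly_comp /= x0E; congr _.[_].
  by apply: eq_map_poly => c /=; rewrite j0E.
apply: (@projective_line_genus _ _ _ x0).
  by move=> p p0; apply: (cb_trans cb); rewrite -he p0 rmorph0.
move=> z; have : simple_subfield j x (h z).
  by rewrite -[simple_subfield j x]/(simple_field j x : set E) -hE; exists z.
move=> [p [q [q0 hz]]]; exists p, q; split.
  by apply: contra_neq q0 => q0; rewrite -he q0 rmorph0.
by apply: (fmorph_inj h); rewrite fmorph_div !he.
Qed.

End Distinguished.

(** * Functions with small poles at infinity *)

Section RiemannRoch.
Variables (x y : E) (s : seq k).
Hypothesis ku : kummer j x y s [::].
Hypothesis s4 : size s = 4%N.

Lemma kconj_nil : kconj j x y [::] = y ^+ 2.
Proof. by rewrite /kconj /rts big_nil rmorph1 divr1. Qed.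

Lemma quartic_wild : ((size s + 2 * size ([::] : seq k)) %% 3 != 0)%N.
Proof. by rewrite s4. Qed.

(** The pole orders of 1, x, y are 0, 3, 4, and the next basis elements x^2, x y, y^2 have 6, 7, 8.
    The bound 5 is the one met by the derivative of y. *)
Lemma quartic_riemann_roch (Pinf : place j) f : Pinf x < 0 ->
  (forall P : place j, P <> Pinf -> vge P 0 f) -> vge Pinf (-5) f ->
  exists a b c, f = j a + j b * x + j c * y /\ (vge Pinf (-3) f -> c = 0).
Proof.
move=> xinf ffin finf.
have x3 := infinite_place_ord ku quartic_wild xinf.
have y4 : Pinf y = - 4 by rewrite (infinite_ord_y ku quartic_wild xinf) s4.
have [p0 [p1 [p2 [fE h0 h1 h2]]]] :=
  kummer_riemann_roch three_neq0 ku quartic_wild xinf ffin finf.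
have y0 := cb_neq0 (ku_basis ku).
have pole n p t : t != 0 -> vge Pinf n (eval1 j x p * t) -> p != 0 ->
    n <= - 3 * (size p).-1%:Z + Pinf t.
  move=> t0 + pn0; have [e0 eP] := ord_pole xinf pn0.
  by rewrite vgeP ?mulf_neq0 // ord_mul // eP x3 mulrC.
have s0 : (size p0 <= 2)%N.
  have [->|p00] := eqVneq p0 0; first by rewrite size_poly0.
  have := pole _ p0 1 (oner_neq0 _); rewrite mulr1 ord_one => /(_ _ h0 p00).
  by clear; lia.
have s1 n : - 6 <= n -> vge Pinf n (eval1 j x p1 * y) -> (size p1 <= 1)%N /\ (-4 < n -> p1 = 0).
  move=> n6 hn; have [->|p10] := eqVneq p1 0; first by rewrite size_poly0.
  have := pole _ p1 y y0 hn p10; rewrite y4 => h; split; first by move: h n6; clear; lia.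
  by move=> n4; exfalso; move: h n6 n4; clear; lia.
have p20 : p2 = 0.
  apply/eqP; apply: contrapT => /negP p20.
  have := pole _ p2 _ _ h2 p20; rewrite kconj_nil => /(_ (expf_neq0 2 y0)).
  by rewrite ordX y4; clear; lia.
have p1E : p1 = (p1`_0)%:P by apply: size1_polyC; have [] := s1 (-5) isT h1.
have p0E : eval1 j x p0 = j p0`_0 + j p0`_1 * x.
  rewrite /eval1 (@horner_coef_wide _ 2); last by rewrite size_map_poly.
  by rewrite !big_ord_recl big_ord0 !coef_map /= expr0 expr1 mulr1 addr0.
have fE' : f = j p0`_0 + j p0`_1 * x + j p1`_0 * y.
  by rewrite fE /kcomb p20 rmorph0 mul0r addr0 p0E {1}p1E eval1C.
exists p0`_0, p0`_1, p1`_0; split=> // f3.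
have [q0 [q1 [q2 [fq hq0 hq1 _]]]] :=
  kummer_riemann_roch three_neq0 ku quartic_wild xinf ffin f3.
have [_ q1E _] : [/\ q0 - p0 = 0, q1 - p1 = 0 & q2 - p2 = 0].
  apply: (kcomb0 ku); rewrite /kcomb !rmorphB /= -[RHS](subrr f) {1}fq fE /kcomb.
  by ring.
move/eqP: q1E; rewrite subr_eq0 => /eqP q1E; rewrite q1E in hq1.
by have [_ ->] := s1 (-3) isT hq1; rewrite ?coef0.
Qed.

End RiemannRoch.

(** * Uniqueness of the quartic model *)

Section Unique.
Variables (x y : E) (s : seq k) (x' y' : E) (s' : seq k).
Hypothesis ku : kummer j x y s [::].
Hypothesis s4 : size s = 4%N.
Hypothesis ku' : kummer j x' y' s' [::].
Hypothesis s4' : size s' = 4%N.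
Hypothesis same : fixing j x = fixing j x'.

Let kummer_y3 u v t : kummer j u v t [::] -> simple_subfield j u (v ^+ 3).
Proof. by move=> h; rewrite (ku_eq h); exact: simple_subfield_eval. Qed.

Lemma same_field z : simple_subfield j x z <-> simple_subfield j x' z.
Proof.
have [_ h] := fixing_three (ku_basis ku) (kummer_y3 ku).
have [_ h'] := fixing_three (ku_basis ku') (kummer_y3 ku').
split=> Sz; [apply: h'|apply: h] => t tF; apply: fixing_simple Sz.
  by rewrite same.
by rewrite -same.
Qed.

Lemma ord_simple_subfield (P : place j) u z : (forall p, p != 0 -> exists m, P (eval1 j u p) = 3 * m) ->
  simple_subfield j u z -> exists m : int, P z = 3 * m.
Proof.
move=> h [p [q [q0 ->]]].
have [->|p0] := eqVneq (eval1 j u p) 0; first by exists 0; rewrite mul0r ord_zero mulr0.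
have pn0 : p != 0 by apply: contra_neq p0 => ->; rewrite rmorph0.
have qn0 : q != 0 by apply: contra_neq q0 => ->; rewrite rmorph0.
have [m Pm] := h p pn0; have [n Pn] := h q qn0.
by exists (m - n); rewrite ord_div // Pm Pn mulrBr.
Qed.

(* A place over which all of k(x) has order divisible by 3 is a ramification point. *)
Lemma ramified_center u v t (P : place j) : kummer j u v t [::] ->
  (forall z, simple_subfield j u z -> exists m : int, P z = 3 * m) -> vge P 0 u ->
  exists2 c, c \in t & vge P 1 (u - j c) /\ P v = 1.
Proof.
move=> kuv Pm u0; have [c uc] := kummer_finite kuv u0.
have [ct|ct] := boolP (c \in t).
  by exists c => //; have [_ _ ->] := kummer_ord_ramified kuv ct uc.
have [eta etah vc] := kummer_center kuv uc.
have eta0 : eta != 0.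
  have : eta ^+ 3 != 0 by rewrite etah kpolyE mulf_neq0 ?expf_neq0 // rts_neq.
  by rewrite expf_eq0.
have P1 := kummer_ord_unramified three_neq0 kuv etah eta0 uc vc.
have [|m] := Pm (u - j c); first
  exact: simple_subfieldB (simple_subfield_id j u) (simple_subfield_const j u c).
by rewrite P1 => e; exfalso; move: e; clear; lia.
Qed.

(** Suppose the places differ. Orders of k(x) at P' are divisible by 3, so P' is a finite branch
    place of the first model, where y has order 1. A generator of the group multiplies y' by a cube
    root of unity, so y' = a y^i with a in k(x). As y' has order -4 at P', i = 0 and i = 1 are
    impossible modulo 3. For i = 2, look at another place Q, a finite branch place of both models:
    there y and y' both have order 1. *)
Lemma same_infinity (P P' : place j) : P x < 0 -> P' x' < 0 -> P = P'.
Proof.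
move=> Px P'x'; apply: contrapT => PP'.
have w := quartic_wild s4; have w' := quartic_wild s4'.
have x3' := infinite_place_ord ku' w' P'x'.
have y4' : P' y' = - 4 by rewrite (infinite_ord_y ku' w' P'x') s4'.
have P'x : vge P' 0 x by apply: (infinite_place_fin ku w Px) => e; apply: PP'.
have mP' z : simple_subfield j x z -> exists m, P' z = 3 * m.
  move=> /same_field; apply: ord_simple_subfield => p p0.
  have [_ ->] := ord_pole P'x' p0; exists (- (size p).-1%:Z).
  by rewrite x3'; clear; lia.
have [c cs [xc yc]] := ramified_center ku mP' P'x.
(* A second finite branch point, which yields the auxiliary place Q different from P'. *)
have [d ds dc] : exists2 d, d \in s & d != c.
  have us : uniq s by have := ku_uniq ku; rewrite cats0.
  move: us s4; case: (s) => [|a [|b r]] //= /andP[]; rewrite in_cons negb_or => /andP[ab _] _ _.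
  have [ac|ac] := eqVneq a c; last by exists a; rewrite ?mem_head.
  by exists b; rewrite ?inE ?eqxx ?orbT // -ac eq_sym.
have [Q xQ] := kummer_place_ramified ku ds.
have [_ x3Q y1Q] := kummer_ord_ramified ku ds xQ.
have QP' : Q <> P'.
  move=> e; have [] := ord_sub_const dc xQ; rewrite e => n0 e0.
  by move: xc; rewrite vgeP // e0.
have tx := cb_trans (ku_basis ku).
have mQ z : simple_subfield j x z -> exists m, Q z = 3 * m.
  apply: ord_simple_subfield => p p0.
  have [m [_ -> _]] := ord_eval1_ramified xQ x3Q p0 (transcendental_sub_neq0 d tx).
  by exists m%:Z.
have mQ' z : simple_subfield j x' z -> exists m, Q z = 3 * m.
  by move=> /same_field; exact: mQ.
have Qx' := infinite_place_fin ku' w' P'x' QP'.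
have [c' cs' [xc' y1Q']] := ramified_center ku' mQ' Qx'.
have [th th2] := @cube_root_unity k; have th3 := twist_unity th2.
have [t0 t1 t2] := unity_neq th2.
have cb := ku_basis ku; have cb' := ku_basis ku'.
have [g [gF gE]] := twist_exists cb (kummer_y3 ku) th3.
have [h hE] := automorphism_rmorphism gF.1.
have y0 := cb_neq0 cb; have y0' := cb_neq0 cb'.
have gy3 : g y' ^+ 3 = y' ^+ 3.
  rewrite -hE -rmorphXn /= hE (ku_eq ku').
  have gF' : fixing j x' g by rewrite -same.
  by apply: (fixing_simple gF'); exact: simple_subfield_eval.
have [a0 [a1 [a2 [S0 S1 S2 yE]]]] := cb_span cb y'.
have SN z : simple_subfield j x z -> simple_subfield j x (- z).
  move=> Sz; rewrite -sub0r; apply: simple_subfieldB => //.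
  by rewrite -(rmorph0 j); exact: simple_subfield_const.
(* An eigenvector of g has a nonzero coordinate only at the power of y with the same eigenvalue. *)
have eig (lam : k) : g y' = j lam * y' -> [/\ (lam == 1) || (a0 == 0),
    (lam == th) || (a1 == 0) & (lam == th ^+ 2) || (a2 == 0)].
  rewrite yE gE // => e.
  have [||||/eqP + /eqP + /eqP] := @cb_indep _ _ _ _ _ cb (j (1 - lam) * a0)
    (j (th - lam) * a1) (j (th ^+ 2 - lam) * a2).
  - by apply: simple_subfieldM => //; exact: simple_subfield_const.
  - by apply: simple_subfieldM => //; exact: simple_subfield_const.
  - by apply: simple_subfieldM => //; exact: simple_subfield_const.
  - rewrite -[RHS](subrr (j lam * (a0 + a1 * y + a2 * y ^+ 2))) -[X in _ = X - _]e !rmorphB rmorph1 rmorphXn.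
    by ring.
  rewrite !mulf_eq0 !fmorph_eq0 !subr_eq0 => e0 e1 e2.
  by split; rewrite 1?eq_sym.
have tt1 : th ^+ 2 == 1 = false.
  apply/eqP => e; move: t1; have -> : th = 1; last by rewrite eqxx.
  have : th ^+ 3 = 1 by apply: (fmorph_inj j); rewrite rmorphXn rmorph1.
  by rewrite exprS e mulr1.
have [e|e|e] := cube_eq th2 gy3.
- have [|_ + +] := eig 1; first by rewrite rmorph1 mul1r.
  rewrite ![1 == _]eq_sym (negPf t1) tt1 /= => /eqP a10 /eqP a20.
  have Sy : simple_subfield j x' y' by apply/same_field; rewrite yE a10 a20 !mul0r !addr0.
  have [m] : exists m, P' y' = 3 * m by apply/mP'/same_field.
  by rewrite y4'; clear; lia.
- have [|+ _ +] := eig th; first by [].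
  rewrite (negPf t1) [th == _]eq_sym (negPf t2) /= => /eqP a00 /eqP a20.
  have y'E : y' = a1 * y by rewrite yE a00 a20 mul0r add0r addr0.
  have a1n : a1 != 0 by apply: contra_neq y0' => a10; rewrite y'E a10 mul0r.
  have [m mE] := mP' _ S1; move: y4'; rewrite y'E ord_mul // mE yc.
  by clear; lia.
- have [|+ + _] := eig (th ^+ 2); first by rewrite rmorphXn.
  rewrite tt1 (negPf t2) /= => /eqP a00 /eqP a10.
  have y'E : y' = a2 * y ^+ 2 by rewrite yE a00 a10 mul0r !add0r.
  have a2n : a2 != 0 by apply: contra_neq y0' => a20; rewrite y'E a20 mul0r.
  have [m mE] := mQ _ S2; move: y1Q'; rewrite y'E ord_mul ?expf_neq0 // mE ordX y1Q.
  by clear; lia.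
Qed.

Lemma quartic_unique : exists a b c d e,
  x' = j a + j b * x /\ y' = j c + j d * x + j e * y.
Proof.
have w := quartic_wild s4; have w' := quartic_wild s4'.
have [P Px] := infinite_place ku w; have [P' P'x'] := infinite_place ku' w'.
have PP' := same_infinity Px P'x'; subst P'.
have fin' Q : Q <> P -> vge Q 0 x' by exact: (infinite_place_fin ku' w' P'x').
have x3' := infinite_place_ord ku' w' P'x'.
have y4' : P y' = - 4 by rewrite (infinite_ord_y ku' w' P'x') s4'.
have [|a [b [c [xE c0]]]] := quartic_riemann_roch ku s4 Px fin' (f := x').
  by rewrite /vge x3' orbC.
have [||c' [d [e [yE _]]]] := quartic_riemann_roch ku s4 Px (f := y').
- by move=> Q /fin'; exact: (kummer_integral ku').
- by rewrite /vge y4' orbC.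
exists a, b, c', d, e; split=> //; rewrite {1}xE c0 ?rmorph0 ?mul0r ?addr0 //.
by rewrite /vge x3' orbC.
Qed.

End Unique.
End QuarticModel.

(** * Local rings at smooth points *)

Section MPolyTaylor.

Lemma eq_mmap n (R S : nzRingType) (f f' : R -> S) (h h' : 'I_n -> S) p :
  f =1 f' -> h =1 h' -> mmap f h p = mmap f' h' p.
Proof.
move=> ff hh; apply: eq_bigr => m _; rewrite ff; congr (_ * _).
by apply: eq_bigr => i _; rewrite hh.
Qed.

Lemma rmorph_mmap n (R S S' : nzRingType) (th : {rmorphism S -> S'}) (f : R -> S)
    (h : 'I_n -> S) p : th (mmap f h p) = mmap (th \o f) (th \o h) p.
Proof.
rewrite /mmap rmorph_sum; apply: eq_bigr => m _; rewrite rmorphM; congr (_ * _).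
by rewrite /mmap1 rmorph_prod; apply: eq_bigr => i _; rewrite rmorphXn.
Qed.

Definition mmap_hom n (R : nzRingType) (S : comNzRingType) (f : {rmorphism R -> S})
  (h : 'I_n -> S) : {rmorphism {mpoly R[n]} -> S} := mmap f h.

Variables (K Kb : fieldType) (iota : {rmorphism K -> Kb}) (n : nat) (a : 'I_n -> Kb).

Definition mlift : {rmorphism {mpoly K[n]} -> {mpoly Kb[n]}} :=
  mmap_hom (@mpolyC n Kb \o iota) (fun i => 'X_i).

Lemma mliftC c : mlift c%:MP = (iota c)%:MP.
Proof. exact: mmapC. Qed.

Lemma mliftX i : mlift 'X_i = 'X_i.
Proof. by rewrite /= mmapX mmap1U. Qed.

(** First-order Taylor expansion at [a], with polynomial coefficients [r i] whose values at [a] are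
    the partial derivatives: the form in which the Jacobian matrix enters the local ring. *)
Definition taylor p := exists r : 'I_n -> {mpoly Kb[n]},
  mlift p = (mmap iota a p)%:MP + \sum_i ('X_i - (a i)%:MP) * r i /\
  forall i, mmap idfun a (r i) = mmap iota a (mderiv i p).

Let ev : {rmorphism {mpoly Kb[n]} -> Kb} := mmap_hom idfun a.
Let ea : {rmorphism {mpoly K[n]} -> Kb} := mmap_hom iota a.

Lemma taylorC c : taylor c%:MP.
Proof.
exists (fun=> 0); split=> [|i]; first by rewrite mliftC mmapC big1 ?addr0 // => i _; rewrite mulr0.
by rewrite mderivC !mmap0.
Qed.

Lemma taylorX i : taylor 'X_i.
Proof.
exists (fun l => (i == l)%:R); split=> [|l].
  rewrite mliftX mmapX mmap1U (bigD1 i) //= eqxx mulr1 big1 ?addr0; first by rewrite addrC subrK.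
  by move=> l li; rewrite eq_sym (negPf li) mulr0.
rewrite mderivX mmapZ mmapX mnm1E !rmorph_nat.
have [<-|_] := eqVneq i l; last by rewrite mul0r.
have -> : (U_(i) - U_(i))%MM = 0%MM by apply/mnmP => q; rewrite mnmBE mnm0E subnn.
by rewrite mmap11 mulr1.
Qed.

Lemma taylorD p q : taylor p -> taylor q -> taylor (p + q).
Proof.
move=> [r [pE rE]] [s [qE sE]]; exists (fun i => r i + s i); split=> [|i].
  rewrite (rmorphD mlift) pE qE mmapD mpolyCD addrACA -big_split /=; congr (_ + _).
  by apply: eq_bigr => i _; rewrite mulrDr.
by rewrite -[LHS]/(ev (r i + s i)) rmorphD /= rE sE mderivD mmapD.
Qed.

Lemma taylorM p q : taylor p -> taylor q -> taylor (p * q).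
Proof.
move=> [r [pE rE]] [s [qE sE]].
exists (fun i => r i * mlift q + (mmap iota a p)%:MP * s i); split=> [|i].
  rewrite (rmorphM mlift) {1}pE mulrDl {1}qE mulrDr -[mmap iota a (p * q)]/(ea (p * q)).
  rewrite (rmorphM ea) mpolyCM -addrA; congr (_ + _).
  rewrite mulr_sumr mulr_suml -big_split /=; apply: eq_bigr => i _.
  by rewrite mulrDr addrC mulrA mulrCA.
rewrite -[LHS]/(ev _) rmorphD !rmorphM [ev (r i)]rE [ev (s i)]sE.
have -> : ev (mlift q) = ea q.
  rewrite [LHS]rmorph_mmap; apply: eq_mmap => [c|l] /=; first by rewrite mmapC.
  by rewrite mmapX mmap1U.
have -> : ev (mmap iota a p)%:MP = ea p by rewrite /= mmapC.
by rewrite mderivM -[RHS]/(ea _) rmorphD !rmorphM.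
Qed.

Lemma taylor_all p : taylor p.
Proof.
rewrite [p]mpolyE; elim/big_ind: _ => [||m _]; first by rewrite -mpolyC0; exact: taylorC.
  exact: taylorD.
rewrite -mul_mpolyC; apply: taylorM; first exact: taylorC.
rewrite mpolyXE_id; elim/big_ind: _ => [||i _]; first by rewrite -mpolyC1; exact: taylorC.
  exact: taylorM.
elim: (m i) => [|e IH]; first by rewrite expr0 -mpolyC1; exact: taylorC.
by rewrite exprS; apply: taylorM => //; exact: taylorX.
Qed.

(** Used to pass from homogeneous to affine coordinates: at a zero of p with one coordinate equal to
    1, the derivative in that direction is a combination of the others. *)
Lemma euler_formula d p : p \is d.-homog ->
  \sum_i a i * mmap iota a (mderiv i p) = d%:R * mmap iota a p.
Proof.
move=> /dhomogP hd; have ip := mpolyE p.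
have EX m : \sum_i a i * mmap iota a (mderiv i 'X_[m]) = (mdeg m)%:R * mmap iota a 'X_[m].
  rewrite mdegE natr_sum mulr_suml; apply: eq_bigr => i _.
  rewrite mderivX mmapZ rmorph_nat; have [->|mi] := eqVneq (m i) 0%N.
    by rewrite !mul0r mulr0.
  rewrite mulrCA; congr (_ * _).
  have {2}-> : m = (U_(i) + (m - U_(i)))%MM.
    apply/mnmP => l; rewrite mnmDE mnmBE mnm1E; case: eqP => [<-|]; last by rewrite add0n subn0.
    by rewrite subnKC // lt0n.
  by rewrite mpolyXD -[RHS]/(ea _) rmorphM /= !mmapX mmap1U.
move: ip; rewrite big_seq => ->; elim/big_ind: _ => [|q r qE rE|m mp].
- by rewrite mmap0 mulr0 big1 // => i _; rewrite mderiv0 mmap0 mulr0.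
- rewrite mmapD mulrDr -qE -rE -big_split /=; apply: eq_bigr => i _.
  by rewrite mderivD mmapD mulrDr.
rewrite mmapZ mulrCA -(hd m mp) -EX mulr_sumr; apply: eq_bigr => i _.
by rewrite mderivZ mmapZ mulrCA.
Qed.

End MPolyTaylor.

Section SmoothLocal.
Variables (K : fieldType) (Kb : closedFieldType) (F Fb : fieldType).
Variables (iota : {rmorphism K -> Kb}) (j : {rmorphism K -> F}).
Variables (jF : {rmorphism F -> Fb}) (jK : {rmorphism Kb -> Fb}).
Hypothesis H : is_base_change iota j jF jK.
Variables (n : nat) (u : 'I_n.+1 -> F).
Hypothesis u_neq0 : exists i, u i != 0.
Hypothesis u_gen : generates_function_field j u.
Hypothesis u_smooth : forall a : 'I_n.+1 -> Kb,
  geometric_point j u iota a -> smooth_at j u iota a.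
Variable P : place jK.
Hypothesis P_residue : forall z, vge P 0 z -> exists c, vge P 1 (z - jK c).

Let jFj c : jF (j c) = jK (iota c). Proof. by case: H. Qed.

Lemma homogeneous_scale d p i0 : u i0 != 0 -> p \is d.-homog ->
  mmap j u p = u i0 ^+ d * mmap j (fun i => u i / u i0) p.
Proof.
move=> u0 /dhomogP hd; rewrite /mmap mulr_sumr !big_seq; apply: eq_bigr => m mp.
rewrite mulrCA; congr (_ * _); rewrite -(hd m mp) /= /mmap1.
rewrite mdegE expr_sum -big_split /=; apply: eq_bigr => i _.
by rewrite -exprMn mulrC divfK.
Qed.

Lemma minimal_coordinate : exists i0, u i0 != 0 /\
  forall i, vge P 0 (jF (u i / u i0)).
Proof.
have [i1 ui1] := u_neq0.
(* Adding [S] makes all orders nonnegative, so that a coordinate of minimal order can be chosen by a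
   minimum over natural numbers. *)
pose S : nat := (\sum_i `|P (jF (u i))|)%N.
pose M i : nat := `|(P (jF (u i)) + S%:Z)%R|%N.
case: (@arg_minnP _ i1 (fun i => u i != 0) M ui1) => i0 ui0 i0min.
exists i0; split=> // i; have [->|ui] := eqVneq (u i) 0; first by rewrite mul0r rmorph0 vge0.
have PS l : - S%:Z <= P (jF (u l)).
  have : (`|P (jF (u l))| <= S)%N by rewrite /S (bigD1 l) //= leq_addr.
  by move: (P _) (S) => e S'; clear; lia.
rewrite fmorph_div vgeP ?mulf_neq0 ?invr_eq0 ?fmorph_eq0 // ord_div ?fmorph_eq0 //.
have := i0min i ui; have := PS i; have := PS i0; rewrite /M.
by move: (P _) (P _) (S) => e e' S'; clear; lia.
Qed.

(** * The affine chart around the center of the place *)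

Section Chart.
Variable i0 : 'I_n.+1.
Hypothesis ui0 : u i0 != 0.
Hypothesis ui0_min : forall i, vge P 0 (jF (u i / u i0)).
Let v i := u i / u i0.
Variable a : 'I_n.+1 -> Kb.
Hypothesis va : forall i, vge P 1 (jF (v i) - jK (a i)).

Let T := {mpoly Kb[n.+1]}.
Let phi : {rmorphism T -> Fb} := mmap_hom jK (jF \o v).
Let ev : {rmorphism T -> Kb} := mmap_hom idfun a.

Let phiC c : phi c%:MP = jK c. Proof. exact: mmapC. Qed.
Let phiX i : phi 'X_i = jF (v i). Proof. by rewrite /= mmapX mmap1U. Qed.
Let evC c : ev c%:MP = c. Proof. exact: mmapC. Qed.
Let evX i : ev 'X_i = a i. Proof. by rewrite /= mmapX mmap1U. Qed.

Lemma chart_integral g : vge P 0 (phi g).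
Proof.
rewrite /= /mmap; apply: vge_sum => m _; apply: vgeM0; first exact: vge_const.
by rewrite /mmap1; elim/big_ind: _ => [||i _]; [rewrite -(rmorph1 jK); exact: vge_const|
  move=> ? ?; exact: vgeM0|apply: vgeX; exact: ui0_min].
Qed.

Lemma chart_taylor g : exists r : 'I_n.+1 -> T,
  phi g = jK (ev g) + \sum_i (jF (v i) - jK (a i)) * phi (r i).
Proof.
have [r [gE _]] := taylor_all (idfun : {rmorphism Kb -> Kb}) a g; exists r.
have -> : phi g = phi (mlift idfun n.+1 g).
  by rewrite [RHS]rmorph_mmap; apply: eq_mmap => [c|i] /=; rewrite ?mmapC // mmapX mmap1U.
rewrite gE rmorphD phiC (rmorph_sum phi); congr (_ + _).
by apply: eq_bigr => i _; rewrite rmorphM rmorphB phiX phiC.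
Qed.

Lemma chart_center g : vge P 1 (phi g - jK (ev g)).
Proof.
have [r ->] := chart_taylor g; rewrite addrC addKr.
by apply: vge_sum => i _; rewrite mulrC; apply: vgeM0 => //; exact: chart_integral.
Qed.

Lemma chart_ker g : phi g = 0 -> ev g = 0.
Proof.
by move=> g0; have := chart_center g; rewrite g0 sub0r vgeN => /vge1_const.
Qed.

Lemma chart_frac z : exists g h, phi h != 0 /\ z = phi g / phi h.
Proof.
move: z; apply: (base_change_ind H) => [|x y [g [h [h0 ->]]] [g' [h' [h0' ->]]]|f c].
- by exists 0, 1; rewrite rmorph0 rmorph1 oner_eq0 mul0r.
- exists (g * h' + g' * h), (h * h'); rewrite rmorphD !rmorphM mulf_neq0 //; split=> //.
  by field; rewrite h0 h0'.
have [d [p [q [pd qd q0 ->]]]] := u_gen f.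
have phiL p' : phi (mlift iota n.+1 p') = jF (mmap j v p').
  rewrite [LHS]rmorph_mmap [RHS]rmorph_mmap.
  by apply: eq_mmap => [b|i] /=; rewrite ?mmapC ?jFj // mmapX mmap1U.
move: q0; rewrite (homogeneous_scale ui0 pd) (homogeneous_scale ui0 qd) mulf_eq0 negb_or => /andP[ud q0].
exists (mlift iota n.+1 p * c%:MP), (mlift iota n.+1 q); rewrite (rmorphM phi) !phiL phiC fmorph_eq0.
split=> //; rewrite fmorph_div !rmorphM /= -/v.
have q0' : jF (mmap j v q) != 0 by rewrite fmorph_eq0.
have ud' : jF (u i0 ^+ d) != 0 by rewrite fmorph_eq0.
by field; rewrite q0' ud'.
Qed.

Lemma chart_nonconstant : exists i, jF (v i) - jK (a i) != 0.
Proof.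
apply: contrapT => Nex; have [z [z0 z1]] := ord_surj P.
have phiE g : phi g = jK (ev g).
  have [r ->] := chart_taylor g; rewrite big1 ?addr0 // => i _.
  have -> : jF (v i) - jK (a i) = 0; last by rewrite mul0r.
  by apply/eqP/negPn/negP => h; apply: Nex; exists i.
have [g [h [h0 zE]]] := chart_frac z.
by move: z1; rewrite zE !phiE -fmorph_div ord_const.
Qed.

Lemma chart_i0 : a i0 = 1.
Proof.
have := va i0; rewrite /v divff // rmorph1 -(rmorph1 jK) -rmorphB => /vge1_const.
by move/eqP; rewrite subr_eq0 eq_sym => /eqP.
Qed.

Lemma chart_geometric : geometric_point j u iota a.
Proof.
split; first by exists i0; rewrite chart_i0 oner_eq0.
move=> p [[d pd] p0].
have -> : mmap iota a p = ev (mlift iota n.+1 p).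
  by rewrite [RHS]rmorph_mmap; apply: eq_mmap => [b|i] /=; rewrite ?mmapC // mmapX mmap1U.
apply: chart_ker; rewrite rmorph_mmap; apply/eqP.
have : jF (mmap j v p) == 0.
  move/eqP: p0; rewrite (homogeneous_scale ui0 pd) mulf_eq0 expf_eq0 (negPf ui0) andbF /=.
  by move=> /eqP p0; rewrite /v p0 rmorph0.
rewrite rmorph_mmap; congr (_ == 0).
by apply: eq_mmap => [b|i] /=; rewrite ?mmapC ?jFj // mmapX mmap1U.
Qed.

(* By the Jacobian criterion and Cramer's rule, the differences of the coordinates
   v and their values a are multiples of one of them in the local ring. *)
Lemma chart_cramer : exists l s (w : 'I_n.+1 -> T), ev s != 0 /\
  forall i, phi s * (jF (v i) - jK (a i)) = (jF (v l) - jK (a l)) * phi (w i).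
Proof.
have [p [pI prank]] := u_smooth chart_geometric.
pose del i := jF (v i) - jK (a i).
have del0 : del i0 = 0 by rewrite /del chart_i0 /v divff // !rmorph1 subrr.
(* Expanding the q-th equation at [a] and evaluating on the curve gives a linear relation between
   the differences [del i], whose coefficients specialize at [a] to a row of the Jacobian matrix. *)
have /choice [R RP] : forall q, exists r : 'I_n.+1 -> T,
    \sum_i del i * phi (r i) = 0 /\ forall i, ev (r i) = mmap iota a (mderiv i (p q)).
  move=> q; have [r [rE1 rE2]] := taylor_all iota a (p q); exists r; split=> //.
  have [[d pd] p0] := pI q.
  have p00 : mmap iota a (p q) = 0 by case: chart_geometric => _; apply; exact: pI.
  have := congr1 phi rE1; rewrite p00 mpolyC0 add0r [RHS](rmorph_sum phi) => e.
  transitivity (phi (mlift iota n.+1 (p q))).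
    by rewrite e; apply: eq_bigr => i _; rewrite rmorphM rmorphB phiX phiC.
  have : jF (mmap j v (p q)) = 0.
    move/eqP: p0; rewrite (homogeneous_scale ui0 pd) mulf_eq0 expf_eq0 (negPf ui0) andbF /=.
    by move=> /eqP p0; rewrite /v p0 rmorph0.
  rewrite rmorph_mmap => <-; rewrite [LHS]rmorph_mmap.
  by apply: eq_mmap => [b|i] /=; rewrite ?mmapC ?jFj // mmapX mmap1U.
pose J : 'M[Kb]_(n.-1, n.+1) := \matrix_(i, l) mmap iota a (mderiv l (p i)).
pose J' : 'M[Kb]_(n.-1, n) := col' i0 J.
(* By Euler's formula the column [i0] depends on the others, so deleting it keeps the rank. *)
have JE : J = J' *m (\matrix_(q, i) if unlift i0 i is Some q' then (q == q')%:R else - a (lift i0 q)).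
  apply/matrixP => r i; rewrite !mxE; case: (unliftP i0 i) => [q ->|->].
    rewrite (bigD1 q) //= !mxE liftK eqxx mulr1 big1 ?addr0 // => q' qq'.
    by rewrite !mxE liftK (negPf qq') mulr0.
  under eq_bigr do rewrite !mxE unlift_none mulrN mulrC.
  rewrite sumrN; apply/eqP; rewrite -addr_eq0; apply/eqP.
  have [[d pd] _] := pI r; have := euler_formula iota a pd.
  have -> : mmap iota a (p r) = 0 by case: chart_geometric => _; apply; exact: pI.
  rewrite mulr0 (bigD1_ord i0) //= chart_i0 mul1r => e.
  by rewrite -[RHS]e.
have rkJ' : \rank J' = n.-1.
  apply/eqP; rewrite eqn_leq rank_leq_row -{1}prank -/J JE.
  exact: mxrankM_maxl.
have full : row_full J'^T by rewrite /row_full mxrank_tr rkJ'.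
pose f := fullrankfun full.
have Bunit : rowsub f J'^T \in unitmx by exact: fullrowsub_unit.
have finj : injective f by exact: fullrankfun_inj.
have n0 : (0 < n)%N.
  rewrite lt0n; apply/eqP => nE; have [i] := chart_nonconstant.
  suff -> : i = i0 by rewrite -/(del i0) del0 eqxx.
  apply: ord_inj; move: (nat_of_ord i) (ltn_ord i) (nat_of_ord i0) (ltn_ord i0) nE.
  by move: n => m e; clear; lia.
(* [f] selects columns forming an invertible minor, one fewer than there are; the coordinate of the
   remaining column becomes the local parameter. *)
have [l0 l0f] : exists l0, l0 \notin codom f.
  apply: contrapT => Nex; have : (#|'I_n| <= #|codom f|)%N.
    apply: subset_leq_card; apply/fintype.subsetP => q _; apply/negPn/negP => h.
    by apply: Nex; exists q.
  by rewrite card_codom // !card_ord; case: (n) n0 => // m _; rewrite ltnn.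
have cover q : q = l0 \/ exists r, q = f r.
  have [qf|qf] := boolP (q \in codom f); first by right; have [r ->] := codomP qf; exists r.
  left; apply: contrapT => /eqP ql.
  have us : uniq (q :: l0 :: codom f).
    by rewrite /= in_cons negb_or ql qf l0f map_inj_uniq // enum_uniq.
  have := max_card (mem (q :: l0 :: codom f)); rewrite (card_uniqP us) card_ord /=.
  by rewrite size_codom card_ord; case: (n) n0 => // m _; rewrite /= ltnn.
pose l := lift i0 l0; pose g r := lift i0 (f r).
(* The determinant of this lift of the minor is nonzero at [a]. Multiplying the relations by the
   adjugate expresses determinant times [del (g q)] as a multiple of [del l]. *)
pose RT : 'M[T]_(n.-1) := \matrix_(r, q) R r (g q).
have [s sE] : exists s, s = \det RT by eexists.
have evs : ev s != 0.
  have -> : ev s = \det (rowsub f J'^T)^T.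
    rewrite sE -det_map_mx; congr (\det _); apply/matrixP => r q.
    by rewrite !mxE (RP r).2.
  by rewrite det_tr -unitfE -unitmxE.
have Rl r : \sum_q del (g q) * phi (R r (g q)) = - (del l * phi (R r l)).
  have := (RP r).1; rewrite (bigD1_ord i0) //= del0 mul0r add0r (bigD1 l0) //= -/l.
  rewrite addrC => /eqP; rewrite addr_eq0 => /eqP <-.
  rewrite (reindex_omap f (fun q => [pick r | f r == q])) /=; last first.
    move=> q ql; case: (cover q) => [e|[r' ->]]; first by rewrite e eqxx in ql.
    by case: pickP => [r'' /eqP/finj ->//|/(_ r')]; rewrite eqxx.
  apply: eq_bigl => r'; case: pickP => [r'' /eqP/finj ->|/(_ r')]; rewrite ?eqxx // andbT.
  by apply/esym/negP => /eqP e; case/negP: l0f; rewrite -e; exact: codom_f.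
have sg q : phi s * del (g q) =
    del l * phi (- \sum_r \adj RT q r * R r l).
  have adjE q' : \sum_r \adj RT q r * RT r q' = s * (q == q')%:R.
    have := congr1 (fun A : 'M[T]_(n.-1) => A q q') (mul_adj_mx RT).
    by rewrite [LHS]mxE [RHS]mxE sE mulr_natr.
  rewrite rmorphN mulrN (rmorph_sum phi) mulr_sumr -sumrN.
  transitivity (\sum_r phi (\adj RT q r) * \sum_q' del (g q') * phi (R r (g q'))).
    under eq_bigr do rewrite mulr_sumr.
    rewrite exchange_big /= (bigD1 q) //= [X in _ + X]big1 ?addr0 => [|q' qq'].
      transitivity (del (g q) * phi (\sum_r \adj RT q r * RT r q)).
        by rewrite adjE eqxx mulr1 mulrC.
      rewrite rmorph_sum mulr_sumr; apply: eq_bigr => r _.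
      by rewrite (rmorphM phi) [RT r q]mxE mulrCA.
    transitivity (del (g q') * phi (\sum_r \adj RT q r * RT r q')).
      rewrite rmorph_sum mulr_sumr; apply: eq_bigr => r _.
      by rewrite (rmorphM phi) [RT r q']mxE mulrCA.
    by rewrite adjE eq_sym (negPf qq') mulr0 rmorph0 mulr0.
  by apply: eq_bigr => r _; rewrite Rl rmorphM mulrN mulrCA.
have /choice [w wE] : forall i, exists w, phi s * del i = del l * phi w.
  move=> i; case: (unliftP i0 i) => [q ->|->]; last first.
    by exists 0; rewrite del0 rmorph0 !mulr0.
  by case: (cover q) => [->|[r ->]]; [exists s; rewrite mulrC|eexists; exact: sg].
by exists l, s, w.
Qed.

(** By [chart_cramer] a function vanishing at [a] is divisible by [t] up to a unit. Each division
    lowers the order at [P] by at least 1, so it ends; thus the point is regular and its local ring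
    is the valuation ring of [P]. *)
Lemma chart_local z : vge P 0 z -> exists g h, ev h != 0 /\ z * phi h = phi g.
Proof.
have [l [s [w [evs wE]]]] := chart_cramer.
pose t : T := 'X_l - (a l)%:MP.
have phit : phi t = jF (v l) - jK (a l) by rewrite rmorphB phiX phiC.
have evt : ev t = 0 by rewrite rmorphB evX evC subrr.
have s0 : phi s != 0 by apply: contra_neq evs => /chart_ker.
have t0 : phi t != 0.
  have [i vi] := chart_nonconstant; apply: contra_neq (mulf_neq0 s0 vi).
  by rewrite wE -phit => ->; rewrite mul0r.
have H1 g : ev g = 0 -> exists g', phi s * phi g = phi t * phi g'.
  move=> g0; have [r rE] := chart_taylor g; exists (\sum_i w i * r i).
  rewrite rE g0 rmorph0 add0r (rmorph_sum phi) !mulr_sumr; apply: eq_bigr => i _.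
  by rewrite mulrA wE -phit rmorphM mulrA.
have unit g : ev g != 0 -> P (phi g) = 0.
  move=> g0; have jg : jK (ev g) != 0 by rewrite fmorph_eq0.
  have := @ordD_lt _ _ _ P (jK (ev g)) (phi g - jK (ev g)) jg.
  by rewrite ord_const add0r (addrC (jK _)) subrK => /(_ (chart_center g)) [].
have rp : regular_point jK phi ev (@mpolyC n.+1 Kb) t.
  split=> //.
  - exact: chart_ker.
  - move=> g g0; have ge0 h : phi h != 0 -> 0 <= P (phi h).
      by move=> h0; have := chart_integral h; rewrite vgeP.
    have t1 : 1 <= P (phi t).
      by have := chart_center t; rewrite evt rmorph0 subr0 vgeP.
    have [N] : exists N : nat, P (phi g) <= N%:Z.
      by exists `|P (phi g)|%N; move: (P _); clear; lia.
    elim: N g g0 => [|N IH] g g0 gN.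
      exists 0%N, 1, g; rewrite !rmorph1 oner_eq0 expr0 !mul1r; split=> //.
      apply/eqP => /H1 [g' gE]; have g'0 : phi g' != 0.
        by apply: contra_neq (mulf_neq0 s0 g0); rewrite gE => ->; rewrite mulr0.
      have := ord_mul P s0 g0; rewrite gE ord_mul // (unit s evs).
      by have := ge0 g' g'0; move: gN t1; move: (P (phi g)) (P (phi t)) (P (phi g')); clear; lia.
    have [eg|eg] := eqVneq (ev g) 0; last first.
      by exists 0%N, 1, g; rewrite !rmorph1 oner_eq0 expr0 !mul1r.
    have [g' gE] := H1 g eg; have g'0 : phi g' != 0.
      by apply: contra_neq (mulf_neq0 s0 g0); rewrite gE => ->; rewrite mulr0.
    have [|m [s0' [s1' [e0 e1 eE]]]] := IH g' g'0.
      have := ord_mul P s0 g0; rewrite gE ord_mul // (unit s evs).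
      by move: gN t1; move: (P (phi g)) (P (phi t)) (P (phi g')); clear; lia.
    exists m.+1, (s0' * s), s1'; split=> //; first by rewrite rmorphM mulf_neq0.
    by rewrite rmorphM -mulrA gE mulrCA eE exprS mulrA.
  - exact: chart_frac.
have cP : centered phi ev P.
  by move=> g g0; have := chart_center g; rewrite g0 rmorph0 subr0.
move=> /(centered_local rp cP) [g [h [h0 ->]]]; exists g, h; split=> //.
by rewrite divfK //; apply: contra_neq h0 => /chart_ker.
Qed.

End Chart.

Lemma smooth_local : exists (v : 'I_n.+1 -> F) (a : 'I_n.+1 -> Kb),
  (forall g, vge P 1 (mmap jK (jF \o v) g - jK (mmap idfun a g))) /\
  forall z, vge P 0 z -> exists g h : {mpoly Kb[n.+1]}, mmap idfun a h != 0 /\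
    z * mmap jK (jF \o v) h = mmap jK (jF \o v) g.
Proof.
have [i0 [ui0 i0min]] := minimal_coordinate.
have /choice [a va] := fun i => P_residue (i0min i).
exists (fun i => u i / u i0), a; split=> [g|z z0]; first exact: (chart_center i0min va).
exact: (chart_local ui0 i0min va).
Qed.

End SmoothLocal.

(** * Extension of derivations *)

Section Derivation.
Variables (K : fieldType) (Kb : closedFieldType) (F Fb : fieldType).
Variables (iota : {rmorphism K -> Kb}) (j : {rmorphism K -> F}).
Variables (jF : {rmorphism F -> Fb}) (jK : {rmorphism Kb -> Fb}).
Hypothesis H : is_base_change iota j jF jK.
Variables (W FW : fieldType) (a : {rmorphism K -> W}) (b : {rmorphism W -> Kb}).
Variables (jFW : {rmorphism F -> FW}) (jW : {rmorphism W -> FW}) (bF : {rmorphism FW -> Fb}).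
Hypothesis HW : is_base_change a j jFW jW.
Hypothesis bFF : forall f, bF (jFW f) = jF f.
Hypothesis bFW : forall w, bF (jW w) = jK (b w).
Variable D : W -> Kb.
Hypothesis DD : {morph D : x y / x + y}.
Hypothesis DM : forall x y, D (x * y) = b x * D y + b y * D x.
Hypothesis Da : forall c, D (a c) = 0.

Let HWb : is_base_change b jW bF jK.
Proof. exact: (base_change_cancel H HW bFF bFW). Qed.

(** The derivation acts on the factor [W] of the tensor product and kills [F]; the Leibniz rule is
    checked on pure tensors. *)
Lemma derivation_extend : exists Dt : FW -> Fb, [/\ {morph Dt : x y / x + y},
  forall x y, Dt (x * y) = bF x * Dt y + bF y * Dt x, forall f, Dt (jFW f) = 0
  & forall w, Dt (jW w) = jK (D w)].
Proof.
have D1 : D 1 = 0 by rewrite -(rmorph1 a) Da.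
have [||Dt [DtD DtE]] := base_change_extend HW (g := jF) (psi := jK \o D).
- by move=> x y /=; rewrite DD rmorphD.
- move=> c w /=; rewrite DM Da mulr0 addr0 rmorphM; congr (_ * _).
  by case: HW => e _ _; rewrite -bFW -e bFF.
exists Dt; split=> //.
- have Dt0 : Dt 0 = 0 by apply: (addrI (Dt 0)); rewrite -DtD !addr0.
  move=> x y; move: x; apply: (base_change_ind HW) => [|x x' xE xE'|f c].
  + by rewrite mul0r rmorph0 Dt0 mul0r mulr0 addr0.
  + by rewrite mulrDl !DtD xE xE' rmorphD; ring.
  move: y; apply: (base_change_ind HW) => [|y y' yE yE'|f' c'].
  + by rewrite mulr0 rmorph0 Dt0 mul0r mulr0 addr0.
  + by rewrite mulrDr !DtD yE yE' rmorphD; ring.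
  have -> : jFW f * jW c * (jFW f' * jW c') = jFW (f * f') * jW (c * c').
    by rewrite !rmorphM; ring.
  by rewrite !DtE /= DM !(rmorphD, rmorphM) /= !bFF !bFW; ring.
- by move=> f; rewrite -[jFW f]mulr1 -(rmorph1 jW) DtE /= D1 rmorph0 mulr0.
- by move=> w; rewrite -[jW w]mul1r -(rmorph1 jFW) DtE rmorph1 mul1r.
Qed.

Variable Dt : FW -> Fb.
Hypothesis DtD : {morph Dt : x y / x + y}.
Hypothesis DtM : forall x y, Dt (x * y) = bF x * Dt y + bF y * Dt x.
Hypothesis DtF : forall f, Dt (jFW f) = 0.
Hypothesis DtW : forall w, Dt (jW w) = jK (D w).

Lemma derivation0 : Dt 0 = 0.
Proof. by apply: (addrI (Dt 0)); rewrite -DtD !addr0. Qed.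

Lemma derivation_sum (I : Type) (r : seq I) (p : pred I) (f : I -> FW) :
  Dt (\sum_(i <- r | p i) f i) = \sum_(i <- r | p i) Dt (f i).
Proof. exact: (big_morph Dt DtD derivation0). Qed.

(** Write z = g / h with h a unit at [P]. The coefficients of g and h lie in [Kb], where the
    derivation is not defined; [relation_descent] replaces them by coefficients in [W]. Then h Dt(z)
    = Dt(g) - z Dt(h), and the right side is integral since the functions [v] on the curve are
    killed. *)
Lemma derivation_integral (P : place jK) (n : nat) (v : 'I_n -> F) (c : 'I_n -> Kb) z :
  (forall g, vge P 1 (mmap jK (jF \o v) g - jK (mmap idfun c g))) ->
  (vge P 0 (bF z) -> exists g h : {mpoly Kb[n]}, mmap idfun c h != 0 /\
    bF z * mmap jK (jF \o v) h = mmap jK (jF \o v) g) ->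
  vge P 0 (bF z) -> vge P 0 (Dt z).
Proof.
move=> center local z0; have [g [h [h0 zh]]] := local z0.
have mon0 m : vge P 0 (jF (mmap1 v m)).
  have := center 'X_[m]; rewrite !mmapX => h1.
  have -> : jF (mmap1 v m) = mmap1 (jF \o v) m.
    by rewrite /mmap1 rmorph_prod; apply: eq_bigr => i _; rewrite rmorphXn.
  by rewrite -[mmap1 _ m](subrK (jK (mmap1 c m))); apply: vgeD (vge_const P _); apply: vge_le h1.
pose N := maxn (msize g) (msize h).
pose B : finType := 'X_{1..n < N}.
pose zz (i : B + B) : FW := match i with
  | inl m => jFW (mmap1 v m) * z | inr m => - jFW (mmap1 v m) end.
pose lam (i : B + B) : Kb := match i with inl m => h@_m | inr m => g@_m end.
(* This form is the value of the denominator at the center [c], so the descended denominator is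
   still a unit there. *)
pose ell (i : B + B) : Kb := match i with inl m => mmap1 c m | inr m => 0 end.
have monE m : mmap1 (jF \o v) m = jF (mmap1 v m).
  by rewrite /mmap1 rmorph_prod; apply: eq_bigr => i _; rewrite rmorphXn.
have rel : \sum_i jK (lam i) * bF (zz i) = 0.
  rewrite big_sumType /=; apply/eqP; rewrite addrC addr_eq0; apply/eqP.
  move: zh; rewrite (mmapE N) ?leq_maxr // (mmapE N) ?leq_maxl // => zh.
  have -> : \sum_(i : B) jK h@_i * bF (jFW (mmap1 v i) * z) =
     bF z * \sum_(m : 'X_{1..n < N}) jK h@_m * mmap1 (jF \o v) m.
    rewrite mulr_sumr; apply: eq_bigr => m _.
    by rewrite rmorphM bFF monE; ring.
  rewrite zh -sumrN; apply: eq_bigr => m _.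
  by rewrite rmorphN mulrN bFF monE.
have [|rho [rhorel rhoell]] := relation_descent HWb rel (ell := ell).
  rewrite big_sumType /= [X in _ + X]big1 ?addr0; last by move=> m _; rewrite mul0r.
  move: h0; rewrite (mmapE N) ?leq_maxr //.
  by congr (_ != 0); apply: eq_bigr => m _; rewrite mulrC.
pose h' := \sum_(m : B) jW (rho (inl m)) * jFW (mmap1 v m).
pose g' := \sum_(m : B) jW (rho (inr m)) * jFW (mmap1 v m).
have gh : h' * z = g'.
  apply/eqP; rewrite -subr_eq0 -rhorel big_sumType /= /h' /g' mulr_suml -sumrN.
  apply/eqP; congr (_ + _); apply: eq_bigr => m _; first by rewrite mulrA.
  by rewrite mulrN.
have Dint (r : B -> W) : vge P 0 (Dt (\sum_(m : B) jW (r m) * jFW (mmap1 v m))).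
  rewrite derivation_sum; apply: vge_sum => m _.
  by rewrite DtM DtF mulr0 add0r bFF DtW mulrC; apply: vgeM0; [exact: vge_const|exact: mon0].
pose h'' : {mpoly Kb[n]} := \sum_(m : B) b (rho (inl m)) *: 'X_[m].
have phih : mmap jK (jF \o v) h'' = bF h'.
  rewrite -[LHS]/(mmap_hom jK (jF \o v) h'') /h'' /h' [LHS]rmorph_sum [RHS]rmorph_sum.
  apply: eq_bigr => m _; rewrite -[LHS]/(mmap jK (jF \o v) (b (rho (inl m)) *: 'X_[m])).
  by rewrite mmapZ mmapX monE rmorphM bFF bFW.
have evh : mmap idfun c h'' != 0.
  move: rhoell; rewrite big_sumType /= [X in _ + X]big1 ?addr0; last by move=> m _; rewrite mul0r.
  congr (_ != 0); rewrite -[RHS]/(mmap_hom idfun c h'') /h'' [RHS]rmorph_sum.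
  apply: eq_bigr => m _; rewrite -[RHS]/(mmap idfun c (b (rho (inl m)) *: 'X_[m])).
  by rewrite mmapZ mmapX mulrC.
have [h'0 Ph'] : bF h' != 0 /\ P (bF h') = 0.
  have je : jK (mmap idfun c h'') != 0 by rewrite fmorph_eq0.
  have := @ordD_lt _ _ _ P (jK (mmap idfun c h'')) (bF h' - jK (mmap idfun c h'')) je.
  rewrite ord_const add0r (addrC (jK _)) subrK; apply.
  by rewrite -phih; exact: center.
have := congr1 Dt gh; rewrite DtM => e.
have : vge P 0 (bF h' * Dt z).
  rewrite -[bF h' * Dt z](addrK (bF z * Dt h')) e; apply: vgeB; first exact: Dint.
  by apply: vgeM0 => //; exact: Dint.
have [->|Dz0] := eqVneq (Dt z) 0; first by move=> _; exact: vge0.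
by rewrite !vgeP ?mulf_neq0 // ord_mul // Ph' add0r.
Qed.

End Derivation.

(** * Descent of quartic models *)

Section CubicBasisBaseChange.
Variables (K Kb F Fb : fieldType) (iota : {rmorphism K -> Kb}).
Variables (j : {rmorphism K -> F}) (jF : {rmorphism F -> Fb}).
Variable jK : {rmorphism Kb -> Fb}.
Hypothesis H : is_base_change iota j jF jK.

Let jFj c : jF (j c) = jK (iota c). Proof. by case: H. Qed.

Lemma eval1_base_change x p : jF (eval1 j x p) = eval1 jK (jF x) (map_poly iota p).
Proof.
rewrite /eval1 -horner_map -!map_poly_comp; congr _.[_].
by apply: eq_map_poly => c /=; rewrite jFj.
Qed.

Lemma comb3_base_change x y p0 p1 p2 : jF (comb3 j x y p0 p1 p2) =
  comb3 jK (jF x) (jF y) (map_poly iota p0) (map_poly iota p1) (map_poly iota p2).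
Proof. by rewrite /comb3 !rmorphD !rmorphM /= !eval1_base_change. Qed.

Definition mon3 (L : fieldType) (x y : L) N (i : 'I_N + ('I_N + 'I_N)) : L :=
  match i with
  | inl i => x ^+ i | inr (inl i) => x ^+ i * y | inr (inr i) => x ^+ i * y ^+ 2 end.

Definition coef3 (k : fieldType) N (p0 p1 p2 : {poly k}) (i : 'I_N + ('I_N + 'I_N)) : k :=
  match i with inl i => p0`_i | inr (inl i) => p1`_i | inr (inr i) => p2`_i end.

Lemma comb3_mon (k L : fieldType) (h : {rmorphism k -> L}) x y N (p0 p1 p2 : {poly k}) :
  (size p0 <= N)%N -> (size p1 <= N)%N -> (size p2 <= N)%N ->
  comb3 h x y p0 p1 p2 = \sum_(i : 'I_N + ('I_N + 'I_N)) h (coef3 p0 p1 p2 i) * mon3 x y i.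
Proof.
move=> s0 s1 s2; rewrite big_sumType big_sumType /= /comb3 -addrA.
have e (p : {poly k}) : (size p <= N)%N -> eval1 h x p = \sum_(i < N) h p`_i * x ^+ i.
  move=> sp; rewrite /eval1 (horner_coef_wide _ (n := N)); last by rewrite size_map_poly.
  by apply: eq_bigr => i _; rewrite coef_map.
rewrite !e // !mulr_suml; congr (_ + (_ + _)); apply: eq_bigr => i _; by rewrite mulrA.
Qed.

Lemma mon3_comb (k L : fieldType) (h : {rmorphism k -> L}) x y N
    (c : 'I_N + ('I_N + 'I_N) -> k) :
  \sum_i h (c i) * mon3 x y i = comb3 h x y (\sum_(i < N) c (inl i) *: 'X^i)
    (\sum_(i < N) c (inr (inl i)) *: 'X^i) (\sum_(i < N) c (inr (inr i)) *: 'X^i).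
Proof.
rewrite big_sumType big_sumType /= /comb3 -addrA.
have e (d : 'I_N -> k) : eval1 h x (\sum_(i < N) d i *: 'X^i) = \sum_(i < N) h (d i) * x ^+ i.
  by rewrite rmorph_sum; apply: eq_bigr => i _ /=; rewrite eval1Z eval1Xn.
rewrite !e !mulr_suml; congr (_ + (_ + _)); apply: eq_bigr => i _; by rewrite mulrA.
Qed.

Lemma coef_sumX (k : fieldType) N (c : 'I_N -> k) (i : 'I_N) :
  (\sum_(l < N) c l *: 'X^l : {poly k})`_i = c i.
Proof.
rewrite coef_sum (bigD1 i) //= coefZ coefXn eqxx mulr1 big1 ?addr0 // => l li.
by rewrite coefZ coefXn eq_sym val_eqE (negPf li) mulr0.
Qed.

Lemma mon3_indep (k L : fieldType) (h : {rmorphism k -> L}) x y N :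
  (forall p0 p1 p2, comb3 h x y p0 p1 p2 = 0 -> [/\ p0 = 0, p1 = 0 & p2 = 0]) ->
  indep h (@mon3 L x y N).
Proof.
move=> cI c; rewrite mon3_comb => /cI [c0 c1 c2] [i|[i|i]].
- by rewrite -[LHS](coef_sumX (fun i => c (inl i))) c0 coef0.
- by rewrite -[LHS](coef_sumX (fun i => c (inr (inl i)))) c1 coef0.
- by rewrite -[LHS](coef_sumX (fun i => c (inr (inr i)))) c2 coef0.
Qed.

Lemma mon3_base_change x y N i : jF (@mon3 F x y N i) = mon3 (jF x) (jF y) i.
Proof. by case: i => [i|[i|i]] /=; rewrite ?rmorphM ?rmorphXn. Qed.

Lemma comb3_descent x y z0 p0 p1 p2 :
  (forall p0 p1 p2, comb3 jK (jF x) (jF y) p0 p1 p2 = 0 -> [/\ p0 = 0, p1 = 0 & p2 = 0]) ->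
  jF z0 = comb3 jK (jF x) (jF y) p0 p1 p2 -> exists q0 q1 q2,
  [/\ p0 = map_poly iota q0, p1 = map_poly iota q1, p2 = map_poly iota q2
    & z0 = comb3 j x y q0 q1 q2].
Proof.
move=> cI; pose N := (size p0 + size p1 + size p2)%N.
have [s0 s1 s2] : [/\ size p0 <= N, size p1 <= N & size p2 <= N]%N.
  by split; rewrite /N; move: (size p0) (size p1) (size p2); clear; lia.
rewrite (comb3_mon jK _ _ s0 s1 s2) => z0E.
have zI : indep jK (jF \o (@mon3 F x y N)).
  move=> c c0; apply: (mon3_indep cI); rewrite -[RHS]c0.
  by apply: eq_bigr => i _ /=; rewrite mon3_base_change.
have [|c' cE z0E'] := coefs_descent H (z0 := z0) (c := coef3 p0 p1 p2) zI.
  by rewrite z0E; apply: eq_bigr => i _ /=; rewrite mon3_base_change.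
pose q0 : {poly K} := \sum_(i < N) c' (inl i) *: 'X^i.
pose q1 : {poly K} := \sum_(i < N) c' (inr (inl i)) *: 'X^i.
pose q2 : {poly K} := \sum_(i < N) c' (inr (inr i)) *: 'X^i.
have pE (p : {poly Kb}) (d : 'I_N -> K) : (size p <= N)%N ->
    (forall i : 'I_N, p`_i = iota (d i)) -> p = map_poly iota (\sum_(i < N) d i *: 'X^i).
  move=> sp pd; apply/polyP => i; rewrite coef_map.
  have [lt|ge] := ltnP i N.
    by rewrite -[i]/(val (Ordinal lt)) pd coef_sumX.
  rewrite nth_default ?(leq_trans sp) // coef_sum big1 ?[RHS]rmorph0 // => l _.
  by rewrite coefZ coefXn gtn_eqF ?mulr0 // (leq_trans (ltn_ord l)).
exists q0, q1, q2; split.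
- by apply: pE => // i; exact: (cE (inl i)).
- by apply: pE => // i; exact: (cE (inr (inl i))).
- by apply: pE => // i; exact: (cE (inr (inr i))).
- by rewrite z0E' mon3_comb.
Qed.

(** The relation z d(x) = p0 + p1 y + p2 y^2 is descended to [K] by [relation_descent], with the
    leading coefficient of [d] as linear form so that the new denominator is not 0. *)
Lemma cubic_basis_down x y : cubic_basis jK (jF x) (jF y) -> cubic_basis j x y.
Proof.
move=> cb; have tx := cb_trans cb.
have map0 (p : {poly K}) : map_poly iota p = 0 -> p = 0.
  by move/eqP; rewrite map_poly_eq0 => /eqP.
apply: cubic_basisI.
- by move=> p p0; apply/map0/tx; rewrite -eval1_base_change p0 rmorph0.
- move=> p0 p1 p2 c0; have [] := cb_indep_poly (p0 := map_poly iota p0)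
    (p1 := map_poly iota p1) (p2 := map_poly iota p2) cb.
    by rewrite -comb3_base_change c0 rmorph0.
  by move=> /map0 -> /map0 -> /map0 ->.
move=> z; have [d [p0 [p1 [p2 [d0 zd]]]]] := cb_span_poly (jF z) cb.
pose N := (size d + size p0 + size p1 + size p2)%N.
have [sd s0 s1 s2] : [/\ size d <= N, size p0 <= N, size p1 <= N & size p2 <= N]%N.
  by split; rewrite /N; move: (size d) (size p0) (size p1) (size p2); clear; lia.
pose I : finType := ('I_N + ('I_N + ('I_N + 'I_N)))%type.
pose zz (i : I) : F := match i with inl i => x ^+ i * z | inr i => - mon3 x y i end.
pose lam (i : I) : Kb := match i with inl i => d`_i | inr i => coef3 p0 p1 p2 i end.
have ldN : ((size d).-1 < N)%N.
  by rewrite (leq_trans _ sd) // prednK // lt0n size_poly_eq0.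
pose ell (i : I) : Kb := match i with inl i => (i == Ordinal ldN)%:R | inr _ => 0 end.
have eE (p : {poly Kb}) : (size p <= N)%N ->
    eval1 jK (jF x) p = \sum_(i < N) jK p`_i * jF x ^+ i.
  move=> sp; rewrite /eval1 (horner_coef_wide _ (n := N)); last by rewrite size_map_poly.
  by apply: eq_bigr => i _; rewrite coef_map.
have rel : \sum_i jK (lam i) * jF (zz i) = 0.
  rewrite big_sumType /=; apply/eqP; rewrite addr_eq0; apply/eqP.
  transitivity (jF z * eval1 jK (jF x) d).
    rewrite eE // mulr_sumr; apply: eq_bigr => i _.
    by rewrite rmorphM rmorphXn; ring.
  rewrite zd (comb3_mon jK _ _ s0 s1 s2) -sumrN; apply: eq_bigr => i _.
  by rewrite rmorphN mulrN opprK mon3_base_change.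
have [|rho [rhorel rhoell]] := relation_descent H rel (ell := ell).
  rewrite big_sumType /=.
  rewrite [X in _ + X]big1 ?addr0 => [|i _]; last by rewrite mul0r.
  rewrite (bigD1 (Ordinal ldN)) //= eqxx mul1r big1 ?addr0; last first.
    by move=> i /negPf ->; rewrite mul0r.
  by rewrite -lead_coefE lead_coef_eq0.
exists (\sum_(i < N) rho (inl i) *: 'X^i), (\sum_(i < N) rho (inr (inl i)) *: 'X^i),
  (\sum_(i < N) rho (inr (inr (inl i))) *: 'X^i), (\sum_(i < N) rho (inr (inr (inr i))) *: 'X^i).
split.
  apply: contraNneq rhoell => e; rewrite big_sumType /=.
  rewrite [X in _ + X]big1 ?addr0 => [|i _]; last by rewrite mul0r.
  rewrite (bigD1 (Ordinal ldN)) //= eqxx mul1r big1 ?addr0; last first.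
    by move=> i /negPf ->; rewrite mul0r.
  by rewrite -(coef_sumX (fun i => rho (inl i))) e coef0 rmorph0.
rewrite -(mon3_comb j x y (fun i => rho (inr i))).
move: rhorel; rewrite [X in X = _ -> _]big_sumType /= => rhorel.
apply/eqP; rewrite -subr_eq0 -[X in _ == X]rhorel; apply/eqP; congr (_ + _).
  rewrite rmorph_sum mulr_sumr; apply: eq_bigr => i _ /=.
  by rewrite eval1Z eval1Xn; ring.
by rewrite -sumrN; apply: eq_bigr => i _; rewrite mulrN.
Qed.

(** The span of 1, y, y^2 is closed under products as y^3 is in k(x), and contains both [F] and the
    constants. *)
Lemma cubic_basis_up x y h : cubic_basis j x y -> y ^+ 3 = eval1 j x h ->
  cubic_basis jK (jF x) (jF y).
Proof.
move=> cb yh; have cI p0 p1 p2 := @cb_indep_poly _ _ _ x y p0 p1 p2 cb.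
have cI' p0 p1 p2 : comb3 jK (jF x) (jF y) p0 p1 p2 = 0 -> [/\ p0 = 0, p1 = 0 & p2 = 0].
  pose N := (size p0 + size p1 + size p2)%N.
  have [s0 s1 s2] : [/\ size p0 <= N, size p1 <= N & size p2 <= N]%N.
    by split; rewrite /N; move: (size p0) (size p1) (size p2); clear; lia.
  rewrite (comb3_mon jK _ _ s0 s1 s2) => c0.
  have /(_ (coef3 p0 p1 p2)) := base_change_indep H (mon3_indep cI (N := N)).
  have -> : \sum_i jK (coef3 p0 p1 p2 i) * (jF \o mon3 (N := N) x y) i = 0.
    by rewrite -[RHS]c0; apply: eq_bigr => i _ /=; rewrite mon3_base_change.
  move=> /(_ erefl) c0'.
  have p_0 (p : {poly Kb}) : (size p <= N)%N -> (forall i : 'I_N, p`_i = 0) -> p = 0.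
    move=> sp pc; apply/polyP => i; rewrite coef0; have [lt|ge] := ltnP i N.
      exact: (pc (Ordinal lt)).
    by rewrite nth_default // (leq_trans sp).
  split; apply: p_0 => // i; first exact: (c0' (inl i)).
    exact: (c0' (inr (inl i))).
  exact: (c0' (inr (inr i))).
have tx' : transcendental jK (jF x).
  move=> p p0; have [|-> //] := cI' p 0 0.
  by rewrite /comb3 p0 rmorph0 !mul0r !addr0.
pose S := simple_subfield jK (jF x).
have SM a b : S a -> S b -> S (a * b) by exact: simple_subfieldM.
have S0 : S 0 by rewrite -(rmorph0 jK); exact: simple_subfield_const.
have SD a b : S a -> S b -> S (a + b).
  move=> Sa Sb; rewrite -[b]opprK; apply: simple_subfieldB => //.
  by rewrite -sub0r; apply: simple_subfieldB.
have Sy3 : S (jF y ^+ 3).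
  by rewrite -rmorphXn yh eval1_base_change; exact: simple_subfield_eval.
have spanM z w : (exists a0 a1 a2, [/\ S a0, S a1, S a2 & z = a0 + a1 * jF y + a2 * jF y ^+ 2]) ->
   (exists a0 a1 a2, [/\ S a0, S a1, S a2 & w = a0 + a1 * jF y + a2 * jF y ^+ 2]) ->
   exists a0 a1 a2, [/\ S a0, S a1, S a2 & z * w = a0 + a1 * jF y + a2 * jF y ^+ 2].
  move=> [a0 [a1 [a2 [Sa0 Sa1 Sa2 ->]]]] [b0 [b1 [b2 [Sb0 Sb1 Sb2 ->]]]].
  exists (a0 * b0 + (a1 * b2 + a2 * b1) * jF y ^+ 3),
    (a0 * b1 + a1 * b0 + a2 * b2 * jF y ^+ 3), (a0 * b2 + a1 * b1 + a2 * b0); split.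
  - by apply: (SD); [exact: SM|apply: (SM) => //; apply: (SD); exact: SM].
  - by apply: (SD); [apply: (SD); exact: SM|apply: (SM) => //; exact: SM].
  - by apply: (SD); [apply: (SD); exact: SM|exact: SM].
  - by ring.
split=> //; first exact: simple_indep.
apply: (base_change_ind H) => [|z w [a0 [a1 [a2 [Sa0 Sa1 Sa2 ->]]]] [b0 [b1 [b2 [Sb0 Sb1 Sb2 ->]]]]|f c].
- by exists 0, 0, 0; split=> //; rewrite !mul0r !addr0.
- by exists (a0 + b0), (a1 + b1), (a2 + b2); split; [exact: SD|exact: SD|exact: SD|ring].
apply: spanM; last first.
  by exists (jK c), 0, 0; split=> //; [exact: simple_subfield_const|rewrite !mul0r !addr0].
have [d [p0 [p1 [p2 [d0 fd]]]]] := cb_span_poly f cb.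
have d0' : eval1 jK (jF x) (map_poly iota d) != 0.
  by rewrite transcendental_neq0 // map_poly_eq0.
have Sf p : S (eval1 jK (jF x) p / eval1 jK (jF x) (map_poly iota d)) by exists p, (map_poly iota d).
exists (eval1 jK (jF x) (map_poly iota p0) / eval1 jK (jF x) (map_poly iota d)),
  (eval1 jK (jF x) (map_poly iota p1) / eval1 jK (jF x) (map_poly iota d)),
  (eval1 jK (jF x) (map_poly iota p2) / eval1 jK (jF x) (map_poly iota d)); split=> //.
apply: (mulIf d0'); have := congr1 jF fd.
by rewrite rmorphM comb3_base_change /= eval1_base_change => ->; rewrite /comb3; field.
Qed.

Lemma morphism_extend (R : fieldType) (g : {rmorphism F -> R}) (psi : {rmorphism Kb -> R}) :
  (forall c, psi (iota c) = g (j c)) -> exists Psi : {rmorphism Fb -> R},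
    (forall f, Psi (jF f) = g f) /\ forall c, Psi (jK c) = psi c.
Proof.
move=> psij.
have [||Ps [PsD PsE]] := base_change_extend H (g := g) (psi := psi).
- exact: rmorphD.
- by move=> c w; rewrite rmorphM psij.
have Ps0 : Ps 0 = 0 by apply: (addrI (Ps 0)); rewrite -PsD !addr0.
have PsF f : Ps (jF f) = g f by rewrite -[jF f]mulr1 -(rmorph1 jK) PsE rmorph1 mulr1.
have PsK c : Ps (jK c) = psi c by rewrite -[jK c]mul1r -(rmorph1 jF) PsE rmorph1 mul1r.
have [||| Psi PsiE] := @rmorphismP _ _ Ps.
- move=> x y; apply/eqP; rewrite eq_sym subr_eq -PsD subrK; exact: eqxx.
- by rewrite -(rmorph1 jF) PsF rmorph1.
- move=> x y; move: x; apply: (base_change_ind H) => [|x x' xE xE'|f c].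
  + by rewrite mul0r Ps0 mul0r.
  + by rewrite mulrDl !PsD xE xE' mulrDl.
  move: y; apply: (base_change_ind H) => [|y y' yE yE'|f' c'].
  + by rewrite mulr0 Ps0 mulr0.
  + by rewrite mulrDr !PsD yE yE' mulrDr.
  have -> : jF f * jK c * (jF f' * jK c') = jF (f * f') * jK (c * c').
    by rewrite !rmorphM; ring.
  by rewrite !PsE !rmorphM /=; ring.
by exists Psi; split=> [f|c]; rewrite PsiE.
Qed.

End CubicBasisBaseChange.

Lemma separable_comp (k : fieldType) (p q : {poly k}) :
  size q = 2%N -> separable_poly p -> separable_poly (p \Po q).
Proof.
move=> q2; rewrite !unlock => sp.
have q'0 : (q^`()) = (q`_1)%:P.
  apply/polyP => -[|i]; rewrite coef_deriv coefC ?mulr1n //=.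
  by rewrite nth_default ?mul0rn // q2.
have q1 : q`_1 != 0.
  by have := lead_coef_eq0 q; rewrite lead_coefE q2 -size_poly_eq0 q2 => /= ->.
rewrite deriv_comp q'0 mulrC mul_polyC coprimepZr //.
by rewrite coprimep_comp_poly.
Qed.

(** * Completing the cube over the smaller field *)

Section QuarticDescent.
Variables (K Kb F Fb : fieldType) (iota : {rmorphism K -> Kb}).
Variables (j : {rmorphism K -> F}) (jF : {rmorphism F -> Fb}).
Variable jK : {rmorphism Kb -> Fb}.
Hypothesis H : is_base_change iota j jF jK.
Hypothesis three_neq0 : (3%:R : Kb) != 0.

(** Let Z = mu y and Y = Z + L(X), with L linear. The equation Y^3 = 3 L Y^2 - 3 L^2 Y + (Z^3 + L^3)
    has coefficients over [K] because X and Y come from [F]. As 3 is invertible, L is over [K],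
    hence so are Z and the quartic Z^3. *)
Lemma quartic_descent x y s x1 y1 k1 k0 mu nu la :
  kummer jK x y s [::] -> size s = 4%N -> k1 != 0 -> mu != 0 ->
  jF x1 = jK k1 * x + jK k0 -> jF y1 = jK mu * y + jK nu * jF x1 + jK la ->
  exists nu' la' g, let y2 := y1 - j nu' * x1 - j la' in
  [/\ y2 ^+ 3 = eval1 j x1 g, size g = 5%N, separable_poly g,
      jF y2 = jK mu * y & cubic_basis j x1 y2].
Proof.
move=> ku s4 k10 mu0 x1E y1E.
have [cb us] := ku; rewrite cats0 in us; rewrite /rts big_nil expr1n mulr1 -/(rts s) => yE.
have tx := cb_trans cb; pose q := k1^-1 *: 'X - (k0 / k1)%:P : {poly Kb}.
have q2 : size q = 2%N.
  by rewrite size_polyDl ?size_scale ?size_polyX ?invr_eq0 // size_polyN ltnS size_polyC leq_b1.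
have jk10 : jK k1 != 0 by rewrite fmorph_eq0.
have xE : x = eval1 jK (jF x1) q.
  rewrite /q rmorphB /= eval1Z eval1X eval1C x1E fmorph_div fmorphV.
  by field.
set X := jF x1 in x1E y1E xE *; pose Z := jK mu * y.
have [G GE] : exists G, G = mu ^+ 3 *: (rts s \Po q) by eexists.
have ZE : Z ^+ 3 = eval1 jK X G.
  by rewrite /Z GE eval1Z eval1_comp -xE exprMn yE rmorphXn.
have X1 : X = eval1 jK x (k1 *: 'X + k0%:P).
  by rewrite rmorphD /= eval1Z eval1X eval1C.
have simple_eval u p : simple_subfield jK u (eval1 jK u p).
  exact: simple_subfield_eval.
have tX : transcendental jK X.
  move=> p; rewrite X1 -eval1_comp => /tx /eqP.
  rewrite comp_poly2_eq0 => [/eqP //|].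
  by rewrite size_polyDl ?size_scale ?size_polyX // ltnS size_polyC leq_b1.
have cbZ : cubic_basis jK X Z.
  apply: (cubic_basis_scale cb) => //.
  - by rewrite X1.
  - by rewrite xE.
  - exact: simple_subfield_const.
  - by rewrite fmorph_eq0.
have [L LE] : exists L, L = nu *: 'X + la%:P :> {poly Kb} by eexists.
have YE : jF y1 = Z + eval1 jK X L.
  by rewrite y1E LE rmorphD /= eval1Z eval1X eval1C addrA.
have cY p0 p1 p2 : comb3 jK X (jF y1) p0 p1 p2 = 0 -> [/\ p0 = 0, p1 = 0 & p2 = 0].
  move=> c0; have [] := cb_indep_poly (p0 := p0 + p1 * L + p2 * L ^+ 2)
     (p1 := p1 + 2%:R *: (p2 * L)) (p2 := p2) cbZ.
    rewrite -[RHS]c0 /comb3 YE !rmorphD /= eval1Z !(rmorphM (eval1 jK X)) /=.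
    by rewrite rmorph_nat; ring.
  move=> e0 e1 p20; move: e1 e0; rewrite p20 !mul0r scaler0 !addr0 => ->.
  by rewrite mul0r addr0 => ->.
have Y3 : jF (y1 ^+ 3) = comb3 jK X (jF y1) (G + L ^+ 3) (- 3%:R *: L ^+ 2) (3%:R *: L).
  rewrite rmorphXn /= /comb3 YE !rmorphD /= !eval1Z !(rmorphXn (eval1 jK X)) /= -ZE.
  by rewrite rmorphN !rmorph_nat; ring.
have [_ [_ [l3 [_ _ l3E _]]]] := comb3_descent H cY Y3.
pose l := (3%:R^-1 : K) *: l3.
have three0 : (3%:R : K) != 0 by rewrite -(fmorph_eq0 iota) rmorph_nat.
have lE : map_poly iota l = L.
  by rewrite /l map_polyZ /= -l3E scalerA fmorphV rmorph_nat mulVf // scale1r.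
have l2 : l = l`_1 *: 'X + (l`_0)%:P.
  have sl : (size l <= 2)%N.
    rewrite -(size_map_poly iota) lE LE (leq_trans (size_polyD _ _)) // geq_max.
    rewrite (leq_trans (size_scale_leq _ _)) ?size_polyX //.
    by rewrite (leq_trans (size_polyC_leq1 _)).
  apply/polyP => -[|[|i]]; rewrite coefD coefZ coefX coefC ?mulr0 ?mulr1 ?add0r ?addr0 //.
  by rewrite nth_default // (leq_trans sl).
pose y2 := y1 - j l`_1 * x1 - j l`_0.
have y2l : y2 = y1 - eval1 j x1 l.
  by rewrite [in RHS]l2 rmorphD /= eval1Z eval1X eval1C /y2; ring.
have y2E : jF y2 = Z by rewrite y2l rmorphB /= (eval1_base_change H) lE YE addrK.
have cbY2 : cubic_basis j x1 y2 by apply: (cubic_basis_down H); rewrite y2E.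
have y23 : jF (y2 ^+ 3) = comb3 jK X (jF y2) G 0 0.
  by rewrite rmorphXn /= y2E ZE /comb3 !rmorph0 !mul0r !addr0.
have [|g [g1 [g2 [gE g10 g20 y2g]]]] := comb3_descent H _ y23.
  by move=> p0 p1 p2; rewrite y2E; exact: cb_indep_poly.
have g1_0 : g1 = 0 by apply/eqP; rewrite -(map_poly_eq0 iota) -g10.
have g2_0 : g2 = 0 by apply/eqP; rewrite -(map_poly_eq0 iota) -g20.
have mu30 : mu ^+ 3 != 0 by rewrite expf_neq0.
exists l`_1, l`_0, g; split=> //.
- by rewrite -/y2 y2g g1_0 g2_0 /comb3 !rmorph0 !mul0r !addr0.
- by rewrite -(size_map_poly iota) -gE GE size_scale // size_comp_poly2 // size_rts s4.
have : separable_poly (rts s \Po q).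
  by apply: separable_comp => //; rewrite separable_prod_XsubC.
rewrite -(separable_map iota) -gE GE !unlock /separable_poly.body.
by rewrite derivZ coprimepZl // coprimepZr.
Qed.

End QuarticDescent.

(** * Maps that detect irrational elements *)

Section MovingMaps.
Variable Kb : closedFieldType.

Lemma minimal_polynomial (K : fieldType) (iota : {rmorphism K -> Kb}) e :
  algebraicOver iota e -> exists p : {poly K}, [/\ p != 0, eval1 iota e p = 0
    & forall q, eval1 iota e q = 0 -> p %| q].
Proof.
move=> [p0 p00 /eqP rp0].
pose P n := `[< exists p : {poly K}, [/\ p != 0, eval1 iota e p = 0 & size p = n] >].
have [|n /asboolP [p [pn0 pe pn]] nmin] := ex_minnP (P := P).
  by exists (size p0); apply/asboolP; exists p0.
exists p; split=> // q qe; rewrite /dvdp; apply/negPn/negP => r0.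
have /nmin : P (size (q %% p)).
  apply/asboolP; exists (q %% p); split=> //.
  by have := qe; rewrite {1}(divp_eq q p) rmorphD rmorphM /= pe mulr0 add0r.
by rewrite -pn leqNgt ltn_modp pn0.
Qed.

(** A witness, on [W], that some element of [E] is not in [K]: either an embedding over [K] other
    than the inclusion, or a [K]-derivation into [Kb]. *)
Definition moving_map (K W : fieldType) (iota : {rmorphism K -> Kb})
    (a : {rmorphism K -> W}) (b : {rmorphism W -> Kb}) (E : {pred Kb}) : Prop :=
  (exists s : {rmorphism W -> Kb}, (forall c, s (a c) = iota c) /\
     exists2 w, b w \in E & s w <> b w) \/
  (exists D : W -> Kb, [/\ {morph D : x y / x + y},
     forall x y, D (x * y) = b x * D y + b y * D x, forall c, D (a c) = 0
     & exists2 w, b w \in E & D w <> 0]).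

(** Take W = K(e), with p the minimal polynomial of e. If p' = 0, differentiation of polynomials
    passes to the quotient by p and sends e to 1. If p' <> 0, e is a simple root, and since p is not
    linear there is another root to which e can be sent. *)
Lemma simple_moving_map (K : fieldType) (iota : {rmorphism K -> Kb}) (E : {pred Kb}) e :
  (forall z, algebraicOver iota z) -> e \in E -> ~ (exists c, e = iota c) ->
  exists (W : fieldType) (a : {rmorphism K -> W}) (b : {rmorphism W -> Kb}),
  [/\ forall c, b (a c) = iota c, range b e & moving_map iota a b E].
Proof.
move=> alg eE eK; have [p [p0 pe pmin]] := minimal_polynomial (alg e).
have [W [b bE]] := subfieldP (simple_field iota e).
have [a aE] : exists a : {rmorphism K -> W}, forall c, b (a c) = iota c.
  by apply: rmorphism_factor => c; rewrite bE; exact: simple_subfield_const.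
have [we _ wE] : range b e by rewrite bE; exact: simple_subfield_id.
exists W, a, b; split=> //; first by exists we.
have poly_of w : exists q, b w = eval1 iota e q.
  have : range b (b w) by exists w.
  rewrite bE => -[r [d [d0 ->]]]; have [u du] := algebraic_inverse (alg _) d0.
  exists (r * (u \Po d)); rewrite rmorphM /= eval1_comp; congr (_ * _).
  by apply: (mulfI d0); rewrite divff.
have [Q QE] := choice poly_of.
have diff q1 q2 : eval1 iota e q1 = eval1 iota e q2 -> exists r, q1 = q2 + r * p.
  move=> q12; have /pmin /dvdpP [r rE] : eval1 iota e (q1 - q2) = 0 by rewrite rmorphB /= q12 subrr.
  by exists r; rewrite -rE addrC subrK.
have [p'0|p'0] := eqVneq (p^`()) 0.
  right; pose D w := eval1 iota e (Q w)^`().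
  have DE w r : b w = eval1 iota e r -> D w = eval1 iota e r^`().
    rewrite QE /D => /diff [t ->].
    by rewrite derivD derivM p'0 mulr0 addr0 rmorphD rmorphM /= pe mulr0 addr0.
  exists D; split.
  - move=> x y; rewrite (DE _ (Q x + Q y)) ?derivD ?rmorphD //=.
    by rewrite !QE.
  - move=> x y; rewrite (DE _ (Q x * Q y)) ?derivM ?rmorphD ?rmorphM /=; last by rewrite !QE.
    by rewrite /D !QE; ring.
  - by move=> c; rewrite (DE _ c%:P) ?derivC ?rmorph0 // aE eval1C.
  exists we; first by rewrite wE.
  rewrite (DE _ 'X) ?derivX ?rmorph1 ?eval1X //.
  by apply/eqP; rewrite oner_eq0.
have p'e : eval1 iota e p^`() != 0.
  apply/eqP => /pmin /dvdp_leq; rewrite p'0 => /(_ isT).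
  by rewrite leqNgt lt_size_deriv.
have /factor_theorem [u uE] : root (map_poly iota p) e by apply/eqP.
have ue : u.[e] != 0.
  apply: contra_neq p'e => ue; rewrite /eval1 -deriv_map uE derivM.
  by rewrite derivXsubC !hornerE ue subrr mulr0 addr0.
(* Were the cofactor u constant, p would be linear and e would lie in [K]. *)
have [e' re'] : exists e', root u e'.
  apply/closed_rootP/eqP => /eqP/size_poly1P [c c0 uc].
  apply: eK; exists (- (p`_0 / p`_1)).
  have sp : size p = 2%N.
    by rewrite -(size_map_poly iota) uE uc size_Cmul // size_XsubC.
  have p10 : p`_1 != 0 by have := p0; rewrite -lead_coef_eq0 lead_coefE sp.
  have := pe; rewrite /eval1 horner_coef size_map_poly sp !big_ord_recl big_ord0 /=.
  rewrite /bump /= !coef_map /= expr0 expr1 mulr1 addr0 => /eqP.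
  rewrite addrC addr_eq0 => /eqP pe'.
  apply: (mulfI (x := iota p`_1)); first by rewrite fmorph_eq0.
  by rewrite pe' rmorphN mulrN fmorph_div mulrC divfK ?fmorph_eq0.
have e'e : e' != e by apply: contraNneq ue => <-.
have pe' : eval1 iota e' p = 0 by rewrite /eval1 uE hornerM (rootP re') mul0r.
left; pose s w := eval1 iota e' (Q w).
have sE w r : b w = eval1 iota e r -> s w = eval1 iota e' r.
  by rewrite QE /s => /diff [t ->]; rewrite rmorphD rmorphM /= pe' mulr0 addr0.
have [|||S SE] := @rmorphismP _ _ s.
- by move=> x y; rewrite (sE _ (Q x - Q y)) ?rmorphB //= !QE.
- by rewrite (sE _ 1) ?rmorph1.
- by move=> x y; rewrite (sE _ (Q x * Q y)) ?rmorphM //= !QE.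
exists S; split.
  by move=> c; rewrite SE (sE _ c%:P) ?eval1C // aE.
exists we; first by rewrite wE.
by rewrite wE SE (sE _ 'X) ?eval1X ?wE //; exact/eqP.
Qed.

(** [W] has to contain all of [E]. Irrational elements are adjoined one by one; while some element
    of [E] is still missing, the map just found is dropped and the search restarts over the larger
    field. A moving map over that field is also one over [K]. *)
Lemma exists_moving_map (K : fieldType) (iota : {rmorphism K -> Kb}) (E : seq Kb) :
  (forall e, algebraicOver iota e) -> ~ (forall e, e \in E -> exists c, e = iota c) ->
  exists (W : fieldType) (a : {rmorphism K -> W}) (b : {rmorphism W -> Kb}),
  [/\ forall c, b (a c) = iota c, forall e, e \in E -> exists w, e = b w
    & moving_map iota a b (mem E)].
Proof.
move=> alg EK.
have [L LE EL] : exists2 L : seq Kb, {subset L <= E} &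
    forall e, e \in E -> (exists c, e = iota c) \/ e \in L by exists E => // e; right.
elim: L K iota alg EK LE EL => [|e L IH] K iota alg EK LE EL.
  by case: EK => e /EL [].
have LE' : {subset L <= E} by move=> x xL; apply: LE; rewrite inE xL orbT.
have [eK|eK] := pselect (exists c, e = iota c).
  apply: IH => // x /EL [|]; first by left.
  by rewrite inE => /orP [/eqP ->|]; [left|right].
have eE : e \in mem E by apply: LE; rewrite inE eqxx.
have [W [a [b [ba eb mov]]]] := simple_moving_map alg eE eK.
have [Eb|Eb] := pselect (forall x, x \in E -> exists c, x = b c); first by exists W, a, b.
have algb x : algebraicOver b x.
  have [p p0 rp] := alg x; exists (map_poly a p); first by rewrite map_poly_eq0.
  by rewrite -map_poly_comp (eq_map_poly (g := iota)) // => c /=; rewrite ba.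
have [|W' [a' [b' [ba' Eb' mov']]]] := IH _ b algb Eb LE'.
  move=> x /EL [[c ->]|]; first by left; exists (a c); rewrite ba.
  rewrite inE => /orP [/eqP ->|]; last by right.
  by left; case: eb => w _ <-; exists w.
exists W', (a' \o a : {rmorphism K -> W'}), b'; split=> //.
  by move=> c /=; rewrite ba' ba.
case: mov' => [[s [sa sE]]|[D [DD DM Da DE]]]; [left|right].
  by exists s; split=> // c /=; rewrite sa ba.
by exists D; split=> // c /=; rewrite Da.
Qed.

End MovingMaps.

Lemma quartic_kummer (k : closedFieldType) (E : fieldType) (j : {rmorphism k -> E}) x y g :
  cubic_basis j x y -> y ^+ 3 = eval1 j x g -> size g = 5%N -> separable_poly g ->
  exists d s, [/\ d != 0, size s = 4%N & kummer j x (j d * y) s [::]].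
Proof.
move=> cb yE g5 sepg; have [s gE] := closed_field_poly_normal g.
have g0 : lead_coef g != 0 by rewrite lead_coef_eq0 -size_poly_eq0 g5.
have [d dE] := cube_root (lead_coef g)^-1.
have d0 : d != 0 by apply: contraNneq g0 => d0; rewrite -invr_eq0 -dE d0 expr0n.
have rE : rts s = (lead_coef g)^-1 *: g by rewrite {2}gE scalerA mulVf // scale1r.
exists d, s; split=> //.
  by move: g5; rewrite gE size_scale // size_prod_XsubC => -[].
split.
- apply: (cubic_basis_scale cb); rewrite ?fmorph_eq0 //.
  + exact: cb_trans cb.
  + exact: simple_subfield_id.
  + exact: simple_subfield_id.
  + exact: simple_subfield_const.
- rewrite cats0 -separable_prod_XsubC -/(rts s) rE.
  move: sepg; rewrite !unlock /separable_poly.body.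
  by rewrite derivZ coprimepZl ?coprimepZr ?invr_eq0.
rewrite /rts big_nil expr1n mulr1 -/(rts s) exprMn -rmorphXn dE yE rE.
by rewrite eval1Z.
Qed.

(** * Effect of an embedding on the flag *)

Section GaloisStep.
Variables (K : fieldType) (Kb : closedFieldType) (F Fb : fieldType).
Variables (iota : {rmorphism K -> Kb}) (j : {rmorphism K -> F}).
Variables (jF : {rmorphism F -> Fb}) (jK : {rmorphism Kb -> Fb}).
Hypothesis H : is_base_change iota j jF jK.
Hypothesis three_neq0 : 3%:R != 0 :> Kb.
Variables (x y : Fb) (s : seq Kb).
Hypothesis ku : kummer jK x y s [::].
Hypothesis s4 : size s = 4%N.
Hypothesis same_fixing : forall x' y' s',
  kummer jK x' y' s' [::] -> size s' = 4%N -> fixing jK x = fixing jK x'.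
Variables (W FW : fieldType) (a : {rmorphism K -> W}) (b : {rmorphism W -> Kb}).
Variables (jFW : {rmorphism F -> FW}) (jW : {rmorphism W -> FW}) (bF : {rmorphism FW -> Fb}).
Hypothesis HW : is_base_change a j jFW jW.
Hypothesis bFF : forall f, bF (jFW f) = jF f.
Hypothesis bFW : forall w, bF (jW w) = jK (b w).
Variables (xW yW : FW) (k1 k0 mu nu la : Kb).
Hypothesis k10 : k1 != 0.
Hypothesis mu0 : mu != 0.
Hypothesis xWE : bF xW = jK k1 * x + jK k0.
Hypothesis yWE : bF yW = jK mu * y + jK nu * bF xW + jK la.
Variables (sg : {rmorphism W -> Kb}) (sF : {rmorphism FW -> Fb}).
Hypothesis sFF : forall f, sF (jFW f) = jF f.
Hypothesis sFW : forall w, sF (jW w) = jK (sg w).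

(** Through [sF] too, [Fb] is a base change of [FW], so the quartic model over [W] is carried to a
    quartic model of [Fb]. Its group is the old one by [same_fixing], and [quartic_unique] compares
    the two. *)
Lemma galois_step : exists a0 b0 c0 d0 e0 : Kb,
  sF xW = jK a0 + jK b0 * x /\ sF yW = jK c0 + jK d0 * x + jK e0 * y.
Proof.
have HWb := base_change_cancel H HW bFF bFW.
have HWs := base_change_cancel H HW sFF sFW.
have [n' [l' [g [y2E g5 sepg y2y cb2]]]] := quartic_descent HWb three_neq0 ku s4 k10 mu0 xWE yWE.
set y2 := yW - _ - _ in y2E y2y cb2.
have cbs := cubic_basis_up HWs cb2 y2E.
have y2s : sF y2 ^+ 3 = eval1 jK (sF xW) (map_poly sg g).
  by rewrite -rmorphXn y2E (eval1_base_change HWs).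
have [||d [s' [d0 s'4 ku']]] := quartic_kummer cbs y2s.
- by rewrite size_map_poly.
- by rewrite separable_map.
have [a0 [b0 [c0 [d1 [e0 [xE yE]]]]]] :=
  quartic_unique three_neq0 ku s4 ku' s'4 (same_fixing ku' s'4).
have yW2 : sF yW = sF y2 + jK (sg n') * sF xW + jK (sg l').
  by rewrite /y2 !rmorphB rmorphM /= !sFW; ring.
have jd0 : jK d != 0 by rewrite fmorph_eq0.
have y2E' : sF y2 = (jK c0 + jK d1 * x + jK e0 * y) / jK d by rewrite -yE mulrC mulKf.
exists a0, b0, (c0 / d + sg n' * a0 + sg l'), (d1 / d + sg n' * b0), (e0 / d).
split=> //; rewrite yW2 y2E' xE !rmorphD !rmorphM /= fmorphV.
by field.
Qed.

End GaloisStep.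

(** * Effect of a derivation on the flag *)

Section DerivationStep.
Variables (K : fieldType) (Kb : closedFieldType) (F Fb : fieldType).
Variables (iota : {rmorphism K -> Kb}) (j : {rmorphism K -> F}).
Variables (jF : {rmorphism F -> Fb}) (jK : {rmorphism Kb -> Fb}).
Hypothesis H : is_base_change iota j jF jK.
Hypothesis three_neq0 : 3%:R != 0 :> Kb.
Variables (n : nat) (u : 'I_n.+1 -> F).
Hypothesis u_neq0 : exists i, u i != 0.
Hypothesis u_gen : generates_function_field j u.
Hypothesis u_smooth : forall c : 'I_n.+1 -> Kb,
  geometric_point j u iota c -> smooth_at j u iota c.
Variables (x y : Fb) (s : seq Kb).
Hypothesis ku : kummer jK x y s [::].
Hypothesis s4 : size s = 4%N.
Variables (W FW : fieldType) (a : {rmorphism K -> W}) (b : {rmorphism W -> Kb}).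
Variables (jFW : {rmorphism F -> FW}) (jW : {rmorphism W -> FW}) (bF : {rmorphism FW -> Fb}).
Hypothesis HW : is_base_change a j jFW jW.
Hypothesis bFF : forall f, bF (jFW f) = jF f.
Hypothesis bFW : forall w, bF (jW w) = jK (b w).
Variable D : W -> Kb.
Variable Dt : FW -> Fb.
Hypothesis DtD : {morph Dt : x y / x + y}.
Hypothesis DtM : forall x y, Dt (x * y) = bF x * Dt y + bF y * Dt x.
Hypothesis DtF : forall f, Dt (jFW f) = 0.
Hypothesis DtW : forall w, Dt (jW w) = jK (D w).

Let HWb := base_change_cancel H HW bFF bFW.

Lemma derivation_eval1 z p : exists r, Dt (eval1 jW z p) =
  eval1 jK (bF z) r + eval1 jK (bF z) (map_poly b p)^`() * Dt z.
Proof.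
elim/poly_ind: p => [|p c [r rE]].
  by exists 0; rewrite !rmorph0 deriv0 rmorph0 mul0r addr0 (derivation0 DtD).
exists (r * 'X + (D c)%:P); rewrite !rmorphD !rmorphM /= map_polyX map_polyC /=.
rewrite !eval1X !eval1C DtD DtM DtW rE derivD derivM derivX derivC addr0 mulr1.
rewrite (eval1_base_change HWb) rmorphD rmorphM /= eval1X; ring.
Qed.

Lemma derivation_place (P : place jK) z : vge P 0 (bF z) -> vge P 0 (Dt z).
Proof.
have res := kummer_residue three_neq0 ku (quartic_wild s4) (P := P).
have [v [c [center local]]] := smooth_local H u_neq0 u_gen u_smooth res.
move=> z0.
exact: (derivation_integral H HW bFF bFW DtD DtM DtF DtW center (fun h => local _ h) z0).
Qed.

Variables (xW y2 : FW) (g : {poly W}) (k1 k0 mu : Kb).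
Hypothesis k10 : k1 != 0.
Hypothesis mu0 : mu != 0.
Hypothesis xWE : bF xW = jK k1 * x + jK k0.
Hypothesis y2y : bF y2 = jK mu * y.
Hypothesis y2E : y2 ^+ 3 = eval1 jW xW g.
Hypothesis sepg : separable_poly g.
Hypothesis g5 : size g = 5%N.
Hypothesis cb2 : cubic_basis jW xW y2.

Lemma derivation_pole (P : place jK) : P x < 0 -> vge P (-4) (Dt xW) /\ vge P (-5) (Dt y2).
Proof.
move=> xinf; have wild := quartic_wild s4.
have Px := infinite_place_ord ku wild xinf; have Py := infinite_ord_y ku wild xinf.
have x0 : x != 0 by apply: contraTneq xinf => ->; rewrite ord_zero.
have y0 : y != 0 := cb_neq0 (ku_basis ku).
have jk10 : jK k1 != 0 by rewrite fmorph_eq0.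
have jmu0 : jK mu != 0 by rewrite fmorph_eq0.
have k1x0 : jK k1 * x != 0 by rewrite mulf_neq0.
have Pk1x : P (jK k1 * x) = -3 by rewrite ord_mul // ord_const add0r.
have [X0 PX] : bF xW != 0 /\ P (bF xW) = -3.
  rewrite xWE -Pk1x; apply: ordD_lt => //; rewrite Pk1x.
  by apply: vge_le (vge_const _ _).
have Y0 : bF y2 != 0 by rewrite y2y mulf_neq0.
have PY : P (bF y2) = -4 by rewrite y2y ord_mul // ord_const add0r Py s4.
(* A local parameter at infinity, of order -3 + 4, and t^3 xW is a unit. Both have integral
   derivatives; solving the product rule for [Dt xW], and then xW = t y2 for [Dt y2], loses just one
   order each. *)
pose t := xW / y2.
have T0 : bF t != 0 by rewrite fmorph_div mulf_neq0 ?invr_eq0.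
have PT : P (bF t) = 1 by rewrite fmorph_div ord_div // PX PY.
have t0 : vge P 0 (Dt t) by apply: derivation_place; rewrite vgeP // PT.
have U0 : vge P 0 (Dt (t ^+ 3 * xW)).
  apply: derivation_place; rewrite rmorphM rmorphXn /= vgeP ?mulf_neq0 ?expf_neq0 //.
  by rewrite ord_mul ?expf_neq0 // ordX PT PX.
have t3 : Dt (t ^+ 3) = 3%:R * bF t ^+ 2 * Dt t.
  by rewrite [t ^+ 3]exprS expr2 !DtM rmorphM /=; ring.
have DxE : Dt xW = (Dt (t ^+ 3 * xW) - 3%:R * (bF xW * (bF t ^+ 2 * Dt t))) / bF t ^+ 3.
  by rewrite DtM t3 rmorphXn /=; field.
have Dx4 : vge P (-4) (Dt xW).
  rewrite DxE; apply: (vgeM (m := -1) (n := -3)); last first.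
    by rewrite vgeP ?invr_eq0 ?expf_neq0 // ordV ordX PT.
  apply: vgeB; first exact: vge_le U0.
  apply: vgeM0; first by rewrite -(rmorph_nat jK); exact: vge_const.
  apply: (vgeM (m := -3) (n := 2)); first by rewrite vgeP // PX.
  apply: (vgeM (m := 2) (n := 0)) => //.
  by rewrite vgeP ?expf_neq0 // ordX PT.
split=> //.
have y20 : y2 != 0 by rewrite -(fmorph_eq0 bF).
have DyE : Dt y2 = (Dt xW - bF y2 * Dt t) / bF t.
  have xt : Dt xW = bF t * Dt y2 + bF y2 * Dt t by rewrite -DtM /t divfK.
  by rewrite xt; field.
rewrite DyE; apply: (vgeM (m := -4) (n := -1)); last by rewrite vgeP ?invr_eq0 // ordV PT.
apply: vgeB => //; apply: (vgeM (m := -4) (n := 0)) => //.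
by rewrite vgeP // PY.
Qed.

Lemma derivation_step : exists a0 b0 c0 d0 e0 : Kb,
  Dt xW = jK a0 + jK b0 * x /\ Dt y2 = jK c0 + jK d0 * x + jK e0 * y.
Proof.
have wild := quartic_wild s4; have [Pinf xinf] := infinite_place ku wild.
have [Dx4 Dy5] := derivation_pole xinf.
have fin P : P <> Pinf -> vge P 0 (Dt xW) /\ vge P 0 (Dt y2).
  move=> PP; have xP := infinite_place_fin ku wild xinf PP.
  split; apply: derivation_place.
    rewrite xWE; apply: vgeD (vge_const _ _).
    by apply: vgeM0 => //; exact: vge_const.
  rewrite y2y; apply: vgeM0; first exact: vge_const.
  exact: (kummer_integral ku).
have [||a0 [b0 [c0 [DxE _]]]] := quartic_riemann_roch three_neq0 ku s4 (f := Dt xW) xinf.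
- by move=> P /fin [].
- exact: vge_le Dx4.
have [||c1 [d1 [e1 [DyE _]]]] := quartic_riemann_roch three_neq0 ku s4 (f := Dt y2) xinf.
- by move=> P /fin [].
- exact: Dy5.
suff c00 : c0 = 0.
  by exists a0, b0, c1, d1, e1; split=> //; rewrite DxE c00 rmorph0 mul0r addr0.
have cb := cubic_basis_up HWb cb2 y2E.
have jk10 : jK k1 != 0 by rewrite fmorph_eq0.
have jmu0 : jK mu != 0 by rewrite fmorph_eq0.
have YE : bF y2 ^+ 3 = eval1 jK (bF xW) (map_poly b g).
  by rewrite -rmorphXn y2E (eval1_base_change HWb).
have [r rE] := derivation_eval1 xW g.
have y3 : Dt (y2 ^+ 3) = 3%:R * bF y2 ^+ 2 * Dt y2.
  by rewrite [y2 ^+ 3]exprS expr2 !DtM rmorphM /=; ring.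
have xE : x = (bF xW - jK k0) / jK k1 by rewrite xWE addrK mulrC mulKf.
have yE : y = bF y2 / jK mu by rewrite y2y mulrC mulKf.
have [G GE] : exists G, G = map_poly b g by eexists.
have [G' G'E] : exists G', G' = G^`() by eexists.
move: rE YE; rewrite -y2E y3 -GE -G'E => rE YE.
pose A := (a0 - b0 * k0 / k1)%:P + (b0 / k1) *: 'X : {poly Kb}.
pose A1 := (c1 - d1 * k0 / k1)%:P + (d1 / k1) *: 'X : {poly Kb}.
have evA : eval1 jK (bF xW) A = jK a0 + jK b0 * x.
  rewrite rmorphD /= eval1C eval1Z eval1X xE rmorphB !rmorphM /= fmorphV; ring.
have evA1 : eval1 jK (bF xW) A1 = jK c1 + jK d1 * x.
  rewrite rmorphD /= eval1C eval1Z eval1X xE rmorphB !rmorphM /= fmorphV; ring.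
(* Coefficients of 1, y2, y2^2 in the derivative of g(xW) - y2^3 = 0. The coefficient of y2 is g'
   times the y-component of [Dt xW], because the y-component of [Dt y2] contributes y2^3 = g to the
   constant term. *)
have [] := cb_indep_poly (p0 := r + G' * A - (3%:R * (e1 / mu)) *: G)
   (p1 := (c0 / mu) *: G') (p2 := - 3%:R *: A1) cb.
  have [B BE] : exists B, B = A by eexists.
  have [B1 B1E] : exists B1, B1 = A1 by eexists.
  rewrite -BE -B1E in evA evA1 *.
  rewrite /comb3 rmorphB rmorphD /= !eval1Z (rmorphM (eval1 jK (bF xW))) /= -YE evA evA1.
  rewrite !rmorphM rmorphN rmorph_nat /= fmorphV.
  move/eqP: rE; rewrite -subr_eq0 DxE DyE => /eqP rE.
  apply: oppr_inj; rewrite oppr0 -[RHS]rE [in X in _ = X]yE; field.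
  exact: jmu0.
move=> _ /eqP; rewrite scaler_eq0 mulf_eq0 invr_eq0 (negPf mu0) orbF => /orP [/eqP -> //|].
rewrite G'E GE deriv_map map_poly_eq0 => /eqP g'0.
move: sepg; rewrite unlock /separable_poly.body g'0 coprimep0 -size_poly_eq1.
by rewrite g5.
Qed.

End DerivationStep.

(** * Reduced coordinates of the flag *)

Section Coordinates.
Variables (K Kb F Fb : fieldType) (iota : {rmorphism K -> Kb}).
Variables (j : {rmorphism K -> F}) (jF : {rmorphism F -> Fb}).
Variable jK : {rmorphism Kb -> Fb}.
Hypothesis H : is_base_change iota j jF jK.

Definition lincomb m (f : 'I_m.+1 -> F) (c : 'I_m.+1 -> Kb) : Fb :=
  \sum_l jF (f l) * jK (c l).

Lemma lincombD m (f : 'I_m.+1 -> F) c d :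
  lincomb f (fun l => c l + d l) = lincomb f c + lincomb f d.
Proof. by rewrite -big_split; apply: eq_bigr => l _; rewrite rmorphD mulrDr. Qed.

Lemma lincombZ m (f : 'I_m.+1 -> F) e c :
  lincomb f (fun l => e * c l) = jK e * lincomb f c.
Proof. by rewrite mulr_sumr; apply: eq_bigr => l _; rewrite rmorphM mulrCA. Qed.

Lemma lincomb_const m (f : 'I_m.+1 -> F) c : f ord0 = 1 ->
  lincomb f (fun l => c * (l == ord0)%:R) = jK c.
Proof.
move=> f0; rewrite /lincomb (bigD1 ord0) //= f0 rmorph1 mul1r mulr1 big1 ?addr0 //.
by move=> l /negPf ->; rewrite mulr0 rmorph0 mulr0.
Qed.

Lemma lincomb_inj m (f : 'I_m.+1 -> F) c d : lin_indep j f ->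
  lincomb f c = lincomb f d -> c =1 d.
Proof.
move=> fI /eqP; rewrite -subr_eq0 => /eqP cd l; apply/eqP; rewrite -subr_eq0; apply/eqP.
have [_ _ bI] := H; apply: (bI _ _ fI (fun l => c l - d l)); rewrite -[RHS]cd -sumrB.
by apply: eq_bigr => i _ /=; rewrite rmorphB; ring.
Qed.

(** Row reduction with pivots at [ord0], [l1], [l2], the constant 1 being the first unit vector as
    [f ord0 = 1]. A missing pivot would make x constant or y an affine function of x. [A l2] may be
    arbitrary since the smaller span <1, x> is preserved on its own. *)
Lemma reduced_coordinates x y : cubic_basis jK x y ->
  exists m (f : 'I_m.+1 -> F) (A B : 'I_m.+1 -> Kb) l1 l2 k1 k0 mu nu la,
  [/\ [/\ f ord0 = 1, lin_indep j f, k1 != 0 & mu != 0],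
      lincomb f A = jK k1 * x + jK k0,
      lincomb f B = jK mu * y + jK nu * lincomb f A + jK la,
      A ord0 = 0 /\ A l1 = 1
    & [/\ B ord0 = 0, B l1 = 0 & B l2 = 1]].
Proof.
move=> cb.
have [m [f [w [f0 fI wE]]]] := common_basis H (fun i : 'I_2 => if i == ord0 then x else y).
have := wE ord0; have := wE (lift ord0 ord0); rewrite /= -!/(lincomb _ _).
move: (w _) (w _) => al be yE xE {w wE}.
have [l1 al1] : exists l, al l - al ord0 * (l == ord0)%:R != 0.
  apply/existsP; apply/contraT; rewrite negb_exists => /forallP al0.
  have : eval1 jK x ('X - (al ord0)%:P) = 0.
    apply/eqP; rewrite eval1_XsubC subr_eq0 xE -(lincomb_const _ f0); apply/eqP.
    apply: eq_bigr => l _; congr (_ * jK _).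
    by apply/eqP; rewrite -subr_eq0; have := al0 l; rewrite negbK.
  by move=> /(cb_trans cb) /eqP; rewrite polyXsubC_eq0.
set e1 := al l1 - _ in al1.
pose A l := e1^-1 * (al l + - al ord0 * (l == ord0)%:R).
have AE : lincomb f A = jK e1^-1 * x + jK (e1^-1 * - al ord0).
  by rewrite /A lincombZ lincombD lincomb_const // -xE mulrDr rmorphM.
have A0 : A ord0 = 0 by rewrite /A eqxx mulr1 subrr mulr0.
have A1 : A l1 = 1 by rewrite /A mulNr mulVf.
have l10 : (l1 == ord0) = false.
  by apply/eqP => l10; move: A1; rewrite l10 A0 => /eqP; rewrite eq_sym oner_eq0.
pose be' l := be l + - be ord0 * (l == ord0)%:R + - be l1 * A l.
have [l2 be2] : exists l, be' l != 0.
  apply/existsP; apply/contraT; rewrite negb_exists => /forallP be0.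
  have be'0 : lincomb f be' = 0.
    by apply: big1 => l _; have := be0 l; rewrite negbK => /eqP ->; rewrite rmorph0 mulr0.
  have [|_ /eqP] := cb_indep_poly (x := x) (y := y)
    (p0 := (- be ord0 - be l1 * (e1^-1 * - al ord0))%:P - (be l1 * e1^-1) *: 'X)
    (p1 := 1) (p2 := 0) cb; last by rewrite oner_eq0.
  rewrite -[RHS]be'0 /be' !lincombD lincomb_const // lincombZ -yE AE /comb3.
  rewrite rmorph0 rmorph1 mul0r addr0 mul1r rmorphB /= eval1Z eval1X eval1C.
  by rewrite !(rmorphB, rmorphN, rmorphM); ring.
set e2 := be' l2 in be2.
have be'E : lincomb f be' = y - jK (be ord0) - jK (be l1) * lincomb f A.
  by rewrite /be' !lincombD lincomb_const // lincombZ -yE !rmorphN mulNr.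
exists m, f, A, (fun l => e2^-1 * be' l), l1, l2, e1^-1, (e1^-1 * - al ord0), e2^-1,
  (- (e2^-1 * be l1)), (- (e2^-1 * be ord0)).
split=> //.
- by split; rewrite ?invr_eq0.
- by rewrite lincombZ be'E !(rmorphN, rmorphM); ring.
- rewrite /be' A0 A1 eqxx l10 /= mulVf // !(mulr1n, mulr0n).
  by split=> //; ring.
Qed.

End Coordinates.

(** * Rationality of the reduced coordinates *)

Section RationalCoordinates.
Variables (K : fieldType) (Kb : closedFieldType) (F Fb : fieldType).
Variables (iota : {rmorphism K -> Kb}) (j : {rmorphism K -> F}).
Variables (jF : {rmorphism F -> Fb}) (jK : {rmorphism Kb -> Fb}).
Hypothesis H : is_base_change iota j jF jK.
Hypothesis three_neq0 : 3%:R != 0 :> Kb.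
Hypothesis alg : forall e : Kb, algebraicOver iota e.
Variables (n : nat) (u : 'I_n.+1 -> F).
Hypothesis u_neq0 : exists i, u i != 0.
Hypothesis u_gen : generates_function_field j u.
Hypothesis u_smooth : forall c : 'I_n.+1 -> Kb,
  geometric_point j u iota c -> smooth_at j u iota c.
Variables (x y : Fb) (s : seq Kb).
Hypothesis ku : kummer jK x y s [::].
Hypothesis s4 : size s = 4%N.
Hypothesis same_fixing : forall x' y' s',
  kummer jK x' y' s' [::] -> size s' = 4%N -> fixing jK x = fixing jK x'.

Lemma rational_coordinates : exists x1 y1 k1 k0 mu nu la,
  [/\ k1 != 0, mu != 0, jF x1 = jK k1 * x + jK k0
    & jF y1 = jK mu * y + jK nu * jF x1 + jK la].
Proof.
have [m [f [A [B [l1 [l2 [k1 [k0 [mu [nu [la [[f0 fI k10 mu0] AE BE [A0 A1] [B0 B1 B2]]]]]]]]]]]]]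
  := reduced_coordinates H (ku_basis ku).
pose E := codom A ++ codom B.
have AinE l : A l \in E by rewrite mem_cat codom_f.
have BinE l : B l \in E by rewrite mem_cat codom_f orbT.
have [EK|EK] := pselect (forall e, e \in E -> exists c, e = iota c).
  have [A' A'E] := choice (fun l => EK _ (AinE l)).
  have [B' B'E] := choice (fun l => EK _ (BinE l)).
  have down C C' : (forall l, C l = iota (C' l)) ->
      jF (\sum_l f l * j (C' l)) = lincomb jF jK f C.
    move=> CE; rewrite rmorph_sum; apply: eq_bigr => l _ /=.
    by rewrite CE rmorphM; case: H => ->.
  exists (\sum_l f l * j (A' l)), (\sum_l f l * j (B' l)), k1, k0, mu, nu, la.
  by rewrite (down _ _ A'E) (down _ _ B'E).
(* A moving map de will be shown to satisfy de w = de 1 times b w on the coordinates. For an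
   embedding de 1 = 1, for a derivation de 1 = 0, so no coordinate is moved after all. *)
exfalso; have [W [a [b [ba Eb mov]]]] := exists_moving_map alg EK.
have [A' A'E] := choice (fun l => Eb _ (AinE l)).
have [B' B'E] := choice (fun l => Eb _ (BinE l)).
have [FW [jFW [jW [bF [HW bFF bFW]]]]] := base_change_tower H alg ba.
pose up C' := \sum_l jFW (f l) * jW (C' l).
have upE C C' : (forall l, C l = b (C' l)) -> bF (up C') = lincomb jF jK f C.
  move=> CE; rewrite rmorph_sum; apply: eq_bigr => l _ /=.
  by rewrite CE rmorphM bFF bFW.
have xWE : bF (up A') = jK k1 * x + jK k0 by rewrite (upE _ _ A'E).
have yWE : bF (up B') = jK mu * y + jK nu * bF (up A') + jK la.
  by rewrite (upE _ _ A'E) (upE _ _ B'E).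
have jk10 : jK k1 != 0 by rewrite fmorph_eq0.
have jmu0 : jK mu != 0 by rewrite fmorph_eq0.
have binj := fmorph_inj b.
have A'0 : A' ord0 = 0 by apply: binj; rewrite -A'E A0 rmorph0.
have B'0 : B' ord0 = 0 by apply: binj; rewrite -B'E B0 rmorph0.
have A'1 : A' l1 = 1 by apply: binj; rewrite -A'E A1 rmorph1.
have B'1 : B' l1 = 0 by apply: binj; rewrite -B'E B1 rmorph0.
have B'2 : B' l2 = 1 by apply: binj; rewrite -B'E B2 rmorph1.
(* An additive map that preserves the spans of 1, x and of 1, x, y is determined
   on the reduced coordinates by its value at 1. *)
have rigid (de : W -> Kb) : de 0 = 0 ->
    (exists a0 b0, lincomb jF jK f (de \o A') = jK a0 + jK b0 * x) ->
    (exists a0 b0 c0, lincomb jF jK f (de \o B') = jK a0 + jK b0 * x + jK c0 * y) ->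
    forall w, b w \in E -> de w = de 1 * b w.
  move=> de0 [a0 [b0 dA]] [a1 [b1 [c1 dB]]].
  have l10 : (l1 == ord0) = false.
    by apply/eqP => l10; move: A1; rewrite l10 A0 => /eqP; rewrite eq_sym oner_eq0.
  have l20 : (l2 == ord0) = false.
    by apply/eqP => l20; move: B2; rewrite l20 B0 => /eqP; rewrite eq_sym oner_eq0.
  have xE : x = jK k1^-1 * lincomb jF jK f A - jK (k1^-1 * k0).
    by rewrite AE !rmorphM fmorphV; field.
  have yE : y = jK mu^-1 * lincomb jF jK f B - jK (mu^-1 * nu) * lincomb jF jK f A
      - jK (mu^-1 * la).
    by rewrite BE !rmorphM fmorphV; field.
  have dAE : de \o A' =1 fun l => (a0 - b0 * (k1^-1 * k0)) * (l == ord0)%:R + (b0 * k1^-1) * A l.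
    apply: (lincomb_inj H fI); rewrite lincombD lincomb_const // lincombZ dA xE.
    by rewrite rmorphB !rmorphM; ring.
  have dBE : de \o B' =1 fun l => (a1 - b1 * (k1^-1 * k0) - c1 * (mu^-1 * la)) * (l == ord0)%:R +
     ((b1 * k1^-1 - c1 * (mu^-1 * nu)) * A l + (c1 * mu^-1) * B l).
    apply: (lincomb_inj H fI); rewrite !lincombD lincomb_const // !lincombZ dB yE xE.
    by rewrite !rmorphB !rmorphM; ring.
  (* At the pivots the old coordinates are 0 or 1, and [de] is known there; reading off these
     entries gives p = r = t = 0 and q = v = de 1. *)
  move: (a0 - _) (b0 / k1) (a1 - _ - _) (b1 / k1 - _) (c1 / mu) dAE dBE => p q r t v dAE dBE.
  have p0 : p = 0.
    by have := dAE ord0; rewrite /= A'0 de0 A0 mulr1 mulr0 addr0.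
  have q1 : q = de 1.
    by have := dAE l1; rewrite /= A'1 A1 l10 p0 mul0r add0r mulr1.
  have r0 : r = 0.
    by have := dBE ord0; rewrite /= B'0 de0 A0 B0 mulr1 !mulr0 !addr0.
  have t0 : t = 0.
    by have := dBE l1; rewrite /= B'1 de0 A1 B1 l10 r0 mul0r add0r mulr1 mulr0 addr0.
  have v1 : v = de 1.
    by have := dBE l2; rewrite /= B'2 B2 r0 t0 !mul0r !add0r mulr1.
  move=> w; rewrite mem_cat => /orP [] /codomP [l wl].
    have -> : w = A' l by apply: binj; rewrite wl A'E.
    by rewrite -A'E; have := dAE l; rewrite /= p0 q1 mul0r add0r.
  have -> : w = B' l by apply: binj; rewrite wl B'E.
  by rewrite -B'E; have := dBE l; rewrite /= r0 t0 v1 !mul0r !add0r.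
case: mov => [[sg [sga [w wE sw]]]|[D [DD DM Da [w wE Dw]]]].
  have sgj c : sg (a c) = iota c by exact: sga.
  have [|sF [sFF sFW]] := morphism_extend HW (g := jF) (psi := jK \o sg).
    by move=> c /=; rewrite sgj; case: H => ->.
  have [a0 [b0 [c0 [d0 [e0 [xs ys]]]]]] := galois_step H three_neq0 ku s4 same_fixing
    HW bFF bFW k10 mu0 xWE yWE sFF sFW.
  have sup C' : sF (up C') = lincomb jF jK f (sg \o C').
    by rewrite rmorph_sum; apply: eq_bigr => l _ /=; rewrite rmorphM sFF sFW.
  apply: sw; rewrite (rigid sg) ?rmorph0 ?rmorph1 ?mul1r //.
    by exists a0, b0; rewrite -sup.
  by exists c0, d0, e0; rewrite -sup.
have D0 : D 0 = 0 by apply: (addrI (D 0)); rewrite -DD !addr0.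
have D1 : D 1 = 0 by rewrite -(rmorph1 a) Da.
have [Dt [DtD DtM DtF DtW]] := derivation_extend HW bFF bFW DD DM Da.
have HWb := base_change_cancel H HW bFF bFW.
have [n' [l' [g [y2E g5 sepg y2y cb2]]]] := quartic_descent HWb three_neq0 ku s4 k10 mu0 xWE yWE.
set y2 := up B' - _ - _ in y2E y2y cb2.
have [a0 [b0 [c0 [d0 [e0 [xs ys]]]]]] := derivation_step H three_neq0 u_neq0 u_gen u_smooth
  ku s4 HW bFF bFW DtD DtM DtF DtW k10 mu0 xWE y2y y2E sepg g5 cb2.
have Dup C' : Dt (up C') = lincomb jF jK f (D \o C').
  rewrite (derivation_sum DtD); apply: eq_bigr => l _ /=.
  by rewrite DtM DtF DtW mulr0 addr0 bFF.
have yWe : Dt (up B') = Dt y2 + (jK (b n') * Dt (up A') + bF (up A') * jK (D n')) + jK (D l').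
  have -> : up B' = y2 + jW n' * up A' + jW l' by rewrite /y2; ring.
  by rewrite !DtD DtM !DtW bFW.
apply: Dw; rewrite (rigid D) ?D1 ?mul0r //.
  by exists a0, b0; rewrite -Dup.
exists (c0 + b n' * a0 + k0 * D n' + D l'), (d0 + b n' * b0 + k1 * D n'), e0.
rewrite -Dup yWe xs ys xWE !rmorphD !rmorphM /=; ring.
Qed.

End RationalCoordinates.

(** * Scaling to a monic quartic and conclusion *)

Lemma monic_quartic (K F : fieldType) (j : {rmorphism K -> F}) x y g :
  cubic_basis j x y -> y ^+ 3 = eval1 j x g -> size g = 5%N -> separable_poly g ->
  exists x' y' f, [/\ cubic_basis j x' y', y' ^+ 3 = eval1 j x' f, f \is monic,
    size f = 5%N & separable_poly f].
Proof.
move=> cb yE g5 sepg; pose k := lead_coef g.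
have k0 : k != 0 by rewrite lead_coef_eq0 -size_poly_eq0 g5.
have jk0 : j k != 0 by rewrite fmorph_eq0.
have q2 : size (k^-1 *: 'X : {poly K}) = 2%N by rewrite size_scale ?invr_eq0 ?size_polyX.
have sf : size (k ^+ 3 *: (g \Po (k^-1 *: 'X))) = 5%N.
  by rewrite size_scale ?expf_neq0 // size_comp_poly2.
(* Scaling x and y by the leading coefficient k of g changes it to k^3 k k^-4 = 1, so no root
   extraction in [K] is involved. *)
exists (j k * x), (j k * y), (k ^+ 3 *: (g \Po (k^-1 *: 'X))); split=> //.
- apply: (cubic_basis_scale cb) => //.
  + move=> p; have -> : j k * x = eval1 j x (k *: 'X) by rewrite eval1Z eval1X.
    rewrite -eval1_comp => /(cb_trans cb) /eqP.
    by rewrite comp_poly2_eq0 ?size_scale ?size_polyX // => /eqP.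
  + by apply: simple_subfieldM; [exact: simple_subfield_const|exact: simple_subfield_id].
  + rewrite -{2}[x](mulKf jk0) -fmorphV.
    by apply: simple_subfieldM; [exact: simple_subfield_const|exact: simple_subfield_id].
  + exact: simple_subfield_const.
- by rewrite exprMn yE eval1Z eval1_comp eval1Z eval1X fmorphV mulKf // rmorphXn.
- rewrite monicE lead_coefZ lead_coef_comp ?q2 // lead_coefZ lead_coefX mulr1 g5.
  by rewrite -/k mulrA -exprSr exprVn divff ?expf_neq0.
have : separable_poly (g \Po (k^-1 *: 'X)) by exact: separable_comp.
by rewrite !unlock /separable_poly.body derivZ coprimepZl ?coprimepZr ?expf_neq0.
Qed.

Lemma function_field_cubic (K F : fieldType) (j : {rmorphism K -> F}) x y f :
  cubic_basis j x y -> y ^+ 3 = eval1 j x f -> function_field_of_equation j ('X^3 - f%:P).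
Proof.
move=> cb yE; exists x, y; split; first exact: cubic_kernel.
move=> z; have [d [p0 [p1 [p2 [d0 zd]]]]] := cb_span_poly z cb.
have d0' : eval1 j x d != 0 by rewrite transcendental_neq0 //; exact: cb_trans cb.
exists (poly3 p0 p1 p2), d%:P; rewrite eval2C eval2_poly3; split=> //.
by rewrite -zd mulfK.
Qed.

Theorem theorem1p18 (K : fieldType) (hchar : 3%N \notin [pchar K])
    (Kb : closedFieldType) (iota : {rmorphism K -> Kb})
    (hKb : forall a : Kb, algebraicOver iota a)
    (Y : smooth_projective_curve iota)
    (hY : nonspecial_picard_curve Y) :
  exists (f : {poly K}) (c1 c2 c3 c4 : K),
    [/\ f = 'X^4 + c1 *: 'X^3 + c2 *: 'X^2 + c3 *: 'X + c4%:P,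
        f \is monic,
        separable_poly f
      & given_by_equation Y ('X^3 - f%:P)].
Proof.
have three_neq0 : 3%:R != 0 :> Kb by rewrite -(rmorph_nat iota) fmorph_eq0.
have [pic nspec] := hY; have [gen3 [x0 gal]] := pic.
have [x [y [s [ku s4]]]] := picard_kummer three_neq0 gen3 gal.
have dist x' y' s' : kummer (geom_const Y) x' y' s' [::] -> size s' = 4%N ->
    distinguished (fixing (geom_const Y) x').
  move=> ku' s'4; have [|sub card quo] := fixing_distinguished three_neq0 (ku_basis ku').
    by rewrite (ku_eq ku'); exact: simple_subfield_eval.
  by split.
(* Nonspeciality enters only here: two quartic models with different groups would give two
   distinguished subgroups. *)
have same x' y' s' : kummer (geom_const Y) x' y' s' [::] -> size s' = 4%N ->
    fixing (geom_const Y) x = fixing (geom_const Y) x'.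
  move=> ku' s'4; apply: contrapT => ne; apply: nspec; split=> //.
  exists (fixing (geom_const Y) x), (fixing (geom_const Y) x').
  by split=> //; [exact: dist ku s4|exact: dist ku' s'4].
have H := curve_base_change Y.
have [x1 [y1 [k1 [k0 [mu [nu [la [k10 mu0 x1E y1E]]]]]]]] :=
  rational_coordinates H three_neq0 hKb (generic_point_neq0 Y) (@curve_fun_field _ _ _ Y)
    (@curve_smooth _ _ _ Y) ku s4 same.
have [n' [l' [g [y2E g5 sepg _ cb2]]]] := quartic_descent H three_neq0 ku s4 k10 mu0 x1E y1E.
have [x3 [y3 [f [cb3 y3E fm f5 sepf]]]] := monic_quartic cb2 y2E g5 sepg.
exists f, f`_3, f`_2, f`_1, f`_0; split=> //; last exact: function_field_cubic cb3 y3E.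
have f4 : f`_4 = 1 by have := monicP fm; rewrite lead_coefE f5.
apply/polyP => i; rewrite !coefD !coefZ !coefXn coefX coefC.
case: i => [|[|[|[|[|i]]]]] /=; rewrite ?f4 ?mulr0 ?mulr1 ?add0r ?addr0 //.
by rewrite nth_default // f5.
Qed.
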